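(* The following hold. (i) $\mathcal{O}_{1,4}(\mathbb{Q})=\mathbb{Q}\big[g_{1,4}(\tau),\,g_{1,4}(\tau)^{-1},\,(g_{1,4}(\tau)-16)^{-1}\big]$. (ii) $\mathcal{O}^1_4(\mathbb{Q})=\mathbb{Q}\big[g^1_4(\tau),\,g^1_4(\tau)^{-1},\,(g^1_4(\tau)-16)^{-1}\big]$, where $g^1_4(\tau)=g_{1,4}(\tau/4)=g_{\left[\begin{smallmatrix}1/4\\0\end{smallmatrix}\right]}(\tau)^{-8}g_{\left[\begin{smallmatrix}1/2\\0\end{smallmatrix}\right]}(\tau)^{8}$.
   Context: Let $\mathbb{H}$ be the complex upper half-plane and $q=e^{2\pi i\tau}$. For $N\ge1$, let $\Gamma_1(N)=\{\gamma\in\mathrm{SL}_2(\mathbb{Z}):\gamma\equiv\left[\begin{smallmatrix}1&*\\0&1\end{smallmatrix}\right]\pmod N\}$ and $\Gamma^1(N)=\{\gamma\in\mathrm{SL}_2(\mathbb{Z}):\gamma\equiv\left[\begin{smallmatrix}1&0\\ *&1\end{smallmatrix}\right]\pmod N\}$. $\mathcal{F}_{1,N}(\mathbb{Q})$ (resp. $\mathcal{F}^1_N(\mathbb{Q})$) is the field of meromorphic modular functions (meromorphic also at the cusps) for $\Gamma_1(N)$ (resp. $\Gamma^1(N)$) with rational Fourier coefficients, in powers of $q$ (resp. $q^{1/N}$). $\mathcal{O}_{1,N}(\mathbb{Q})$ (resp. $\mathcal{O}^1_N(\mathbb{Q})$) is its subring of functions holomorphic on $\mathbb{H}$. Siegel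 functions: for $\mathbf{v}=\left[\begin{smallmatrix}v_1\\ v_2\end{smallmatrix}\right]\in\mathbb{Q}^2\setminus\mathbb{Z}^2$, $$g_{\mathbf{v}}(\tau)=-e^{\pi i v_2(v_1-1)}q^{\frac12\mathbf{B}_2(v_1)}(1-q^{v_1}e^{2\pi iv_2})\prod_{n=1}^\infty(1-q^{n+v_1}e^{2\pi iv_2})(1-q^{n-v_1}e^{-2\pi iv_2}),\quad \mathbf{B}_2(x)=x^2-x+\tfrac16.$$ Put $$g_{1,4}(\tau)=\left(\frac{g_{\left[\begin{smallmatrix}1/2\\0\end{smallmatrix}\right]}(4\tau)}{g_{\left[\begin{smallmatrix}1/4\\0\end{smallmatrix}\right]}(4\tau)}\right)^{8}=q^{-1}(1+q)^8\prod_{n=1}^\infty\left(\frac{(1-q^{4n+2})(1-q^{4n-2})}{(1-q^{4n+1})(1-q^{4n-1})}\right)^8.$$ *)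

(* Defs.v *)
From Stdlib Require Import Reals ZArith QArith Qreals List.
From Coquelicot Require Import Coquelicot.
Open Scope C_scope.

(* Functions on the upper half-plane are represented by total functions C -> C
   of which only the values on [UHP] matter. *)
Definition UHP (tau : C) : Prop := (0 < Im tau)%R.

Definition Cexp (z : C) : C :=
  RtoC (exp (Re z)) * (cos (Im z), sin (Im z)).

(* q^r = exp (2 pi i r tau); q itself is [qpow 1 tau]. *)
Definition qpow (r : R) (tau : C) : C :=
  Cexp (RtoC (2 * PI * r) * Ci * tau).

(* Complex differentiability, at every point of a neighbourhood. *)
Definition holomorphic_at (f : C -> C) (z : C) : Prop :=
  locally z (fun w => @ex_derive C_AbsRing C_NormedModule f w).

Definition holomorphic (f : C -> C) : Prop :=
  forall tau : C, UHP tau -> holomorphic_at f tau.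

(* By convention a meromorphic function is given the value 0 at its poles; with
   removable singularities removed, a meromorphic function on [UHP] is thus
   represented by exactly one function on [UHP]. *)
Definition pole_at (f : C -> C) (z : C) : Prop :=
  locally' z (fun w => @ex_derive C_AbsRing C_NormedModule f w) /\
  filterlim (fun w => Cmod (f w)) (locally' z) (Rbar_locally p_infty) /\
  f z = 0.

Definition meromorphic (f : C -> C) : Prop :=
  forall tau : C, UHP tau -> holomorphic_at f tau \/ pole_at f tau.

Record SL2Z := mkSL2Z {
  sl_a : Z; sl_b : Z; sl_c : Z; sl_d : Z;
  sl_det : (sl_a * sl_d - sl_b * sl_c = 1)%Z
}.

Definition mobius (g : SL2Z) (tau : C) : C :=
  (RtoC (IZR (sl_a g)) * tau + RtoC (IZR (sl_b g))) /
  (RtoC (IZR (sl_c g)) * tau + RtoC (IZR (sl_d g))).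

Definition Gamma_lower1 (N : positive) (g : SL2Z) : Prop :=
  (Zpos N | sl_a g - 1)%Z /\ (Zpos N | sl_c g)%Z /\ (Zpos N | sl_d g - 1)%Z.

Definition Gamma_upper1 (N : positive) (g : SL2Z) : Prop :=
  (Zpos N | sl_a g - 1)%Z /\ (Zpos N | sl_b g)%Z /\ (Zpos N | sl_d g - 1)%Z.

Definition invariant_under (G : SL2Z -> Prop) (f : C -> C) : Prop :=
  forall g : SL2Z, G g -> forall tau : C, UHP tau -> f (mobius g tau) = f tau.

(* f tau = sum_(n >= 0) a_n q^((n - m) / h) when Im tau is large: a Fourier
   expansion in powers of q^(1/h), of finite principal part. *)
Definition fourier_expansion (h : positive) (f : C -> C) (m : nat)
    (a : nat -> C) : Prop :=
  exists Y : R, forall tau : C, UHP tau -> (Y < Im tau)%R ->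
    let qh := qpow (/ IZR (Zpos h)) tau in
    @is_pseries C_AbsRing C_NormedModule a qh (qh ^ m * f tau).

(* For a function of level N (invariant under the principal congruence subgroup
   of level N), whose translates under SL_2(Z) all have period N. *)
Definition meromorphic_at_cusps (N : positive) (f : C -> C) : Prop :=
  forall g : SL2Z, exists (m : nat) (a : nat -> C),
    fourier_expansion N (fun tau => f (mobius g tau)) m a.

Definition rational_fourier_coefficients (h : positive) (f : C -> C) : Prop :=
  exists (m : nat) (r : nat -> Q),
    fourier_expansion h f m (fun n => RtoC (Q2R (r n))).

Definition F_lower1 (N : positive) (f : C -> C) : Prop :=
  meromorphic f /\ invariant_under (Gamma_lower1 N) f /\
  meromorphic_at_cusps N f /\ rational_fourier_coefficients 1 f.

Definition F_upper1 (N : positive) (f : C -> C) : Prop :=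
  meromorphic f /\ invariant_under (Gamma_upper1 N) f /\
  meromorphic_at_cusps N f /\ rational_fourier_coefficients N f.

Definition O_lower1 (N : positive) (f : C -> C) : Prop :=
  F_lower1 N f /\ holomorphic f.

Definition O_upper1 (N : positive) (f : C -> C) : Prop :=
  F_upper1 N f /\ holomorphic f.

(* The ring Q[gens] of functions on [UHP]; -1 is a rational constant, so closure
   under opposites is automatic. *)
Inductive Q_adjoin (gens : list (C -> C)) : (C -> C) -> Prop :=
| Q_adjoin_const (r : Q) : Q_adjoin gens (fun _ => RtoC (Q2R r))
| Q_adjoin_gen (f : C -> C) : In f gens -> Q_adjoin gens f
| Q_adjoin_add (f1 f2 : C -> C) : Q_adjoin gens f1 -> Q_adjoin gens f2 ->
    Q_adjoin gens (fun tau => f1 tau + f2 tau)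
| Q_adjoin_mul (f1 f2 : C -> C) : Q_adjoin gens f1 -> Q_adjoin gens f2 ->
    Q_adjoin gens (fun tau => f1 tau * f2 tau)
| Q_adjoin_eq (f1 f2 : C -> C) : Q_adjoin gens f1 ->
    (forall tau : C, UHP tau -> f1 tau = f2 tau) -> Q_adjoin gens f2.

(* u 1 * u 2 * ... * u n *)
Fixpoint Cprod (u : nat -> C) (n : nat) : C :=
  match n with
  | O => 1
  | S k => Cprod u k * u (S k)
  end.

(* The product over all n >= 1, as the limit of the partial products. *)
Definition Cinfprod (u : nat -> C) : C :=
  (real (Lim_seq (fun n => Re (Cprod u n))),
   real (Lim_seq (fun n => Im (Cprod u n)))).

Definition B2 (x : R) : R := (x ^ 2 - x + / 6)%R.

(* Meant for (v1, v2) not in Z^2. *)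
Definition siegel (v1 v2 : Q) (tau : C) : C :=
  let x1 := Q2R v1 in
  let x2 := Q2R v2 in
  - Cexp (RtoC (PI * x2 * (x1 - 1)) * Ci)
  * qpow (/ 2 * B2 x1) tau
  * (1 - qpow x1 tau * Cexp (RtoC (2 * PI * x2) * Ci))
  * Cinfprod (fun n =>
      (1 - qpow (INR n + x1) tau * Cexp (RtoC (2 * PI * x2) * Ci))
    * (1 - qpow (INR n - x1) tau * Cexp (- (RtoC (2 * PI * x2) * Ci)))).

Definition g_lower14 (tau : C) : C :=
  (siegel (1 # 2) 0 (4 * tau) / siegel (1 # 4) 0 (4 * tau)) ^ 8.

Definition g_upper14 (tau : C) : C := g_lower14 (tau / 4).

(* Main.v *)
(* Write e(x) = exp(2 pi i x), q = e(tau), g = g_(1,4), S tau = -1/tau and W tau = -1/(4 tau).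

   The theta function theta_u(z) = (1 - e(z)) prod (1 - e(nu + z)) (1 - e(nu - z)) has its zeros exactly at Z + Zu, and
   a Gaussian factor times theta_(-1/u)(z/u) / theta_u(z) is an elliptic function without poles, hence constant by the
   maximum principle (which rests on Goursat's theorem, since only complex differentiability is assumed).
   Evaluating it at the points u/2 and u/4 for u = 4 tau, together with Euler's identity prod (1 + q^n) (1 - q^(2n-1)) = 1,
   gives g(W tau) g(tau + 1/2) = -16 g(tau).

   A holomorphic function on the upper half-plane which is invariant under the two parabolic generators of Gamma_1(4),
   has limits at the three cusps and vanishes at infinity is zero: multiplied with its translates by these limits it
   vanishes at all cusps, so its modulus has a maximum, and the maximum principle applies. Applied to
   g(tau) + g(tau + 1/2) this gives Jacobi's identity g(tau) + g(tau + 1/2) = 16. Hence g and g - 16 have no zeros,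
   g(W tau) = 16 g / (g - 16), and these relations determine g(gamma tau) for every gamma in SL_2(Z).

   Conversely, if f lies in O_(1,4)(Q), then f g^M (g - 16)^M vanishes at the cusps 0 and 1/2 for large M;
   subtracting rational multiples of powers of g removes its pole at infinity, and what remains is a constant.
   The group Gamma^1(4) is conjugate to Gamma_1(4) by tau -> 4 tau. *)

(* Zeros are never counted, neither by a valence formula nor by residues: by Jacobi's identity
   [g - 16] is the negative of g(tau + 1/2), and that is a value of a product without zeros. The
   constant of the theta inversion is never determined either: [g] is built from a quotient of two
   theta values, so comparing the points u/2 and u/4 eliminates it, and the eta function does not
   enter. The number 16 is 2^8 / (1 - i)^8, where 2 = 1 - e(1/2) and 1 - i = 1 - e(1/4) are the
   leading factors of the theta values; the sign in -16 is e(1/2). It is also the value of [g] at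
   the cusp 0. From Goursat's theorem only the mean value property on circles is drawn. No
   holomorphic function is expanded in a power series: every expansion is a hypothesis on f or comes
   from explicit products. Euler's identity makes both [g] and its inverse such products, so no
   series has to be inverted. Rationality is carried along by doing the power series calculus over a
   subring k of the complex numbers: the rationals at infinity, everything at the other cusps, where
   roots of unity occur. *)
Require Import Defs.
From Stdlib Require Import Reals ZArith QArith Qreals List Lra Lia Psatz ClassicalEpsilon.
From Coquelicot Require Import Coquelicot.
Open Scope R_scope.
Open Scope C_scope.
Arguments Cmod _%_C_scope.
Arguments Cexp _%_C_scope.
Arguments Re _%_C_scope.
Arguments Im _%_C_scope.

(** * Complex derivatives *)

(** The increment form, without a quotient: [h = 0] needs no exception, and estimates can be made on
    [Cmod] directly. *)
Definition cder (f : C -> C) (z d : C) : Prop :=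
  forall eps : R, (0 < eps) -> exists del : R, (0 < del) /\
    forall h : C, (Cmod h < del) -> (Cmod (f (z + h) - f z - d * h) <= eps * Cmod h).

(* Coquelicot has two normed-module structures on C over itself; the product and chain rules are stated for this one. *)
Lemma cder_is_derive_ring f z d :
  cder f z d <-> @is_derive C_AbsRing (AbsRing_NormedModule C_AbsRing) f z d.
Proof.
split.
- intros H. split. apply is_linear_scal_l.
  intros x Hx.
  assert (E : z = x) by exact (is_filter_lim_locally_unique (K:=C_AbsRing) (V:=AbsRing_NormedModule C_AbsRing) z x Hx).
  subst x. intros eps. destruct (H eps (cond_pos eps)) as [del [Hd H1]].
  exists (mkposreal del Hd). intros y Hy.
  specialize (H1 (y - z)). change (Cmod (y - z) < del) in Hy. specialize (H1 Hy).
  assert (E : forall y z : C, z + (y - z) = y) by (intros; ring).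
  rewrite E, (Cmult_comm d) in H1. exact H1.
- intros [_ H] eps Heps.
  specialize (H z (fun P HP => HP) (mkposreal eps Heps)).
  destruct H as [del H]. exists del. split. apply cond_pos.
  intros h Hh. specialize (H (z + h)).
  assert (B : ball (M := AbsRing_UniformSpace C_AbsRing) z del (z + h)).
  { change (Cmod (z + h - z) < del). replace (z + h - z) with h by ring. exact Hh. }
  specialize (H B). 
  change (Cmod (f (z + h) - f z - (z + h - z) * d) <= eps * Cmod (z + h - z)) in H.
  replace (z + h - z) with h in H by ring. rewrite (Cmult_comm d). exact H.
Qed.

Lemma cder_is_derive f z d :
  cder f z d <-> @is_derive C_AbsRing C_NormedModule f z d.
Proof. rewrite cder_is_derive_ring. split; intros [_ H]; (split; [apply is_linear_scal_l|exact H]). Qed.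

Lemma cder_ex f z d : cder f z d -> @ex_derive C_AbsRing C_NormedModule f z.
Proof. intros H. exists d. now apply cder_is_derive. Qed.

Lemma cder_plus f g z a b : cder f z a -> cder g z b -> cder (fun w => f w + g w) z (a + b).
Proof. rewrite !cder_is_derive. intros. now apply (is_derive_plus (K:=C_AbsRing) (V:=C_NormedModule)). Qed.
Lemma cder_opp f z a : cder f z a -> cder (fun w => - f w) z (- a).
Proof. rewrite !cder_is_derive. intros. now apply (is_derive_opp (K:=C_AbsRing) (V:=C_NormedModule)). Qed.
Lemma cder_minus f g z a b : cder f z a -> cder g z b -> cder (fun w => f w - g w) z (a - b).
Proof. rewrite !cder_is_derive. intros. now apply (is_derive_minus (K:=C_AbsRing) (V:=C_NormedModule)). Qed.
Lemma cder_const c z : cder (fun _ => c) z 0.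
Proof. intros eps He. exists 1%R. split. lra. intros h _. replace (c - c - 0 * h) with (RtoC 0) by ring.
  rewrite Cmod_0. apply Rmult_le_pos. lra. apply Cmod_ge_0. Qed.
Lemma cder_id z : cder (fun w => w) z 1.
Proof. intros eps He. exists 1%R. split. lra. intros h _. replace (z + h - z - 1 * h) with (RtoC 0) by ring.
  rewrite Cmod_0. apply Rmult_le_pos. lra. apply Cmod_ge_0. Qed.

Lemma cder_ext_loc f g z d :
  (exists r, (0 < r) /\ forall w, (Cmod (w - z) < r) -> f w = g w) -> cder f z d -> cder g z d.
Proof.
intros [r [Hr E]] H eps He. destruct (H eps He) as [del [Hd H1]].
exists (Rmin r del)%R. split. apply Rmin_glb_lt; lra.
intros h Hh. rewrite <- !E. apply H1.
- eapply Rlt_le_trans. apply Hh. apply Rmin_r.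
- replace (z - z) with (RtoC 0) by ring. now rewrite Cmod_0.
- replace (z + h - z) with h by ring. eapply Rlt_le_trans. apply Hh. apply Rmin_l.
Qed.
Lemma cder_ext f g z d : (forall w, f w = g w) -> cder f z d -> cder g z d.
Proof. intros E. apply cder_ext_loc. exists 1%R. split. lra. auto. Qed.

Lemma cder_eq f z d d' : d = d' -> cder f z d -> cder f z d'.
Proof. now intros ->. Qed.

Lemma cder_lipschitz f z d : cder f z d -> exists r L : R, (0 < r) /\ (0 < L) /\
  forall h, (Cmod h < r) -> (Cmod (f (z + h) - f z) <= L * Cmod h).
Proof.
intros H. destruct (H 1%R Rlt_0_1) as [del [Hd H1]].
exists del, (1 + Cmod d)%R. repeat split; trivial.
generalize (Cmod_ge_0 d); lra.
intros h Hh. replace (f (z + h) - f z) with ((f (z + h) - f z - d * h) + d * h) by ring.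
eapply Rle_trans. apply Cmod_triangle. rewrite Cmod_mult. specialize (H1 h Hh). lra.
Qed.

Definition ccont (f : C -> C) (z : C) : Prop :=
  forall eps : R, (0 < eps) -> exists del : R, (0 < del) /\
    forall w : C, (Cmod (w - z) < del) -> (Cmod (f w - f z) < eps).

Lemma cder_ccont f z d : cder f z d -> ccont f z.
Proof.
intros H eps He. destruct (cder_lipschitz f z d H) as (r & L & Hr & HL & H1).
exists (Rmin r (eps / L))%R. split. apply Rmin_glb_lt; trivial. now apply Rdiv_lt_0_compat.
intros w Hw. specialize (H1 (w - z)). replace (z + (w - z)) with w in H1 by ring.
eapply Rle_lt_trans. apply H1. eapply Rlt_le_trans. apply Hw. apply Rmin_l.
assert (H0 : Cmod (w - z) < eps / L) by (eapply Rlt_le_trans; [apply Hw| apply Rmin_r]).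
apply Rmult_lt_compat_l with (r := L) in H0; trivial.
replace (L * (eps / L))%R with eps in H0 by (field; lra). exact H0.
Qed.

Lemma cder_mult f g z a b : cder f z a -> cder g z b ->
  cder (fun w => f w * g w) z (a * g z + f z * b).
Proof. rewrite !cder_is_derive_ring. intros. apply (is_derive_mult (K:=C_AbsRing) f g z a b); trivial.
  intros; apply Cmult_comm. Qed.

Lemma cder_comp f g z a b : cder f (g z) a -> cder g z b -> cder (fun w => f (g w)) z (a * b).
Proof. rewrite !cder_is_derive_ring. intros H1 H2. rewrite (Cmult_comm a).
  apply (is_derive_comp (K:=C_AbsRing) (V:=AbsRing_NormedModule C_AbsRing) f g z a b); trivial. Qed.

Lemma Cmod_sub_ge (a b : C) : (Cmod a - Cmod b <= Cmod (a - b)).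
Proof. assert (H := Cmod_triangle (a - b) b). replace (a - b + b) with a in H by ring. lra. Qed.

Lemma Cmod_minus_sym (a b : C) : Cmod (a - b) = Cmod (b - a).
Proof. rewrite <- Cmod_opp. f_equal. ring. Qed.

Lemma cder_inv (z : C) : z <> 0 -> cder (fun w => / w) z (- / (z * z)).
Proof.
intros Hz eps He. assert (Hm := proj1 (Cmod_gt_0 z) Hz).
set (m := Cmod z) in *.
exists (Rmin (m / 2) (eps * m ^ 3 / 2))%R. split.
{ apply Rmin_glb_lt. lra. apply Rdiv_lt_0_compat; [|lra]. apply Rmult_lt_0_compat; trivial. now apply pow_lt. }
intros h Hh.
assert (h1 : (Cmod h < m / 2)) by (eapply Rlt_le_trans; [apply Hh| apply Rmin_l]).
assert (h2 : (Cmod h < eps * m ^ 3 / 2)) by (eapply Rlt_le_trans; [apply Hh| apply Rmin_r]).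
assert (A : (m / 2 <= Cmod (z + h))).
{ assert (X := Cmod_sub_ge z (- h)). rewrite Cmod_opp in X. replace (z - - h) with (z + h) in X by ring. fold m in X. lra. }
assert (N : z + h <> 0). { intros E. rewrite E, Cmod_0 in A. lra. }
replace (/ (z + h) - / z - - / (z * z) * h) with (h * h / (z * z * (z + h))) by (field; auto).
rewrite Cmod_div, !Cmod_mult; [| repeat apply Cmult_neq_0; auto].
fold m. apply Rmult_le_reg_r with (m * m * Cmod (z + h))%R.
{ repeat apply Rmult_lt_0_compat; lra. }
unfold Rdiv. rewrite Rmult_assoc, Rinv_l, Rmult_1_r.
2:{ apply Rgt_not_eq. repeat apply Rmult_lt_0_compat; lra. }
assert (0 <= Cmod h) by apply Cmod_ge_0.
apply Rle_trans with (Cmod h * (eps * m ^ 3 / 2))%R.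
{ apply Rmult_le_compat_l; lra. }
replace (eps * Cmod h * (m * m * Cmod (z + h)))%R with (Cmod h * (eps * (m * m) * Cmod (z + h)))%R by ring.
apply Rmult_le_compat_l; trivial.
replace (eps * m ^ 3 / 2)%R with (eps * (m * m) * (m / 2))%R by (simpl; field).
apply Rmult_le_compat_l; trivial. apply Rmult_le_pos. lra. apply Rmult_le_pos; lra.
Qed.

Lemma cder_div f g z a b : cder f z a -> cder g z b -> g z <> 0 ->
  cder (fun w => f w / g w) z ((a * g z - f z * b) / (g z * g z)).
Proof.
intros. eapply cder_eq; [|apply cder_mult; [eassumption|eapply (cder_comp (fun w => / w) g); [now apply cder_inv|eassumption]]].
simpl. field; auto.
Qed.

Lemma cder_pow f z a n : cder f z a -> exists d, cder (fun w => f w ^ n) z d.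
Proof.
intros H. induction n as [|n [d IH]].
- exists 0. simpl. apply cder_const.
- eexists. simpl. apply cder_mult; eassumption.
Qed.

(** * The complex exponential and the increment bound *)

Lemma C_eq_parts (a b : C) : Re a = Re b -> Im a = Im b -> a = b.
Proof. destruct a, b; unfold Re, Im; simpl. congruence. Qed.

Lemma Cexp_plus (a b : C) : Cexp (a + b) = Cexp a * Cexp b.
Proof.
unfold Cexp. rewrite re_plus, im_plus, exp_plus, cos_plus, sin_plus.
unfold Cmult, RtoC; simpl. f_equal; ring.
Qed.
Lemma Cexp_0 : Cexp 0 = 1.
Proof. unfold Cexp; simpl. rewrite exp_0, cos_0, sin_0. unfold Cmult, RtoC; simpl. f_equal; ring. Qed.
Lemma Cexp_neq_0 a : Cexp a <> 0.
Proof. intros H. assert (X := Cexp_plus a (- a)). rewrite H in X. replace (a + - a) with (RtoC 0) in X by ring.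
 rewrite Cexp_0 in X. rewrite Cmult_0_l in X. now apply C1_nz. Qed.
Lemma Cexp_opp a : Cexp (- a) = / Cexp a.
Proof. assert (X := Cexp_plus a (- a)). replace (a + - a) with (RtoC 0) in X by ring. rewrite Cexp_0 in X.
  assert (N := Cexp_neq_0 a). 
  replace (Cexp (-a)) with (/ Cexp a * (Cexp a * Cexp (-a))) by (field; auto). rewrite <- X. ring. Qed.
Lemma Cmod_Cexp a : Cmod (Cexp a) = exp (Re a).
Proof.
unfold Cexp. rewrite Cmod_mult, Cmod_R, Rabs_pos_eq by (left; apply exp_pos).
replace (Cmod (cos (Im a), sin (Im a))) with 1%R. ring.
symmetry. transitivity (sqrt 1); [|apply sqrt_1]. unfold Cmod; simpl. apply (f_equal sqrt).
assert (X := sin2_cos2 (Im a)). unfold Rsqr in X. lra.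
Qed.
Lemma Cexp_pow a n : Cexp a ^ n = Cexp (RtoC (INR n) * a).
Proof.
induction n as [|n IH].
- simpl. now rewrite Cmult_0_l, Cexp_0.
- rewrite S_INR, Cpow_S, IH, <- Cexp_plus. apply (f_equal Cexp). rewrite RtoC_plus. ring.
Qed.

Lemma derivable_pt_lim_0_bound f l : derivable_pt_lim f 0 l -> forall eps, 0 < eps ->
  exists del, 0 < del /\ forall h, Rabs h < del -> Rabs (f h - f 0 - l * h) <= eps * Rabs h.
Proof.
intros D eps He. destruct (D eps He) as [del H]. exists del. split. apply cond_pos.
intros h Hh. destruct (Req_dec h 0) as [->|N].
- replace (f 0 - f 0 - l * 0)%R with 0%R by ring. rewrite Rabs_R0. lra.
- specialize (H h N Hh). rewrite Rplus_0_l in H.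
  replace (f h - f 0 - l * h)%R with (((f h - f 0) / h - l) * h)%R by (field; trivial).
  rewrite Rabs_mult. apply Rmult_le_compat_r. apply Rabs_pos. lra.
Qed.

Lemma im_le_Cmod (c : C) : Rabs (Im c) <= Cmod c.
Proof. eapply Rle_trans. 2: apply Rmax_Cmod. apply Rmax_r. Qed.

Lemma Cmod_le_parts (c : C) : Cmod c <= Rabs (Re c) + Rabs (Im c).
Proof.
replace c with (RtoC (Re c) + RtoC (Im c) * Ci) at 1.
2: destruct c; unfold Cplus, Cmult, RtoC, Ci, Re, Im; simpl; f_equal; ring.
eapply Rle_trans. apply Cmod_triangle. rewrite Cmod_mult, Cmod_Ci, !Cmod_R. lra.
Qed.

Lemma cder_Cexp_0 : cder Cexp 0 1.
Proof.
(* Real and imaginary part of the remainder are bounded by 4 and 5 times [eps * Cmod h], which the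
   divisor 10 covers. *)
intros eps0 He0. set (eps := (Rmin 1 (eps0 / 10))%R).
assert (He : 0 < eps) by (apply Rmin_glb_lt; lra).
assert (He1 : eps <= 1) by apply Rmin_l.
assert (He2 : eps <= eps0 / 10) by apply Rmin_r.
destruct (derivable_pt_lim_0_bound exp 1 derivable_pt_lim_exp_0 eps He) as (d1 & Hd1 & H1).
assert (Dc : derivable_pt_lim cos 0 0) by (replace 0%R with (- sin 0)%R at 2 by (rewrite sin_0; ring); apply derivable_pt_lim_cos).
destruct (derivable_pt_lim_0_bound cos 0 Dc eps He) as (d2 & Hd2 & H2).
assert (Ds : derivable_pt_lim sin 0 1) by (rewrite <- cos_0; apply derivable_pt_lim_sin).
destruct (derivable_pt_lim_0_bound sin 1 Ds eps He) as (d3 & Hd3 & H3).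
exists (Rmin (Rmin d1 d2) (Rmin d3 eps)). split. { repeat apply Rmin_glb_lt; trivial; lra. }
intros h Hh. rewrite Cplus_0_l, Cexp_0.
assert (Hx := re_le_Cmod h). assert (Hy := im_le_Cmod h).
assert (B := Rmin_l (Rmin d1 d2) (Rmin d3 eps)). assert (B' := Rmin_r (Rmin d1 d2) (Rmin d3 eps)).
assert (B1 := Rmin_l d1 d2). assert (B2 := Rmin_r d1 d2).
assert (B3 := Rmin_l d3 eps). assert (B4 := Rmin_r d3 eps).
specialize (H1 (Re h) ltac:(lra)). specialize (H2 (Im h) ltac:(lra)). specialize (H3 (Im h) ltac:(lra)).
rewrite exp_0 in H1. rewrite cos_0 in H2. rewrite sin_0 in H3.
eapply Rle_trans. apply Cmod_le_parts.
set (x := Re h) in *. set (y := Im h) in *. set (m := Cmod h) in *.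
set (r1 := (exp x - 1 - 1 * x)%R) in *. set (r2 := (cos y - 1 - 0 * y)%R) in *.
set (r3 := (sin y - 0 - 1 * y)%R) in *.
replace (Re (Cexp h - 1 - 1 * h)) with (r1 + (1 + x + r1) * r2)%R.
2:{ unfold r1, r2, x, y, Cexp, Cminus, Cplus, Copp, Cmult, RtoC, Re, Im; simpl. ring. }
replace (Im (Cexp h - 1 - 1 * h)) with ((x + r1) * y + (1 + x + r1) * r3)%R.
2:{ unfold r1, r3, x, y, Cexp, Cminus, Cplus, Copp, Cmult, RtoC, Re, Im; simpl. ring. }
assert (Hm : m < eps) by lra.
assert (Hm0 : 0 <= m) by apply Cmod_ge_0.
assert (R1 : Rabs r1 <= eps * m) by (eapply Rle_trans; [apply H1| apply Rmult_le_compat_l; lra]).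
assert (R2 : Rabs r2 <= eps * m) by (eapply Rle_trans; [apply H2| apply Rmult_le_compat_l; lra]).
assert (R3 : Rabs r3 <= eps * m) by (eapply Rle_trans; [apply H3| apply Rmult_le_compat_l; lra]).
assert (Q : Rabs (x + r1) <= 2 * eps).
{ eapply Rle_trans. apply Rabs_triang. nra. }
assert (Q' : Rabs (1 + x + r1) <= 3).
{ rewrite Rplus_assoc. eapply Rle_trans. apply Rabs_triang. rewrite Rabs_R1. lra. }
assert (T1 : Rabs (r1 + (1 + x + r1) * r2) <= eps * m + 3 * (eps * m)).
{ eapply Rle_trans. apply Rabs_triang. apply Rplus_le_compat. lra. rewrite Rabs_mult.
  apply Rmult_le_compat; try apply Rabs_pos; lra. }
assert (T2 : Rabs ((x + r1) * y + (1 + x + r1) * r3) <= 2 * eps * m + 3 * (eps * m)).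
{ eapply Rle_trans. apply Rabs_triang. rewrite !Rabs_mult. apply Rplus_le_compat;
  apply Rmult_le_compat; try apply Rabs_pos; lra. }
assert (eps * m <= eps0 / 10 * m) by (apply Rmult_le_compat_r; lra). nra.
Qed.

Lemma cder_Cexp z : cder Cexp z (Cexp z).
Proof.
intros eps He.
assert (Hm := proj1 (Cmod_gt_0 _) (Cexp_neq_0 z)).
destruct (cder_Cexp_0 (eps / Cmod (Cexp z))%R) as [del [Hd H]].
now apply Rdiv_lt_0_compat.
exists del. split; trivial. intros h Hh. specialize (H h Hh).
rewrite Cplus_0_l, Cexp_0 in H.
rewrite Cexp_plus. replace (Cexp z * Cexp h - Cexp z - Cexp z * h) with (Cexp z * (Cexp h - 1 - 1 * h)) by ring.
rewrite Cmod_mult. apply Rmult_le_compat_l with (r := Cmod (Cexp z)) in H; [|lra].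
eapply Rle_trans. apply H. right. field. lra.
Qed.

(* The real mean value theorem applied to [Re (conj u * f)] along the segment, [u = f w - f z]. *)
Lemma cder_increment_bound (f f' : C -> C) (z w : C) (M : R) :
  (forall t, 0 <= t <= 1 -> cder f (z + RtoC t * (w - z)) (f' (z + RtoC t * (w - z)))) ->
  (forall t, 0 <= t <= 1 -> Cmod (f' (z + RtoC t * (w - z))) <= M) ->
  Cmod (f w - f z) <= M * Cmod (w - z).
Proof.
intros D B.
set (u := f w - f z).
set (h := fun t : R => Re (Cconj u * f (z + RtoC t * (w - z)))).
set (h' := fun t : R => Re (Cconj u * (f' (z + RtoC t * (w - z)) * (w - z)))).
assert (Dh : forall t, 0 <= t <= 1 -> derivable_pt_lim h t (h' t)).
{ intros t Ht. intros eps He.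
  set (L := (Cmod u * Cmod (w - z) + 1)%R).
  assert (HL : 0 < L). { generalize (Rmult_le_pos _ _ (Cmod_ge_0 u) (Cmod_ge_0 (w - z))). unfold L; lra. }
  destruct (D t Ht (eps / (2 * L))%R) as [del [Hd H]]. apply Rdiv_lt_0_compat; lra.
  assert (Hd' : 0 < del / (Cmod (w - z) + 1)). { apply Rdiv_lt_0_compat; trivial. generalize (Cmod_ge_0 (w - z)); lra. }
  exists (mkposreal _ Hd'). intros k Nk Hk. simpl in Hk.
  assert (Hk' : Cmod (RtoC k * (w - z)) < del).
  { rewrite Cmod_mult, Cmod_R. apply Rmult_lt_compat_r with (r := (Cmod (w - z) + 1)%R) in Hk.
    2: generalize (Cmod_ge_0 (w - z)); lra.
    unfold Rdiv in Hk. rewrite Rmult_assoc, Rinv_l, Rmult_1_r in Hk. 2: generalize (Cmod_ge_0 (w - z)); lra.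
    generalize (Rabs_pos k); intros; nra. }
  specialize (H _ Hk').
  set (X := Cconj u * (f (z + RtoC t * (w - z) + RtoC k * (w - z)) - f (z + RtoC t * (w - z)) - f' (z + RtoC t * (w - z)) * (RtoC k * (w - z)))).
  replace ((h (t + k)%R - h t) / k - h' t)%R with (Re X / k)%R.
  2:{ unfold X, h, h'. replace (z + RtoC (t + k) * (w - z)) with (z + RtoC t * (w - z) + RtoC k * (w - z)) by (rewrite RtoC_plus; ring).
     generalize (f (z + RtoC t * (w - z) + RtoC k * (w - z))) (f (z + RtoC t * (w - z))) (f' (z + RtoC t * (w - z))) (w - z) (Cconj u).
     intros [] [] [] [] []. unfold Cminus, Cplus, Copp, Cmult, RtoC, Re, Im; simpl. field. trivial. }
  unfold Rdiv. rewrite Rabs_mult, Rabs_inv.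
  assert (Pk : 0 < Rabs k) by (now apply Rabs_pos_lt).
  apply Rmult_lt_reg_r with (Rabs k); trivial. rewrite Rmult_assoc, Rinv_l, Rmult_1_r by lra.
  eapply Rle_lt_trans. apply re_le_Cmod. unfold X. rewrite Cmod_mult, Cmod_conj.
  apply Rle_lt_trans with (Cmod u * (eps / (2 * L) * (Rabs k * Cmod (w - z))))%R.
  { apply Rmult_le_compat_l. apply Cmod_ge_0. rewrite Cmod_mult, Cmod_R in H. exact H. }
  replace (Cmod u * (eps / (2 * L) * (Rabs k * Cmod (w - z))))%R with (eps * Rabs k * ((Cmod u * Cmod (w - z)) / (2 * L)))%R by (field; lra).
  rewrite <- (Rmult_1_r (eps * Rabs k)) at 2. apply Rmult_lt_compat_l. now apply Rmult_lt_0_compat.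
  apply Rmult_lt_reg_r with (2 * L)%R. lra. unfold Rdiv. rewrite Rmult_assoc, Rinv_l by lra. unfold L in *; lra. }
destruct (MVT_cor2 h h' 0 1 Rlt_0_1 Dh) as (c & Hc & Hc01).
unfold h in Hc. rewrite Rminus_0_r, Rmult_1_r in Hc.
replace (z + 1 * (w - z)) with w in Hc by ring. replace (z + 0 * (w - z)) with z in Hc by ring.
assert (E : (Re (Cconj u * f w) - Re (Cconj u * f z) = Cmod u * Cmod u)%R).
{ replace (Cmod u * Cmod u)%R with (Cmod u ^ 2)%R by ring. rewrite Cmod2_alt. unfold u. destruct (f w), (f z).
  unfold Cconj, Cminus, Cplus, Copp, Cmult, RtoC, Re, Im; simpl. ring. }
rewrite E in Hc. assert (X : h' c <= Cmod u * (M * Cmod (w - z))).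
{ eapply Rle_trans. apply Rle_abs. unfold h'. eapply Rle_trans. apply re_le_Cmod.
  rewrite !Cmod_mult, Cmod_conj. apply Rmult_le_compat_l. apply Cmod_ge_0. apply Rmult_le_compat_r. apply Cmod_ge_0.
  apply B. lra. }
destruct (Req_dec (Cmod u) 0) as [Z|N].
- rewrite Z. apply Rmult_le_pos; [|apply Cmod_ge_0]. eapply Rle_trans. apply Cmod_ge_0. apply (B 0%R). lra.
- assert (0 < Cmod u). { generalize (Cmod_ge_0 u); lra. }
  apply Rmult_le_reg_l with (Cmod u); trivial. lra.
Qed.

(** * Limits of sequences *)

Definition Ccv (v : nat -> C) (l : C) : Prop :=
  forall eps : R, 0 < eps -> exists N, forall n, (N <= n)%nat -> Cmod (v n - l) < eps.

Lemma Ccv_parts v l : Ccv v l -> is_lim_seq (fun n => Re (v n)) (Re l) /\ is_lim_seq (fun n => Im (v n)) (Im l).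
Proof.
intros H. split; apply is_lim_seq_spec; intros eps; destruct (H eps (cond_pos eps)) as [N HN];
 exists N; intros n Hn; (eapply Rle_lt_trans; [|apply (HN n Hn)]).
- replace (Re (v n) - Re l)%R with (Re (v n - l)). apply re_le_Cmod. unfold Cminus. rewrite re_plus, re_opp. ring.
- replace (Im (v n) - Im l)%R with (Im (v n - l)). apply im_le_Cmod. unfold Cminus. rewrite im_plus, im_opp. ring.
Qed.

Lemma Ccv_unique v l l' : Ccv v l -> Ccv v l' -> l = l'.
Proof.
intros H H'. destruct (Ccv_parts _ _ H) as [A B]. destruct (Ccv_parts _ _ H') as [A' B'].
apply is_lim_seq_unique in A, B, A', B'. rewrite A in A'. rewrite B in B'.
apply C_eq_parts; congruence.
Qed.

Lemma Cinfprod_Ccv u l : Ccv (Cprod u) l -> Cinfprod u = l.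
Proof.
intros H. destruct (Ccv_parts _ _ H) as [A B]. unfold Cinfprod.
apply is_lim_seq_unique in A, B. rewrite A, B. now destruct l.
Qed.

Lemma Ccv_cauchy v : (forall eps, 0 < eps -> exists N, forall n m, (N <= n)%nat -> (N <= m)%nat -> Cmod (v n - v m) < eps) ->
  exists l, Ccv v l.
Proof.
intros H.
assert (A : ex_finite_lim_seq (fun n => Re (v n))).
{ apply ex_lim_seq_cauchy_corr. intros eps. destruct (H eps (cond_pos eps)) as [N HN]. exists N. intros n m Hn Hm.
  eapply Rle_lt_trans; [|apply (HN n m Hn Hm)]. replace (Re (v n) - Re (v m))%R with (Re (v n - v m)). apply re_le_Cmod. unfold Cminus. rewrite re_plus, re_opp. ring. }
assert (B : ex_finite_lim_seq (fun n => Im (v n))).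
{ apply ex_lim_seq_cauchy_corr. intros eps. destruct (H eps (cond_pos eps)) as [N HN]. exists N. intros n m Hn Hm.
  eapply Rle_lt_trans; [|apply (HN n m Hn Hm)]. replace (Im (v n) - Im (v m))%R with (Im (v n - v m)). apply im_le_Cmod. unfold Cminus. rewrite im_plus, im_opp. ring. }
destruct A as [a A]. destruct B as [b B]. exists (a, b).
apply is_lim_seq_spec in A. apply is_lim_seq_spec in B. intros eps He.
destruct (A (mkposreal (eps / 2) ltac:(lra))) as [N1 H1]. destruct (B (mkposreal (eps / 2) ltac:(lra))) as [N2 H2].
exists (Nat.max N1 N2). intros n Hn. specialize (H1 n ltac:(lia)). specialize (H2 n ltac:(lia)). simpl in H1, H2.
eapply Rle_lt_trans. apply Cmod_le_parts.
unfold Cminus. rewrite re_plus, im_plus, re_opp, im_opp. unfold Rminus in *.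
change (Re (a, b)) with a. change (Im (a, b)) with b. lra.
Qed.

Lemma Ccv_const c : Ccv (fun _ => c) c.
Proof. intros eps He. exists 0%nat. intros. replace (c - c) with (RtoC 0) by ring. now rewrite Cmod_0. Qed.

Lemma Ccv_ext v w l : (forall n, v n = w n) -> Ccv v l -> Ccv w l.
Proof. intros E H eps He. destruct (H eps He) as [N HN]. exists N. intros. rewrite <- E. now apply HN. Qed.

Lemma Ccv_bounded v l : Ccv v l -> exists N, forall n, (N <= n)%nat -> Cmod (v n) <= Cmod l + 1.
Proof.
intros H. destruct (H 1%R Rlt_0_1) as [N HN]. exists N. intros n Hn. specialize (HN n Hn).
generalize (Cmod_sub_ge (v n) l). lra.
Qed.

Lemma Ccv_mult v w l l' : Ccv v l -> Ccv w l' -> Ccv (fun n => v n * w n) (l * l').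
Proof.
intros H H' eps He. destruct (Ccv_bounded _ _ H) as [N0 H0].
assert (P := Cmod_ge_0 l). assert (P' := Cmod_ge_0 l').
destruct (H (eps / (2 * (Cmod l' + 1)))%R) as [N1 H1]. apply Rdiv_lt_0_compat; lra.
destruct (H' (eps / (2 * (Cmod l + 1)))%R) as [N2 H2]. apply Rdiv_lt_0_compat; lra.
exists (Nat.max N0 (Nat.max N1 N2)). intros n Hn.
specialize (H0 n ltac:(lia)). specialize (H1 n ltac:(lia)). specialize (H2 n ltac:(lia)).
replace (v n * w n - l * l') with (v n * (w n - l') + l' * (v n - l)) by ring.
eapply Rle_lt_trans. apply Cmod_triangle. rewrite !Cmod_mult.
assert (A : Cmod (v n) * Cmod (w n - l') < eps / 2).
{ apply Rle_lt_trans with ((Cmod l + 1) * Cmod (w n - l'))%R. apply Rmult_le_compat_r; trivial. apply Cmod_ge_0.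
  replace (eps / 2)%R with ((Cmod l + 1) * (eps / (2 * (Cmod l + 1))))%R by (field; lra).
  apply Rmult_lt_compat_l; lra. }
assert (B : Cmod l' * Cmod (v n - l) <= eps / 2).
{ replace (eps / 2)%R with ((Cmod l' + 1) * (eps / (2 * (Cmod l' + 1))))%R by (field; lra).
  apply Rmult_le_compat; try lra. apply Cmod_ge_0. }
lra.
Qed.

Lemma Ccv_subseq v l (s : nat -> nat) : (forall n, (n <= s n)%nat) -> Ccv v l -> Ccv (fun n => v (s n)) l.
Proof. intros Hs H eps He. destruct (H eps He) as [N HN]. exists N. intros n Hn. apply HN. specialize (Hs n). lia. Qed.

Lemma Ccv_Cmod_le v l M : Ccv v l -> (exists N, forall n, (N <= n)%nat -> Cmod (v n) <= M) -> Cmod l <= M.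
Proof.
intros H [N0 H0]. apply le_epsilon. intros eps He. destruct (H eps He) as [N HN].
specialize (H0 (Nat.max N0 N) ltac:(lia)). specialize (HN (Nat.max N0 N) ltac:(lia)).
rewrite Cmod_minus_sym in HN. generalize (Cmod_sub_ge l (v (Nat.max N0 N))). lra.
Qed.

Lemma Ccv_plus v w l l' : Ccv v l -> Ccv w l' -> Ccv (fun n => v n + w n) (l + l').
Proof.
intros H H' eps He. destruct (H (eps / 2)%R ltac:(lra)) as [N1 H1]. destruct (H' (eps / 2)%R ltac:(lra)) as [N2 H2].
exists (Nat.max N1 N2). intros n Hn. specialize (H1 n ltac:(lia)). specialize (H2 n ltac:(lia)).
replace (v n + w n - (l + l')) with ((v n - l) + (w n - l')) by ring.
eapply Rle_lt_trans. apply Cmod_triangle. lra.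
Qed.

Lemma Ccv_minus v w l l' : Ccv v l -> Ccv w l' -> Ccv (fun n => v n - w n) (l - l').
Proof.
intros H H'. apply Ccv_plus; trivial. intros eps He. destruct (H' eps He) as [N HN]. exists N. intros n Hn.
replace (- w n - - l') with (- (w n - l')) by ring. rewrite Cmod_opp. now apply HN.
Qed.

(** The increment bound for [f n - f N], whose derivative is uniformly small, passes to the limit in
    n and compares the increments of [F] and [f N]. Hence pointwise convergence of the functions
    suffices as soon as the derivatives are uniformly Cauchy. *)
Lemma cder_limit (f : nat -> C -> C) (d : nat -> C -> C) (F : C -> C) z0 r : 0 < r ->
  (forall n z, Cmod (z - z0) < r -> cder (f n) z (d n z)) ->
  (forall z, Cmod (z - z0) < r -> Ccv (fun n => f n z) (F z)) ->
  (forall eps, 0 < eps -> exists N, forall n m z, (N <= n)%nat -> (N <= m)%nat -> Cmod (z - z0) < r ->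
     Cmod (d n z - d m z) < eps) ->
  exists D, cder F z0 D.
Proof.
intros Hr Hd Hf Hu.
assert (Z0 : Cmod (z0 - z0) < r) by (replace (z0 - z0) with (RtoC 0) by ring; now rewrite Cmod_0).
destruct (Ccv_cauchy (fun n => d n z0)) as [D HD].
{ intros eps He. destruct (Hu eps He) as [N HN]. exists N. intros. now apply HN. }
exists D. intros eps He.
destruct (Hu (eps / 3)%R ltac:(lra)) as [N HN].
assert (HDN : Cmod (d N z0 - D) <= eps / 3).
{ apply (Ccv_Cmod_le (fun n => d N z0 - d n z0)). apply Ccv_minus; trivial. apply Ccv_const.
  exists N. intros n Hn. left. now apply HN. }
destruct (Hd N z0 Z0 (eps / 3)%R ltac:(lra)) as [del [Hdel HfN]].
exists (Rmin r del). split. now apply Rmin_glb_lt.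
intros h Hh. assert (h1 : Cmod h < r) by (eapply Rlt_le_trans; [apply Hh|apply Rmin_l]).
assert (h2 : Cmod h < del) by (eapply Rlt_le_trans; [apply Hh|apply Rmin_r]).
specialize (HfN h h2).
assert (Zh : Cmod (z0 + h - z0) < r) by (replace (z0 + h - z0) with h by ring; trivial).
assert (X : Cmod ((F (z0 + h) - f N (z0 + h)) - (F z0 - f N z0)) <= eps / 3 * Cmod h).
{ apply (Ccv_Cmod_le (fun n => (f n (z0 + h) - f N (z0 + h)) - (f n z0 - f N z0))).
  - apply Ccv_minus; (apply Ccv_minus; [apply Hf; trivial|apply Ccv_const]).
  - exists N. intros n Hn. replace h with (z0 + h - z0) at 3 by ring.
    apply (cder_increment_bound (fun z => f n z - f N z) (fun z => d n z - d N z)).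
    + intros t Ht. apply cder_minus; apply Hd; (match goal with |- Cmod ?x < r => replace x with (RtoC t * h) by ring end);
      rewrite Cmod_mult, Cmod_R, Rabs_pos_eq by lra; generalize (Cmod_ge_0 h); nra.
    + intros t Ht. left. apply HN; trivial. (match goal with |- Cmod ?x < r => replace x with (RtoC t * h) by ring end);
      rewrite Cmod_mult, Cmod_R, Rabs_pos_eq by lra; generalize (Cmod_ge_0 h); nra. }
replace (F (z0 + h) - F z0 - D * h) with (((F (z0 + h) - f N (z0 + h)) - (F z0 - f N z0)) + (f N (z0 + h) - f N z0 - d N z0 * h) + (d N z0 - D) * h) by ring.
eapply Rle_trans. apply Cmod_triangle. rewrite Cmod_mult.
eapply Rle_trans. apply Rplus_le_compat_r. apply Cmod_triangle.
assert (Cmod (d N z0 - D) * Cmod h <= eps / 3 * Cmod h) by (apply Rmult_le_compat_r; [apply Cmod_ge_0|trivial]).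
lra.
Qed.

(** * Infinite products *)
(** A summable majorant. Its term at 0 is counted although [Cprod] starts at 1; this only weakens
    the estimates. *)
Definition partial_bound (b : nat -> R) (B : R) := (forall n, 0 <= b n) /\ forall n, sum_f_R0 b n <= B.

Lemma sum_cauchy b B : partial_bound b B -> forall eps, 0 < eps -> exists N, forall n m, (N <= n)%nat -> (n <= m)%nat ->
  sum_f_R0 b m - sum_f_R0 b n < eps.
Proof.
intros [Hp HB] eps He.
destruct (growing_cv (fun n => sum_f_R0 b n)) as [l Hl].
- intros n. simpl. generalize (Hp (S n)). lra.
- exists B. intros x [n ->]. apply HB.
- destruct (Hl (eps / 2)%R ltac:(lra)) as [N HN]. exists N. intros n m Hn Hm.
  assert (A := HN n ltac:(lia)). assert (A' := HN m ltac:(lia)). unfold R_dist in *.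
  apply Rabs_def2 in A. apply Rabs_def2 in A'. lra.
Qed.

Lemma Cprod_bound (a : nat -> C) b : (forall n, 0 <= b n) -> (forall n, Cmod (a n) <= b n) ->
  forall n, Cmod (Cprod (fun k => 1 + a k) n) <= exp (sum_f_R0 b n).
Proof.
intros Hb Ha. induction n as [|n IH]; simpl.
- rewrite Cmod_1. generalize (exp_ineq1_le (b 0%nat)) (Hb 0%nat). lra.
- rewrite Cmod_mult, exp_plus. apply Rmult_le_compat; try apply Cmod_ge_0; trivial.
  eapply Rle_trans. apply Cmod_triangle. rewrite Cmod_1. eapply Rle_trans; [|apply exp_ineq1_le]. generalize (Ha (S n)). lra.
Qed.

Lemma exp_le_mono x y : x <= y -> exp x <= exp y.
Proof. intros H. destruct (Req_dec x y) as [->|N]. lra. left. apply exp_increasing. lra. Qed.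

(** Telescoping: each new factor changes the product by at most [exp B] times the new term of the
    majorant. *)
Lemma Cprod_diff_bound (a : nat -> C) b B : partial_bound b B -> (forall n, Cmod (a n) <= b n) ->
  forall n m, (n <= m)%nat -> Cmod (Cprod (fun k => 1 + a k) m - Cprod (fun k => 1 + a k) n) <= exp B * (sum_f_R0 b m - sum_f_R0 b n).
Proof.
intros [Hb HB] Ha n m Hnm. induction Hnm as [|m Hnm IH].
- replace (Cprod (fun k => 1 + a k) n - Cprod (fun k => 1 + a k) n) with (RtoC 0) by ring. rewrite Cmod_0. lra.
- simpl. replace (Cprod (fun k => 1 + a k) m * (1 + a (S m)) - Cprod (fun k => 1 + a k) n)
    with ((Cprod (fun k => 1 + a k) m - Cprod (fun k => 1 + a k) n) + Cprod (fun k => 1 + a k) m * a (S m)) by ring.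
  eapply Rle_trans. apply Cmod_triangle. rewrite Cmod_mult.
  assert (Cmod (Cprod (fun k => 1 + a k) m) * Cmod (a (S m)) <= exp B * b (S m)).
  { apply Rmult_le_compat; try apply Cmod_ge_0; trivial.
    eapply Rle_trans. apply (Cprod_bound a b Hb Ha). now apply exp_le_mono. }
  lra.
Qed.

Lemma Cprod_cv (a : nat -> C) b B : partial_bound b B -> (forall n, Cmod (a n) <= b n) ->
  exists l, Ccv (Cprod (fun k => 1 + a k)) l.
Proof.
intros Hb Ha. apply Ccv_cauchy. intros eps He.
assert (E := exp_pos B).
destruct (sum_cauchy b B Hb (eps / exp B)) as [N HN]. now apply Rdiv_lt_0_compat.
assert (K : forall n m, (N <= n)%nat -> (n <= m)%nat -> Cmod (Cprod (fun k => 1 + a k) m - Cprod (fun k => 1 + a k) n) < eps).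
{ intros n m Hn Hm. eapply Rle_lt_trans. apply (Cprod_diff_bound a b B Hb Ha n m Hm).
  specialize (HN n m Hn Hm). apply Rmult_lt_compat_l with (r := exp B) in HN; trivial.
  replace (exp B * (eps / exp B))%R with eps in HN by (field; lra). exact HN. }
exists N. intros n m Hn Hm. destruct (le_ge_dec m n). now apply K. rewrite Cmod_minus_sym. now apply K.
Qed.

Lemma Cprod_mult u v n : Cprod u n * Cprod v n = Cprod (fun k => u k * v k) n.
Proof. induction n as [|n IH]; simpl. ring. rewrite <- IH. ring. Qed.

Lemma Cprod_ext u v n : (forall k, (1 <= k)%nat -> u k = v k) -> Cprod u n = Cprod v n.
Proof. intros H. induction n as [|n IH]; simpl; trivial. rewrite IH, H by lia. reflexivity. Qed.

Lemma Cprod_1 n : Cprod (fun _ => 1) n = 1.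
Proof. induction n as [|n IH]; simpl; trivial. rewrite IH. ring. Qed.

Lemma partial_bound_small b B : partial_bound b B -> exists N, forall n, (N <= n)%nat -> b n < / 2.
Proof.
intros H. destruct (sum_cauchy b B H (/2)%R ltac:(lra)) as [N HN]. exists (S N). intros n Hn.
destruct n as [|n]; [lia|]. specialize (HN n (S n) ltac:(lia) ltac:(lia)). simpl in HN. lra.
Qed.

Lemma sum_f_R0_scal_le (c b : nat -> R) N : (forall n, 0 <= b n) ->
  (forall n, (N <= n)%nat -> c n <= 2 * b n) -> exists K, forall n, sum_f_R0 c n <= K + 2 * sum_f_R0 b n.
Proof.
intros Hb H. exists (Rmax 0 (sum_f_R0 (fun n => Rabs (c n)) N)).
assert (G : forall n, sum_f_R0 c n <= sum_f_R0 (fun n => Rabs (c n)) (Nat.min n N) + 2 * sum_f_R0 b n).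
{ induction n as [|n IH].
  - simpl. generalize (Rle_abs (c 0%nat)) (Hb 0%nat). lra.
  - cbn [sum_f_R0]. destruct (le_ge_dec N n) as [L|L].
    + rewrite (Nat.min_r n N) in IH by lia. rewrite (Nat.min_r (S n) N) by lia. specialize (H (S n) ltac:(lia)). lra.
    + destruct (Nat.eq_dec n N) as [->|NE].
      * rewrite (Nat.min_id N) in IH. rewrite Nat.min_r by lia. specialize (H (S N) ltac:(lia)). lra.
      * rewrite (Nat.min_l n N) in IH by lia. rewrite (Nat.min_l (S n) N) by lia. cbn [sum_f_R0].
        generalize (Rle_abs (c (S n))) (Hb (S n)). lra. }
assert (M : forall k m, (k <= m)%nat -> sum_f_R0 (fun n => Rabs (c n)) k <= sum_f_R0 (fun n => Rabs (c n)) m).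
{ intros k m0 Hk. induction Hk as [|m Hk IH]. lra. cbn [sum_f_R0]. generalize (Rabs_pos (c (S m))). lra. }
intros n. eapply Rle_trans. apply G. apply Rplus_le_compat_r. eapply Rle_trans. apply M. apply Nat.le_min_r. apply Rmax_r.
Qed.

(* The limit is invertible because the product of the inverse factors converges as well. *)
Lemma Cprod_cv_nonzero (a : nat -> C) b B l : partial_bound b B -> (forall n, Cmod (a n) <= b n) ->
  (forall n, (1 <= n)%nat -> 1 + a n <> 0) -> Ccv (Cprod (fun k => 1 + a k)) l -> l <> 0.
Proof.
intros Hb Ha Hn Hl.
(* [1 + a' n] is the inverse of [1 + a n]. The index 0 does not occur in [Cprod], and [1 + a 0] is
   allowed to vanish there, hence the separate value. *)
set (a' := fun n => match n with O => RtoC 0 | S _ => - a n / (1 + a n) end).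
destruct (partial_bound_small b B Hb) as [N HN].
destruct (sum_f_R0_scal_le (fun n => Cmod (a' n)) b N (proj1 Hb)) as [K HK].
{ intros n HnN. destruct n as [|n]; unfold a'. rewrite Cmod_0. generalize (proj1 Hb 0%nat); lra.
  specialize (HN _ HnN). specialize (Ha (S n)). specialize (Hn (S n) ltac:(lia)).
  assert (L : / 2 <= Cmod (1 + a (S n))).
  { assert (X := Cmod_sub_ge 1 (- a (S n))). rewrite Cmod_opp, Cmod_1 in X. replace (1 - - a (S n)) with (1 + a (S n)) in X by ring. lra. }
  rewrite Cmod_div, Cmod_opp by trivial. apply Rmult_le_reg_r with (Cmod (1 + a (S n))). lra.
  unfold Rdiv. rewrite Rmult_assoc, Rinv_l by lra. generalize (Cmod_ge_0 (a (S n))); nra. }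
destruct (Cprod_cv a' (fun n => Cmod (a' n)) (K + 2 * B)%R) as [l' Hl'].
{ split. intros; apply Cmod_ge_0. intros n. eapply Rle_trans. apply HK. generalize (proj2 Hb n). lra. }
{ intros; lra. }
assert (P := Ccv_mult _ _ _ _ Hl Hl').
assert (P1 : l * l' = 1).
{ apply (Ccv_unique _ _ _ P). apply Ccv_ext with (fun _ => RtoC 1). 2: apply Ccv_const.
  intros n. rewrite Cprod_mult. symmetry. transitivity (Cprod (fun _ => 1) n); [apply Cprod_ext|apply Cprod_1].
  intros [|k] Hk; [lia|]. unfold a'. cbv beta iota. field. now apply Hn. }
intros ->. rewrite Cmult_0_l in P1. symmetry in P1. now apply C1_nz.
Qed.

Fixpoint dprod (u du : nat -> C) (n : nat) : C :=
  match n with O => 0 | S k => dprod u du k * u (S k) + Cprod u k * du (S k) end.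

Lemma cder_Cprod (u du : nat -> C -> C) z n : (forall k, (1 <= k)%nat -> cder (u k) z (du k z)) ->
  cder (fun z => Cprod (fun k => u k z) n) z (dprod (fun k => u k z) (fun k => du k z) n).
Proof.
intros H. induction n as [|n IH]; simpl. apply cder_const.
apply (cder_mult (fun z => Cprod (fun k => u k z) n) (u (S n))). exact IH. apply H. lia.
Qed.

(** Estimating the product and its derivative together closes the induction: a further factor
    multiplies the sum of the two moduli by at most 1 + 2b, which is at most exp (2b). *)
Lemma dprod_bound (a da : nat -> C) b : (forall n, 0 <= b n) -> (forall n, Cmod (a n) <= b n) -> (forall n, Cmod (da n) <= b n) ->
  forall n, Cmod (Cprod (fun k => 1 + a k) n) + Cmod (dprod (fun k => 1 + a k) da n) <= exp (2 * sum_f_R0 b n).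
Proof.
intros Hb Ha Hd. induction n as [|n IH]; cbn [Cprod dprod sum_f_R0].
- rewrite Cmod_1, Cmod_0. generalize (exp_ineq1_le (2 * b 0%nat)) (Hb 0%nat). lra.
- assert (T1 := Cmod_triangle (dprod (fun k => 1 + a k) da n * (1 + a (S n))) (Cprod (fun k => 1 + a k) n * da (S n))).
  rewrite !Cmod_mult in *.
  assert (T : Cmod (1 + a (S n)) <= 1 + b (S n)). { eapply Rle_trans. apply Cmod_triangle. rewrite Cmod_1. generalize (Ha (S n)); lra. }
  specialize (Hd (S n)). specialize (Hb (S n)).
  set (p := Cmod (Cprod (fun k => 1 + a k) n)) in *. set (q := Cmod (dprod (fun k => 1 + a k) da n)) in *.
  assert (Pp : 0 <= p) by apply Cmod_ge_0. assert (Pq : 0 <= q) by apply Cmod_ge_0.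
  apply Rle_trans with ((p + q) * (1 + 2 * b (S n)))%R.
  { assert (p * Cmod (1 + a (S n)) <= p * (1 + b (S n))) by (apply Rmult_le_compat_l; lra).
    assert (q * Cmod (1 + a (S n)) <= q * (1 + b (S n))) by (apply Rmult_le_compat_l; lra).
    assert (p * Cmod (da (S n)) <= p * b (S n)) by (apply Rmult_le_compat_l; lra).
    assert (0 <= q * b (S n)) by (apply Rmult_le_pos; lra). lra. }
  replace (2 * (sum_f_R0 b n + b (S n)))%R with (2 * sum_f_R0 b n + 2 * b (S n))%R by ring.
  rewrite exp_plus. apply Rmult_le_compat; try lra.
  eapply Rle_trans. 2: apply exp_ineq1_le. lra.
Qed.

Lemma dprod_diff_bound (a da : nat -> C) b B : partial_bound b B -> (forall n, Cmod (a n) <= b n) -> (forall n, Cmod (da n) <= b n) ->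
  forall n m, (n <= m)%nat -> Cmod (dprod (fun k => 1 + a k) da m - dprod (fun k => 1 + a k) da n) <= exp (2 * B) * (sum_f_R0 b m - sum_f_R0 b n).
Proof.
intros [Hb HB] Ha Hd n m Hnm. induction Hnm as [|m Hnm IH].
- match goal with |- Cmod (?x - ?x) <= _ => replace (x - x) with (RtoC 0) by ring end. rewrite Cmod_0. lra.
- cbn [dprod sum_f_R0]. 
  set (p := Cprod (fun k => 1 + a k) m) in *. set (q := dprod (fun k => 1 + a k) da m) in *.
  set (q0 := dprod (fun k => 1 + a k) da n) in *.
  replace (q * (1 + a (S m)) + p * da (S m) - q0) with ((q - q0) + (q * a (S m) + p * da (S m))) by ring.
  eapply Rle_trans. apply Cmod_triangle.
  assert (Cmod (q * a (S m) + p * da (S m)) <= exp (2 * B) * b (S m)).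
  { eapply Rle_trans. apply Cmod_triangle. rewrite !Cmod_mult.
    apply Rle_trans with ((Cmod p + Cmod q) * b (S m))%R.
    - assert (Cmod q * Cmod (a (S m)) <= Cmod q * b (S m)) by (apply Rmult_le_compat_l; [apply Cmod_ge_0|trivial]).
      assert (Cmod p * Cmod (da (S m)) <= Cmod p * b (S m)) by (apply Rmult_le_compat_l; [apply Cmod_ge_0|trivial]). lra.
    - apply Rmult_le_compat_r; trivial. eapply Rle_trans. apply (dprod_bound a da b Hb Ha Hd). apply exp_le_mono. generalize (HB m). lra. }
  lra.
Qed.

Lemma cder_infinite_product (a da : nat -> C -> C) (F : C -> C) b B z0 r : 0 < r -> partial_bound b B ->
  (forall n z, Cmod (z - z0) < r -> Cmod (a n z) <= b n /\ Cmod (da n z) <= b n /\ cder (a n) z (da n z)) ->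
  (forall z, Cmod (z - z0) < r -> Ccv (Cprod (fun k => 1 + a k z)) (F z)) ->
  exists D, cder F z0 D.
Proof.
intros Hr Hb Ha HF.
apply (cder_limit (fun n z => Cprod (fun k => 1 + a k z) n) (fun n z => dprod (fun k => 1 + a k z) (fun k => da k z) n) F z0 r Hr).
- intros n z Hz. apply (cder_Cprod (fun k z => 1 + a k z) da). intros k _.
  eapply cder_eq; [|apply cder_plus; [apply cder_const|apply (Ha k z Hz)]]. ring.
- exact HF.
- intros eps He. assert (E := exp_pos (2 * B)).
  destruct (sum_cauchy b B Hb (eps / exp (2 * B))) as [N HN]. now apply Rdiv_lt_0_compat.
  assert (K : forall n m z, (N <= n)%nat -> (n <= m)%nat -> Cmod (z - z0) < r ->
    Cmod (dprod (fun k => 1 + a k z) (fun k => da k z) m - dprod (fun k => 1 + a k z) (fun k => da k z) n) < eps).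
  { intros n m z Hn Hm Hz. eapply Rle_lt_trans. apply (dprod_diff_bound (fun k => a k z) (fun k => da k z) b B Hb); trivial; intros; now apply Ha.
    specialize (HN n m Hn Hm). apply Rmult_lt_compat_l with (r := exp (2 * B)) in HN; trivial.
    replace (exp (2 * B) * (eps / exp (2 * B)))%R with eps in HN by (field; lra). exact HN. }
  exists N. intros n m z Hn Hm Hz. destruct (le_ge_dec m n). now apply K. rewrite Cmod_minus_sym. now apply K.
Qed.

(** * Goursat's theorem and the maximum principle *)

Definition rcont (g : R -> C) (t : R) : Prop :=
  forall eps : R, 0 < eps -> exists del : R, 0 < del /\
    forall s : R, Rabs (s - t) < del -> Cmod (g s - g t) < eps.

Lemma norm_C_R (x : C) : @norm _ C_R_NormedModule x = Cmod x.
Proof.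
destruct x as [x y]. unfold norm; simpl. unfold prod_norm, Cmod; simpl. apply (f_equal sqrt).
unfold norm; simpl. unfold abs; simpl.
rewrite !Rmult_1_r. rewrite <- !Rabs_mult. 
rewrite !Rabs_pos_eq; trivial; apply Rle_0_sqr.
Qed.

Lemma rcont_continuous g t : rcont g t -> @continuous R_UniformSpace C_UniformSpace g t.
Proof.
intros H. apply filterlim_locally. intros eps.
destruct (H eps (cond_pos eps)) as [del [Hd Hs]].
exists (mkposreal del Hd). intros s Bs. apply C_NormedModule_mixin_compat1. apply Hs. exact Bs.
Qed.

Definition CInt (g : R -> C) (a b : R) : C := @RInt C_R_CompleteNormedModule g a b.

Definition rcont_on (g : R -> C) (a b : R) := forall t, a <= t <= b -> rcont g t.

Lemma rcont_ex g a b : a <= b -> rcont_on g a b -> @ex_RInt C_R_CompleteNormedModule g a b.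
Proof.
intros Hab H. apply (ex_RInt_continuous (V := C_R_CompleteNormedModule)).
intros z. rewrite Rmin_left, Rmax_right by trivial. intros Hz. now apply rcont_continuous, H.
Qed.

Lemma CInt_Chasles g a b c : a <= b -> b <= c -> rcont_on g a c -> CInt g a c = CInt g a b + CInt g b c.
Proof.
intros H1 H2 H. symmetry. apply (RInt_Chasles (V := C_R_CompleteNormedModule));
 apply rcont_ex; trivial; intros t Ht; apply H; lra.
Qed.

Lemma CInt_minus f g a b : a <= b -> rcont_on f a b -> rcont_on g a b ->
  CInt (fun t => f t - g t) a b = CInt f a b - CInt g a b.
Proof.
intros H1 Hf Hg. apply (RInt_minus (V := C_R_CompleteNormedModule) f g); now apply rcont_ex.
Qed.

Lemma CInt_bound g a b M : a <= b -> rcont_on g a b -> (forall t, a <= t <= b -> Cmod (g t) <= M) ->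
  Cmod (CInt g a b) <= (b - a) * M.
Proof.
intros H1 Hg HM. rewrite <- norm_C_R.
apply (norm_RInt_le_const (V := C_R_NormedModule) g); trivial.
- intros x Hx. rewrite norm_C_R. now apply HM.
- apply (RInt_correct (V := C_R_CompleteNormedModule)). now apply rcont_ex.
Qed.

Lemma CInt_prim P g a b : a <= b -> rcont_on g a b ->
  (forall t, a <= t <= b -> forall eps, 0 < eps -> exists del : R, 0 < del /\
    forall h : R, Rabs h < del -> Cmod (P (t + h)%R - P t - RtoC h * g t) <= eps * Rabs h) ->
  CInt g a b = P b - P a.
Proof.
intros Hab Hg HP. apply (is_RInt_unique (V := C_R_CompleteNormedModule) g a b (P b - P a)).
apply (is_RInt_derive (V := C_R_CompleteNormedModule) P g a b).
all: intros x; rewrite Rmin_left, Rmax_right by trivial; intros Hx.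
2: now apply rcont_continuous, Hg.
split. apply is_linear_scal_l.
intros y Hy. assert (E := is_filter_lim_locally_unique (K := R_AbsRing) (V := R_NormedModule) x y Hy).
subst y. intros eps. destruct (HP x Hx eps (cond_pos eps)) as [del [Hd H]].
exists (mkposreal del Hd). intros z Hz.
specialize (H (z - x)%R Hz). rewrite <- norm_C_R in H.
assert (E : forall u v : R, (u + (v - u))%R = v) by (intros; ring). rewrite E in H. rewrite <- (scal_R_Cmult (z - x)%R (g x)) in H. exact H.
Qed.

Lemma CInt_const c a b : CInt (fun _ => c) a b = RtoC (b - a) * c.
Proof. unfold CInt. rewrite (RInt_const (V := C_R_CompleteNormedModule)). apply scal_R_Cmult. Qed.

Definition Hint (F : C -> C) (x x' y : R) : C := CInt (fun t => F (t, y)) x x'.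
Definition Vint (F : C -> C) (y y' x : R) : C := CInt (fun t => F (x, t)) y y'.
(** The integral of F dz over the boundary of the rectangle, counterclockwise; [Ci] comes from dz =
    i dt on the vertical sides. *)
Definition bdry (F : C -> C) (x x' y y' : R) : C :=
  Hint F x x' y + Ci * Vint F y y' x' - Hint F x x' y' - Ci * Vint F y y' x.

Definition rect_cont (F : C -> C) (x x' y y' : R) : Prop :=
  forall s t, x <= s <= x' -> y <= t <= y' -> ccont F (s, t).

Lemma Cmod_horiz (s t y : R) : Cmod ((s, y) - (t, y)) = Rabs (s - t).
Proof.
replace ((s, y) - (t, y)) with (RtoC (s - t)). apply Cmod_R.
unfold Cminus, Cplus, Copp, RtoC; simpl. f_equal. ring.
Qed.
Lemma Cmod_vert (s t y : R) : Cmod ((y, s) - (y, t)) = Rabs (s - t).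
Proof.
replace ((y, s) - (y, t)) with (Ci * RtoC (s - t)). rewrite Cmod_mult, Cmod_Ci, Cmod_R. ring.
unfold Cminus, Cplus, Copp, RtoC, Cmult, Ci; simpl. f_equal; ring.
Qed.

Lemma ccont_horiz F s y : ccont F (s, y) -> rcont (fun t => F (t, y)) s.
Proof.
intros H eps He. destruct (H eps He) as [del [Hd H1]]. exists del. split; trivial.
intros t Ht. apply H1. now rewrite Cmod_horiz.
Qed.
Lemma ccont_vert F x t : ccont F (x, t) -> rcont (fun t => F (x, t)) t.
Proof.
intros H eps He. destruct (H eps He) as [del [Hd H1]]. exists del. split; trivial.
intros s Hs. apply H1. now rewrite Cmod_vert.
Qed.

Lemma bdry_split F x xm x' y ym y' : x <= xm -> xm <= x' -> y <= ym -> ym <= y' -> rect_cont F x x' y y' ->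
  bdry F x x' y y' = bdry F x xm y ym + bdry F xm x' y ym + bdry F x xm ym y' + bdry F xm x' ym y'.
Proof.
intros H1 H2 H3 H4 HF. unfold bdry.
assert (A : forall y0, y <= y0 <= y' -> Hint F x x' y0 = Hint F x xm y0 + Hint F xm x' y0).
{ intros y0 Hy0. apply CInt_Chasles; trivial. intros t Ht. apply ccont_horiz. now apply HF. }
assert (B : forall x0, x <= x0 <= x' -> Vint F y y' x0 = Vint F y ym x0 + Vint F ym y' x0).
{ intros x0 Hx0. apply CInt_Chasles; trivial. intros t Ht. apply ccont_vert. now apply HF. }
rewrite !A, !B by lra. ring.
Qed.

Lemma bdry_prim P F x x' y y' : x <= x' -> y <= y' -> rect_cont F x x' y y' ->
  (forall s t, x <= s <= x' -> y <= t <= y' -> cder P (s, t) (F (s, t))) -> bdry F x x' y y' = 0.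
Proof.
intros H1 H2 HF HP. unfold bdry.
assert (A : forall y0, y <= y0 <= y' -> Hint F x x' y0 = P (x', y0) - P (x, y0)).
{ intros y0 Hy0. apply (CInt_prim (fun t => P (t, y0))); trivial.
  intros t Ht. apply ccont_horiz. now apply HF.
  intros t Ht eps He. destruct (HP t y0 Ht Hy0 eps He) as [del [Hd H]]. exists del. split; trivial.
  intros h Hh. specialize (H (RtoC h)). rewrite Cmod_R in H. specialize (H Hh).
  replace ((t, y0) + RtoC h) with ((t + h)%R, y0) in H. now rewrite (Cmult_comm h).
  unfold Cplus, RtoC; simpl. f_equal. ring. }
assert (B : forall x0, x <= x0 <= x' -> Ci * Vint F y y' x0 = P (x0, y') - P (x0, y)).
{ intros x0 Hx0.
  (* Along a vertical line the real derivative of [P] is i F, so -i P is a primitive of [F]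
     there. *)
  assert (E : Vint F y y' x0 = (- Ci * P (x0, y')) - (- Ci * P (x0, y))).
  { apply (CInt_prim (fun t => - Ci * P (x0, t))); trivial.
    intros t Ht. apply ccont_vert. now apply HF.
    intros t Ht eps He. destruct (HP x0 t Hx0 Ht eps He) as [del [Hd H]]. exists del. split; trivial.
    intros h Hh. specialize (H (Ci * RtoC h)). rewrite Cmod_mult, Cmod_Ci, Cmod_R, Rmult_1_l in H. specialize (H Hh).
    replace ((x0, t) + Ci * RtoC h) with (x0, (t + h)%R) in H.
    2: unfold Cplus, Cmult, Ci, RtoC; simpl; f_equal; ring.
    replace (- Ci * P (x0, (t + h)%R) - - Ci * P (x0, t) - RtoC h * F (x0, t)) with
      (- Ci * (P (x0, (t + h)%R) - P (x0, t) - F (x0, t) * (Ci * RtoC h))).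
    rewrite Cmod_mult, Cmod_opp, Cmod_Ci, Rmult_1_l. exact H.
    replace (RtoC h * F (x0, t)) with (- (Ci * Ci) * RtoC h * F (x0, t)). ring.
    replace (Ci * Ci) with (-(1)). ring. unfold Ci, Cmult, Copp, RtoC; simpl. f_equal; ring. }
  rewrite E. replace (P (x0, y') - P (x0, y)) with (- (Ci * Ci) * (P (x0, y') - P (x0, y))). ring.
  replace (Ci * Ci) with (-(1)). ring. unfold Ci, Cmult, Copp, RtoC; simpl. f_equal; ring. }
rewrite !A, !B by lra. ring.
Qed.

Lemma bdry_minus F G x x' y y' : x <= x' -> y <= y' -> rect_cont F x x' y y' -> rect_cont G x x' y y' ->
  bdry (fun z => F z - G z) x x' y y' = bdry F x x' y y' - bdry G x x' y y'.
Proof.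
intros H1 H2 HF HG. unfold bdry, Hint, Vint.
rewrite !(CInt_minus (fun t => F (t, _)) (fun t => G (t, _))); trivial.
rewrite !(CInt_minus (fun t => F (_, t)) (fun t => G (_, t))); trivial. ring.
all: intros t Ht; (apply ccont_horiz || apply ccont_vert); (apply HF || apply HG); lra.
Qed.

Lemma bdry_bound F x x' y y' M : x <= x' -> y <= y' -> rect_cont F x x' y y' ->
  (forall s t, x <= s <= x' -> y <= t <= y' -> Cmod (F (s, t)) <= M) ->
  Cmod (bdry F x x' y y') <= 2 * ((x' - x) + (y' - y)) * M.
Proof.
intros H1 H2 HF HM. unfold bdry.
assert (A : forall y0, y <= y0 <= y' -> Cmod (Hint F x x' y0) <= (x' - x) * M).
{ intros y0 Hy0. apply CInt_bound; trivial. intros t Ht. apply ccont_horiz. now apply HF. intros; now apply HM. }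
assert (B : forall x0, x <= x0 <= x' -> Cmod (Ci * Vint F y y' x0) <= (y' - y) * M).
{ intros x0 Hx0. rewrite Cmod_mult, Cmod_Ci, Rmult_1_l. apply CInt_bound; trivial. intros t Ht. apply ccont_vert. now apply HF. intros; now apply HM. }
assert (T : forall a b : C, Cmod (a - b) <= Cmod a + Cmod b). { intros a b. rewrite <- (Cmod_opp b). apply Cmod_triangle. }
eapply Rle_trans. apply T. eapply Rle_trans. apply Rplus_le_compat_r. apply T.
eapply Rle_trans. apply Rplus_le_compat_r, Rplus_le_compat_r. apply Cmod_triangle.
assert (A1 := A y ltac:(lra)). assert (A2 := A y' ltac:(lra)). assert (B1 := B x ltac:(lra)). assert (B2 := B x' ltac:(lra)).
lra.
Qed.

Definition corner_bdry F (a b : R) (n : nat) (p : R * R) : R :=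
  Cmod (bdry F (fst p) (fst p + a / 2 ^ n) (snd p) (snd p + b / 2 ^ n)).

(** A rectangle of stage n is given by its lower left corner alone. The step moves to the first
    quarter whose boundary integral keeps a fourth of the modulus; the last quarter needs no test,
    since it must succeed when the other three fail. *)
Definition goursat_step F (a b : R) (n : nat) (p : R * R) : R * R :=
  let m := (corner_bdry F a b n p / 4)%R in
  let J := corner_bdry F a b (S n) in
  let x := (fst p + a / 2 ^ S n)%R in
  let y := (snd p + b / 2 ^ S n)%R in
  if Rle_dec m (J p) then p
  else if Rle_dec m (J (x, snd p)) then (x, snd p)
  else if Rle_dec m (J (fst p, y)) then (fst p, y)
  else (x, y).

Fixpoint goursat_seq F (a b : R) (p : R * R) (n : nat) : R * R :=
  match n with
  | O => p
  | S k => goursat_step F a b k (goursat_seq F a b p k)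
  end.

Lemma Cmod_sum4_last (a b c d : C) : Cmod a < Cmod (a + b + c + d) / 4 ->
  Cmod b < Cmod (a + b + c + d) / 4 -> Cmod c < Cmod (a + b + c + d) / 4 ->
  Cmod (a + b + c + d) / 4 <= Cmod d.
Proof.
assert (T1 := Cmod_triangle (a + b + c) d). assert (T2 := Cmod_triangle (a + b) c).
assert (T3 := Cmod_triangle a b). lra.
Qed.

Lemma half_pow a n : (a / 2 ^ n = 2 * (a / 2 ^ S n))%R.
Proof. simpl. field. apply pow_nonzero. lra. Qed.

Lemma pow2_pos n : 0 < 2 ^ n.
Proof. apply pow_lt. lra. Qed.

Lemma goursat_step_spec F a b n p : 0 < a -> 0 < b ->
  rect_cont F (fst p) (fst p + a / 2 ^ n) (snd p) (snd p + b / 2 ^ n) ->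
  let q := goursat_step F a b n p in
  corner_bdry F a b n p / 4 <= corner_bdry F a b (S n) q /\
  fst p <= fst q /\ fst q + a / 2 ^ S n <= fst p + a / 2 ^ n /\
  snd p <= snd q /\ snd q + b / 2 ^ S n <= snd p + b / 2 ^ n.
Proof.
intros Ha Hb HF. unfold goursat_step.
assert (A := half_pow a n). assert (B := half_pow b n).
assert (PA : 0 < a / 2 ^ S n) by (apply Rdiv_lt_0_compat; trivial; apply pow2_pos).
assert (PB : 0 < b / 2 ^ S n) by (apply Rdiv_lt_0_compat; trivial; apply pow2_pos).
destruct Rle_dec as [H1|H1]; cbn [fst snd] in *. split; [trivial|lra].
destruct Rle_dec as [H2|H2]; cbn [fst snd] in *. split; [trivial|lra].
destruct Rle_dec as [H3|H3]; cbn [fst snd] in *. split; [trivial|lra].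
split; [|lra].
apply Rnot_le_lt in H1, H2, H3.
unfold corner_bdry in *. cbn [fst snd] in *.
set (x := fst p) in *. set (y := snd p) in *.
set (u := (a / 2 ^ S n)%R) in *. set (v := (b / 2 ^ S n)%R) in *.
rewrite A, B in H1, H2, H3, HF |- *.
assert (S := bdry_split F x (x + u)%R (x + 2 * u)%R y (y + v)%R (y + 2 * v)%R ltac:(lra) ltac:(lra) ltac:(lra) ltac:(lra) HF).
assert (Ex : (x + u + u = x + 2 * u)%R) by ring.
assert (Ey : (y + v + v = y + 2 * v)%R) by ring. rewrite Ex in H2 |- *. rewrite Ey in H3 |- *.
rewrite S in H1, H2, H3 |- *.
now apply Cmod_sum4_last.
Qed.

Lemma small_half a eps : 0 < a -> 0 < eps -> exists n, a / 2 ^ n < eps.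
Proof.
intros Ha He. destruct (pow_lt_1_zero (/ 2) ltac:(rewrite Rabs_pos_eq; lra) (eps / a)%R) as [n Hn].
now apply Rdiv_lt_0_compat. exists n. specialize (Hn n (le_n n)).
rewrite Rabs_pos_eq in Hn by (apply pow_le; lra). rewrite pow_inv in Hn.
apply Rmult_lt_compat_l with (r := a) in Hn; trivial.
replace (a * (eps / a))%R with eps in Hn by (field; lra). exact Hn.
Qed.

Lemma nested_limit (x : nat -> R) a : 0 < a ->
  (forall n, x n <= x (S n)) -> (forall n, x (S n) + a / 2 ^ S n <= x n + a / 2 ^ n) ->
  exists l, forall n, x n <= l <= x n + a / 2 ^ n.
Proof.
intros Ha H1 H2.
assert (M : forall n k, x n <= x (n + k)%nat /\ x (n + k)%nat + a / 2 ^ (n + k) <= x n + a / 2 ^ n).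
{ intros n k. induction k as [|k IH]. rewrite Nat.add_0_r. lra.
  rewrite Nat.add_succ_r. specialize (H1 (n + k)%nat). specialize (H2 (n + k)%nat). lra. }
assert (P : forall n, 0 < a / 2 ^ n) by (intros; apply Rdiv_lt_0_compat; trivial; apply pow2_pos).
assert (U : forall n m, x m <= x n + a / 2 ^ n).
{ intros n m. destruct (le_ge_dec n m) as [L|L].
  - replace m with (n + (m - n))%nat by lia. generalize (M n (m - n)%nat) (P (n + (m - n))%nat). lra.
  - generalize (M m (n - m)%nat) (P n). replace (m + (n - m))%nat with n by lia. lra. }
destruct (completeness (fun r => exists n, r = x n)) as [l [L1 L2]].
- exists (x 0%nat + a / 2 ^ 0)%R. intros r [n ->]. apply U.
- exists (x 0%nat). now exists 0%nat.
- exists l. intros n. split. apply L1. now exists n. apply L2. intros r [m ->]. apply U.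
Qed.

Lemma Cmod_pair (x y : R) : Cmod (x, y) <= Rabs x + Rabs y.
Proof. apply (Cmod_le_parts (x, y)). Qed.

Theorem goursat_rectangle F x0 y0 a b : 0 < a -> 0 < b ->
  (forall s t, x0 <= s <= x0 + a -> y0 <= t <= y0 + b -> exists d, cder F (s, t) d) ->
  bdry F x0 (x0 + a) y0 (y0 + b) = 0.
Proof.
intros Ha Hb HD.
set (p := goursat_seq F a b (x0, y0)).
assert (HC : forall s t, x0 <= s <= x0 + a -> y0 <= t <= y0 + b -> ccont F (s, t)).
{ intros s t Hs Ht. destruct (HD s t Hs Ht) as [d Hd]. eapply cder_ccont, Hd. }
assert (PA : forall n, 0 < a / 2 ^ n) by (intros; apply Rdiv_lt_0_compat; trivial; apply pow2_pos).
assert (PB : forall n, 0 < b / 2 ^ n) by (intros; apply Rdiv_lt_0_compat; trivial; apply pow2_pos).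
assert (IN : forall n, x0 <= fst (p n) /\ fst (p n) + a / 2 ^ n <= x0 + a /\
  y0 <= snd (p n) /\ snd (p n) + b / 2 ^ n <= y0 + b /\
  corner_bdry F a b 0 (x0, y0) / 4 ^ n <= corner_bdry F a b n (p n)).
{ induction n as [|n IH]. change (p 0%nat) with (x0, y0). cbn [fst snd pow]. lra.
  destruct IH as (I1 & I2 & I3 & I4 & I5).
  destruct (goursat_step_spec F a b n (p n) Ha Hb) as (J1 & J2 & J3 & J4 & J5).
  intros s t Hs Ht. apply HC; lra.
  change (goursat_step F a b n (p n)) with (p (S n)) in *.
  repeat split; try lra.
  eapply Rle_trans; [|apply J1]. simpl.
  replace (corner_bdry F a b 0 (x0, y0) / (4 * 4 ^ n))%R with (corner_bdry F a b 0 (x0, y0) / 4 ^ n / 4)%R. lra.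
  field. apply pow_nonzero; lra. }
assert (ST : forall n, fst (p n) <= fst (p (S n)) /\ fst (p (S n)) + a / 2 ^ S n <= fst (p n) + a / 2 ^ n /\
  snd (p n) <= snd (p (S n)) /\ snd (p (S n)) + b / 2 ^ S n <= snd (p n) + b / 2 ^ n).
{ intros n. destruct (IN n) as (I1 & I2 & I3 & I4 & I5).
  apply (goursat_step_spec F a b n (p n) Ha Hb). intros s t Hs Ht. apply HC; lra. }
destruct (nested_limit (fun n => fst (p n)) a Ha) as [xs Hx]. intros; apply ST. intros; apply ST.
destruct (nested_limit (fun n => snd (p n)) b Hb) as [ys Hy]. intros; apply ST. intros; apply ST.
assert (X0 := Hx 0%nat). assert (Y0 := Hy 0%nat). simpl in X0, Y0. rewrite Rdiv_1_r in X0, Y0.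
destruct (HD xs ys X0 Y0) as [d Hd].
set (w := (xs, ys)) in *.
(* The linear approximation of [F] at the limit point has the primitive [P], so subtracting it
   leaves the boundary integral unchanged while the integrand becomes small. *)
set (A := fun z : C => F w + d * (z - w)).
assert (DA : forall z, cder A z d).
{ intros z. unfold A. eapply cder_eq; [|apply cder_plus; [apply cder_const|apply cder_mult; [apply cder_const|apply cder_minus; [apply cder_id|apply cder_const]]]].
  simpl. ring. }
set (P := fun z : C => F w * z + d * ((z - w) * (z - w)) / 2).
assert (DP : forall z, cder P z (A z)).
{ intros z. unfold P, A. eapply cder_eq; [|apply cder_plus; [apply cder_mult; [apply cder_const|apply cder_id]|
   apply cder_mult; [apply cder_mult; [apply cder_const|apply cder_mult; apply cder_minus; [apply cder_id|apply cder_const|apply cder_id|apply cder_const]]|apply cder_const]]].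
  simpl. field. }
apply Cmod_eq_0. apply Rle_antisym; [|apply Cmod_ge_0].
apply le_epsilon. intros eps0 He0. rewrite Rplus_0_l.
(* At stage n the perimeter is 2 (a + b) / 2^n and the error is at most eps0 / L times (a + b) /
   2^n. This [L] makes the product eps0 / 4^n, which matches the loss of a factor 4 at each
   bisection. *)
set (L := (2 * (a + b) * (a + b))%R).
assert (HL : 0 < L) by (apply Rmult_lt_0_compat; lra).
destruct (Hd (eps0 / L)%R) as [del [Hdel Hbd]]. now apply Rdiv_lt_0_compat.
destruct (small_half (a + b) del) as [n Hn]; [lra|trivial|].
destruct (IN n) as (I1 & I2 & I3 & I4 & I5). specialize (Hx n). specialize (Hy n). simpl in Hx, Hy.
set (u := (a / 2 ^ n)%R) in *. set (v := (b / 2 ^ n)%R) in *.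
assert (Huv : ((a + b) / 2 ^ n = u + v)%R) by (unfold u, v; field; apply pow_nonzero; lra).
rewrite Huv in Hn.
assert (PAn := PA n). assert (PBn := PB n). fold u in PAn. fold v in PBn.
set (x := fst (p n)) in *. set (y := snd (p n)) in *.
assert (RC : rect_cont F x (x + u) y (y + v)) by (intros s t Hs Ht; apply HC; lra).
assert (RA : rect_cont A x (x + u) y (y + v)) by (intros s t Hs Ht; eapply cder_ccont, DA).
assert (E1 : bdry F x (x + u) y (y + v) = bdry (fun z => F z - A z) x (x + u) y (y + v)).
{ rewrite bdry_minus by (lra || trivial). rewrite (bdry_prim P A) by (lra || trivial || (intros; apply DP)). ring. }
assert (E2 : Cmod (bdry F x (x + u) y (y + v)) <= 2 * (u + v) * (eps0 / L * (u + v))).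
{ rewrite E1. replace (2 * (u + v))%R with (2 * ((x + u - x) + (y + v - y)))%R by ring.
  apply bdry_bound; try lra.
  - intros s t Hs Ht eps He.
    destruct (HD s t ltac:(lra) ltac:(lra)) as [d' Hd'].
    eapply (cder_ccont (fun z => F z - A z)); [apply cder_minus; [apply Hd'|apply DA]|exact He].
  - intros s t Hs Ht. specialize (Hbd ((s, t) - w)).
    assert (Bd : Cmod ((s, t) - w) <= u + v).
    { unfold w. replace ((s, t) - (xs, ys)) with ((s - xs)%R, (t - ys)%R) by reflexivity.
      eapply Rle_trans. apply Cmod_pair. apply Rplus_le_compat; apply Rabs_le; lra. }
    specialize (Hbd ltac:(lra)). assert (Ew : forall z z' : C, z + (z' - z) = z') by (intros; ring). rewrite Ew in Hbd.
    unfold A. assert (Ew' : forall z z' z'' : C, z - (z' + z'') = z - z' - z'') by (intros; ring). rewrite Ew'.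
    eapply Rle_trans. apply Hbd. apply Rmult_le_compat_l; trivial.
    left. now apply Rdiv_lt_0_compat. }
unfold corner_bdry in I5. simpl fst in I5. simpl snd in I5. change (fst (p n)) with x in I5. change (snd (p n)) with y in I5.
fold u v in I5. simpl (2 ^ 0)%R in I5. rewrite !Rdiv_1_r in I5.
assert (P4 : 0 < 4 ^ n) by (apply pow_lt; lra).
assert (E3 : (2 * (u + v) * (eps0 / L * (u + v)) = eps0 / 4 ^ n)%R).
{ rewrite <- Huv. unfold L. replace (4 ^ n)%R with (2 ^ n * 2 ^ n)%R. field. repeat split; try (apply pow_nonzero); lra.
  rewrite <- Rpow_mult_distr. apply (f_equal (fun r => (r ^ n)%R)). lra. }
rewrite E3 in E2. assert (E4 : Cmod (bdry F x0 (x0 + a) y0 (y0 + b)) / 4 ^ n <= eps0 / 4 ^ n) by lra.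
apply Rmult_le_reg_r with (/ 4 ^ n)%R. now apply Rinv_0_lt_compat. exact E4.
Qed.

(** * The mean value property and the maximum principle *)

Definition cdiff_on_disc (f : C -> C) (z0 : C) (r : R) : Prop :=
  forall z, Cmod (z - z0) < r -> exists d, cder f z d.

Lemma Cexp_2PI_period s : Cexp (s, - PI)%R = Cexp (s, PI).
Proof. unfold Cexp; simpl. rewrite cos_neg, sin_neg, sin_PI, Ropp_0. reflexivity. Qed.

Lemma circle_cder f z0 r s t : cdiff_on_disc f z0 r -> exp s < r ->
  exists d, cder (fun w => f (z0 + Cexp w)) (s, t) d.
Proof.
intros Hf Hs. destruct (Hf (z0 + Cexp (s, t))) as [d Hd].
{ replace (z0 + Cexp (s, t) - z0) with (Cexp (s, t)) by ring. now rewrite Cmod_Cexp. }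
eexists. apply (cder_comp f (fun w => z0 + Cexp w)). apply Hd.
apply cder_plus. apply cder_const. apply cder_Cexp.
Qed.

Definition circle_mean f z0 s := CInt (fun t => f (z0 + Cexp (s, t))) (- PI) PI.

Lemma circle_rcont f z0 r s a b : cdiff_on_disc f z0 r -> exp s < r ->
  rcont_on (fun t => f (z0 + Cexp (s, t))) a b.
Proof.
intros Hf Hs t _. apply (ccont_vert (fun w => f (z0 + Cexp w))).
destruct (circle_cder f z0 r s t Hf Hs) as [d Hd]. eapply cder_ccont, Hd.
Qed.

(** In the coordinate w with z = z0 + exp w an annulus becomes a rectangle of height 2 pi. Goursat's
    theorem applies to it, the horizontal sides cancel by periodicity, and the vertical sides are
    the two circle means. *)
Lemma circle_mean_const f z0 r s s' : cdiff_on_disc f z0 r -> s' < s -> exp s < r ->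
  circle_mean f z0 s' = circle_mean f z0 s.
Proof.
intros Hf Hss Hs.
assert (PP := PI_RGT_0).
assert (G := goursat_rectangle (fun w => f (z0 + Cexp w)) s' (- PI) (s - s') (2 * PI) ltac:(lra) ltac:(lra)).
replace (s' + (s - s'))%R with s in G by ring. replace (- PI + 2 * PI)%R with PI in G by ring.
assert (E : bdry (fun w => f (z0 + Cexp w)) s' s (- PI) PI = 0).
{ apply G. intros x y Hx Hy. apply circle_cder with r; trivial.
  apply Rle_lt_trans with (exp s); trivial. destruct (Req_dec x s) as [->|N]. lra. left. apply exp_increasing. lra. }
unfold bdry in E.
assert (E1 : Hint (fun w => f (z0 + Cexp w)) s' s (- PI) = Hint (fun w => f (z0 + Cexp w)) s' s PI).
{ unfold Hint, CInt. apply (RInt_ext (V := C_R_CompleteNormedModule)). intros x _. now rewrite Cexp_2PI_period. }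
rewrite E1 in E. fold (circle_mean f z0 s) in E.
change (Vint (fun w => f (z0 + Cexp w)) (- PI) PI s) with (circle_mean f z0 s) in E.
change (Vint (fun w => f (z0 + Cexp w)) (- PI) PI s') with (circle_mean f z0 s') in E.
assert (E2 : Ci * (circle_mean f z0 s - circle_mean f z0 s') = 0) by (rewrite <- E; ring).
assert (E3 : circle_mean f z0 s - circle_mean f z0 s' = 0).
{ destruct (Ceq_dec (circle_mean f z0 s - circle_mean f z0 s') 0) as [Z|N]; trivial.
  exfalso. now apply (Cmult_neq_0 _ _ Ci_nz N). }
symmetry. now apply Ceq_minus.
Qed.

(** The mean does not depend on the radius, so the radius can be taken so small that continuity at
    [z0] decides. *)
Theorem mean_value_circle f z0 r s : cdiff_on_disc f z0 r -> exp s < r ->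
  circle_mean f z0 s = RtoC (2 * PI) * f z0.
Proof.
intros Hf Hs. assert (PP := PI_RGT_0).
assert (HR : 0 < r) by (generalize (exp_pos s); lra).
apply Ceq_minus, Cmod_eq_0, Rle_antisym; [|apply Cmod_ge_0].
apply le_epsilon. intros eps He. rewrite Rplus_0_l.
destruct (Hf z0) as [d Hd]. { replace (z0 - z0) with (RtoC 0) by ring. now rewrite Cmod_0. }
destruct (cder_ccont _ _ _ Hd (eps / (2 * PI))%R) as [del [Hdel Hc]]. apply Rdiv_lt_0_compat; lra.
set (s' := (Rmin (s - 1) (ln del - 1))%R).
assert (L1 : s' <= s - 1) by apply Rmin_l.
assert (L2 : s' <= ln del - 1) by apply Rmin_r.
assert (L3 : exp s' < del). { rewrite <- (exp_ln del Hdel). apply exp_increasing. lra. }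
assert (L4 : exp s' < r). { apply Rlt_trans with (exp s); trivial. apply exp_increasing. lra. }
rewrite <- (circle_mean_const f z0 r s s' Hf ltac:(lra) Hs).
replace (RtoC (2 * PI) * f z0) with (CInt (fun _ => f z0) (- PI) PI).
2:{ rewrite CInt_const. f_equal. f_equal. ring. }
unfold circle_mean. rewrite <- CInt_minus; [|lra|now apply circle_rcont with r|].
2:{ intros t _ e Hpos. exists 1%R. split. lra. intros. replace (f z0 - f z0) with (RtoC 0) by ring. now rewrite Cmod_0. }
replace eps with ((PI - - PI) * (eps / (2 * PI)))%R by (field; lra).
apply CInt_bound. lra.
- intros t _ e Hpos. destruct (circle_rcont f z0 r s' t t Hf L4 t ltac:(lra) e Hpos) as [dl [H1 H2]].
  exists dl. split; trivial. intros u Hu. specialize (H2 u Hu).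
  match goal with |- Cmod ?x < _ => match type of H2 with Cmod ?y < _ => replace x with y by ring end end. exact H2.
- intros t _. left. apply Hc. replace (z0 + Cexp (s', t) - z0) with (Cexp (s', t)) by ring. now rewrite Cmod_Cexp.
Qed.

(** The integral from [a] to a variable endpoint lies between 0 and the total integral 0. It is
    therefore constant, and its derivative is [g]. *)
Lemma cont_RInt_zero (g : R -> R) a b : a < b -> (forall t, a <= t <= b -> continuous g t) ->
  (forall t, a <= t <= b -> 0 <= g t) -> RInt g a b = 0%R -> forall t, a < t < b -> g t = 0%R.
Proof.
intros Hab Hc Hp H0 t Ht.
assert (EX : forall u v, a <= u -> u <= v -> v <= b -> ex_RInt g u v).
{ intros u v Hu Huv Hv. apply (ex_RInt_continuous (V := R_CompleteNormedModule)).
  intros z. rewrite Rmin_left, Rmax_right by trivial. intros. apply Hc; lra. }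
assert (Z : forall u, a <= u <= b -> RInt g a u = 0%R).
{ intros u Hu. assert (Ch := RInt_Chasles (V := R_CompleteNormedModule) g a u b (EX a u ltac:(lra) ltac:(lra) ltac:(lra)) (EX u b ltac:(lra) ltac:(lra) ltac:(lra))).
  rewrite H0 in Ch. unfold plus in Ch; simpl in Ch.
  assert (0 <= RInt g a u) by (apply RInt_ge_0; [lra|apply EX; lra|intros; apply Hp; lra]).
  assert (0 <= RInt g u b) by (apply RInt_ge_0; [lra|apply EX; lra|intros; apply Hp; lra]).
  lra. }
assert (D1 : is_derive (fun u => RInt g a u) t (g t)).
{ apply (is_derive_RInt (V := R_NormedModule) g (fun u => RInt g a u) a t); [|apply Hc; lra].
  exists (mkposreal (Rmin (t - a) (b - t)) ltac:(apply Rmin_glb_lt; lra)). intros u Hu.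
  unfold ball in Hu; simpl in Hu; unfold AbsRing_ball, abs, minus, plus, opp in Hu; simpl in Hu.
  assert (Q1 := Rmin_l (t - a) (b - t)). assert (Q2 := Rmin_r (t - a) (b - t)). apply Rabs_def2 in Hu.
  apply (RInt_correct (V := R_CompleteNormedModule)). apply EX; lra. }
assert (D2 : is_derive (fun u => RInt g a u) t 0%R).
{ apply is_derive_ext_loc with (fun _ => 0%R). 2: apply (is_derive_const (K := R_AbsRing) (V := R_NormedModule) 0%R t).
  exists (mkposreal (Rmin (t - a) (b - t)) ltac:(apply Rmin_glb_lt; lra)). intros u Hu.
  unfold ball in Hu; simpl in Hu; unfold AbsRing_ball, abs, minus, plus, opp in Hu; simpl in Hu.
  assert (Q1 := Rmin_l (t - a) (b - t)). assert (Q2 := Rmin_r (t - a) (b - t)). apply Rabs_def2 in Hu.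
  symmetry. apply Z. lra. }
apply is_derive_unique in D1. apply is_derive_unique in D2. now rewrite D1 in D2.
Qed.

Lemma polar_form (w : C) : w <> 0 -> exists t, - PI <= t <= PI /\ w = Cexp (ln (Cmod w), t).
Proof.
intros Hw. assert (Hm := proj1 (Cmod_gt_0 w) Hw). set (m := Cmod w) in *.
assert (M2 : (m * m = Re w * Re w + Im w * Im w)%R).
{ generalize (Cmod2_alt w). fold m. simpl. lra. }
assert (B : -1 <= Re w / m <= 1).
{ generalize (re_le_Cmod w). fold m. intros X. apply Rabs_le_between in X.
  split. apply Rmult_le_reg_r with m; trivial. unfold Rdiv. rewrite Rmult_assoc, Rinv_l; lra.
  apply Rmult_le_reg_r with m; trivial. unfold Rdiv. rewrite Rmult_assoc, Rinv_l; lra. }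
assert (A := acos_bound (Re w / m)).
assert (SA : (sin (acos (Re w / m)) = Rabs (Im w) / m)%R).
{ rewrite sin_acos by trivial. replace (1 - (Re w / m)²)%R with (Rsqr (Im w / m)).
  rewrite sqrt_Rsqr_abs, Rabs_div by lra. now rewrite (Rabs_pos_eq m) by lra.
  unfold Rsqr. apply Rmult_eq_reg_r with (m * m)%R. 2: apply Rgt_not_eq; nra.
  replace (Im w / m * (Im w / m) * (m * m))%R with (Im w * Im w)%R by (field; lra).
  replace ((1 - Re w / m * (Re w / m)) * (m * m))%R with (m * m - Re w * Re w)%R by (field; lra). lra. }
assert (F : forall t, (cos t = Re w / m -> sin t = Im w / m -> w = Cexp (ln m, t))%R).
{ intros t H1 H2. unfold Cexp. unfold Re at 1, Im at 1 2. simpl. rewrite exp_ln, H1, H2 by trivial.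
  apply C_eq_parts. rewrite re_scal_l; unfold Re at 2; simpl; field; lra.
  rewrite im_scal_l; unfold Im at 2; simpl; field; lra. }
destruct (Rle_dec 0 (Im w)) as [P|N].
- exists (acos (Re w / m)). split. lra. apply F. now apply cos_acos. rewrite SA, Rabs_pos_eq; trivial.
- exists (- acos (Re w / m))%R. split. lra. apply F. rewrite cos_neg. now apply cos_acos.
  rewrite sin_neg, SA, Rabs_left by lra. field; lra.
Qed.

(** On the circle through [z] the function Re (conj c f) has mean |c|^2, which is also its upper
    bound, so it equals |c|^2 everywhere. Together with |f| <= |c| this gives |f - c|^2 <= 0.
    Choosing the circle through [z] reaches every point of the disc at once, without a connectedness
    argument. *)
Theorem maximum_principle f z0 r : cdiff_on_disc f z0 r ->
  (forall z, Cmod (z - z0) < r -> Cmod (f z) <= Cmod (f z0)) ->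
  forall z, Cmod (z - z0) < r -> f z = f z0.
Proof.
intros Hf HM z Hz. assert (PP := PI_RGT_0).
destruct (Ceq_dec z z0) as [->|N]; trivial.
assert (Nw : z - z0 <> 0) by (intros E; apply N; now apply Ceq_minus).
assert (Hm := proj1 (Cmod_gt_0 _) Nw).
destruct (polar_form _ Nw) as (t & Ht & Et). set (s := ln (Cmod (z - z0))) in *.
assert (Es : exp s = Cmod (z - z0)) by (now apply exp_ln).
assert (Hs : exp s < r) by lra.
assert (MV := mean_value_circle f z0 r s Hf Hs).
set (c := f z0) in *.
set (h := fun t : R => f (z0 + Cexp (s, t))).
set (g := fun t : R => (Cmod c ^ 2 - Re (Cconj c * h t))%R).
assert (Hh : forall t, Cmod (h t) <= Cmod c).
{ intros u. apply HM. replace (z0 + Cexp (s, u) - z0) with (Cexp (s, u)) by ring. now rewrite Cmod_Cexp. }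
assert (Hg : forall t, 0 <= g t).
{ intros u. unfold g. assert (X := re_le_Cmod (Cconj c * h u)). rewrite Cmod_mult, Cmod_conj in X.
  apply Rabs_le_between in X. assert (Cmod c * Cmod (h u) <= Cmod c * Cmod c).
  apply Rmult_le_compat_l; [apply Cmod_ge_0|apply Hh]. cbn [pow]. lra. }
assert (Hc : forall t, rcont (fun t => Cconj c * h t) t).
{ intros u. destruct (circle_cder f z0 r s u Hf Hs) as [d Hd].
  apply (ccont_vert (fun w => Cconj c * f (z0 + Cexp w))).
  eapply cder_ccont, (cder_mult (fun _ => Cconj c)). apply cder_const. apply Hd. }
assert (Hgc : forall t, continuous g t).
{ intros u. apply filterlim_locally. intros eps. destruct (Hc u eps (cond_pos eps)) as [del [Hd H]].
  exists (mkposreal del Hd). intros v Hv. specialize (H v Hv).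
  change (Rabs (g v - g u) < eps). unfold g.
  replace (Cmod c ^ 2 - Re (Cconj c * h v) - (Cmod c ^ 2 - Re (Cconj c * h u)))%R with (- Re (Cconj c * h v - Cconj c * h u))%R.
  rewrite Rabs_Ropp. eapply Rle_lt_trans. apply re_le_Cmod. exact H.
  unfold Cminus. rewrite re_plus, re_opp. ring. }
assert (I0 : RInt g (- PI) PI = 0%R).
{ apply is_RInt_unique.
  assert (I1 : @is_RInt C_R_CompleteNormedModule h (- PI) PI (RtoC (2 * PI) * c)).
  { rewrite <- MV. apply (RInt_correct (V := C_R_CompleteNormedModule)). apply rcont_ex. lra. now apply circle_rcont with r. }
  assert (Ire : is_RInt (fun t => Re (h t)) (- PI) PI (Re (RtoC (2 * PI) * c))).
  { exact (is_RInt_fct_extend_fst (U := R_NormedModule) (V := R_NormedModule) h _ _ _ I1). }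
  assert (Iim : is_RInt (fun t => Im (h t)) (- PI) PI (Im (RtoC (2 * PI) * c))).
  { exact (is_RInt_fct_extend_snd (U := R_NormedModule) (V := R_NormedModule) h _ _ _ I1). }
  assert (I2 := is_RInt_minus (V := R_NormedModule) _ _ _ _ _ _ (is_RInt_const (V := R_NormedModule) (- PI) PI (Cmod c ^ 2)%R)
    (is_RInt_plus (V := R_NormedModule) _ _ _ _ _ _ (is_RInt_scal (V := R_NormedModule) _ _ _ (Re c) _ Ire) (is_RInt_scal (V := R_NormedModule) _ _ _ (Im c) _ Iim))).
  unfold minus, plus, opp, scal in I2; simpl in I2; unfold mult in I2; simpl in I2.
  eapply is_RInt_ext; [|replace 0%R with ((PI - - PI) * (Cmod c * (Cmod c * 1)) + - (Re c * (Re (RtoC (2 * PI) * c)) + Im c * (Im (RtoC (2 * PI) * c))))%R; [exact I2|]].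
  - intros x _. unfold g. rewrite re_mult, re_conj, im_conj. unfold Re, Im. simpl. ring.
  - rewrite re_scal_l, im_scal_l. assert (X := Cmod2_alt c). cbn [pow] in X. rewrite X. ring. }
assert (Z : forall t, - PI < t < PI -> g t = 0%R).
{ apply cont_RInt_zero; trivial; try lra; intros; trivial. }
(* The argument [t] may be an endpoint, where [cont_RInt_zero] says nothing; the value is obtained
   by continuity from the points (1 - eta) t. *)
assert (Zt : g t = 0%R).
{ apply Rle_antisym; [|apply Hg]. apply le_epsilon. intros eps He. rewrite Rplus_0_l.
  destruct (proj1 (filterlim_locally _ _) (Hgc t) (mkposreal eps He)) as [del Hdel].
  set (eta := Rmin (/ 2) (del / (2 * PI))). assert (Pd := cond_pos del).
  assert (E1 : 0 < eta) by (apply Rmin_glb_lt; [lra|apply Rdiv_lt_0_compat; lra]).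
  assert (E2 : eta <= / 2) by apply Rmin_l.
  assert (E3 : eta * PI <= del / 2).
  { apply Rle_trans with (del / (2 * PI) * PI)%R. apply Rmult_le_compat_r. lra. apply Rmin_r. right. field. lra. }
  specialize (Hdel ((1 - eta) * t)%R). unfold ball in Hdel; simpl in Hdel; unfold AbsRing_ball, abs, minus, plus, opp in Hdel; simpl in Hdel.
  rewrite Z in Hdel by nra.
  assert (X : Rabs (0 + - g t) < eps) by (apply Hdel; apply Rabs_def1; nra).
  apply Rabs_def2 in X. lra. }
replace z with (z0 + Cexp (s, t)) by (rewrite <- Et; ring). fold (h t).
apply Ceq_minus, Cmod_eq_0.
assert (S2 : Cmod (h t - c) ^ 2 <= 0).
{ rewrite Cmod2_alt. unfold g in Zt. rewrite re_mult, re_conj, im_conj in Zt.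
  assert (X : Cmod (h t) ^ 2 <= Cmod c ^ 2) by (apply pow_incr; split; [apply Cmod_ge_0|apply Hh]).
  rewrite Cmod2_alt in X. rewrite (Cmod2_alt c) in X, Zt.
  unfold Cminus. rewrite re_plus, im_plus, re_opp, im_opp. simpl in *. nra. }
assert (X := Cmod_ge_0 (h t - c)). simpl in S2. nra.
Qed.

(** * The products [prod (1 - q^n w)] *)

Definition ee (z : C) : C := Cexp (RtoC (2 * PI) * Ci * z).

Lemma ee_plus (a b : C) : ee (a + b) = ee a * ee b.
Proof. unfold ee. rewrite <- Cexp_plus. apply (f_equal Cexp). ring. Qed.
Lemma ee_neq_0 z : ee z <> 0.
Proof. apply Cexp_neq_0. Qed.
Lemma ee_opp z : ee (- z) = / ee z.
Proof. unfold ee. rewrite <- Cexp_opp. apply (f_equal Cexp). ring. Qed.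
Lemma ee_pow z n : ee z ^ n = ee (RtoC (INR n) * z).
Proof. unfold ee. rewrite Cexp_pow. apply (f_equal Cexp). ring. Qed.
Lemma re_2PIi z : Re (RtoC (2 * PI) * Ci * z) = (- (2 * PI * Im z))%R.
Proof. destruct z. unfold Re, Im, Cmult, RtoC, Ci; simpl. ring. Qed.
Lemma im_2PIi z : Im (RtoC (2 * PI) * Ci * z) = (2 * PI * Re z)%R.
Proof. destruct z. unfold Re, Im, Cmult, RtoC, Ci; simpl. ring. Qed.
Lemma Cmod_ee z : Cmod (ee z) = exp (- (2 * PI * Im z)).
Proof. unfold ee. now rewrite Cmod_Cexp, re_2PIi. Qed.
Lemma ee_half : ee (/ 2) = - (1).
Proof.
unfold ee. replace (RtoC (2 * PI) * Ci * / 2) with (0, PI)%R.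
unfold Cexp; simpl. rewrite exp_0, cos_PI, sin_PI. unfold Cmult, Copp, RtoC; simpl. f_equal; ring.
replace (/ 2) with (RtoC (/ 2)) by (rewrite RtoC_inv; trivial; lra).
unfold Cmult, RtoC, Ci; simpl. f_equal; field.
Qed.
Lemma ee_quarter : ee (/ 4) = Ci.
Proof.
unfold ee. replace (RtoC (2 * PI) * Ci * / 4) with (0, PI / 2)%R.
unfold Cexp; simpl. rewrite exp_0, cos_PI2, sin_PI2. unfold Cmult, Ci, RtoC; simpl. f_equal; ring.
replace (/ 4) with (RtoC (/ 4)) by (rewrite RtoC_inv; trivial; lra).
unfold Cmult, RtoC, Ci; simpl. f_equal; field.
Qed.
Lemma ee_1 : ee 1 = 1.
Proof. replace (RtoC 1) with (/ 2 + / 2) at 1 by field. rewrite ee_plus, ee_half. ring. Qed.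
Lemma ee_plus_1 z : ee (z + 1) = ee z.
Proof. rewrite ee_plus, ee_1. ring. Qed.
Lemma ee_nat n : ee (RtoC (INR n)) = 1.
Proof. rewrite <- (Cmult_1_r (RtoC (INR n))), <- ee_pow, ee_1. apply Cpow_1_l. Qed.
Lemma ee_eq_1 z : ee z = 1 -> exists k : Z, z = RtoC (IZR k).
Proof.
intros H. assert (PP := PI_RGT_0).
assert (I0 : Im z = 0%R).
{ assert (X := Cmod_ee z). rewrite H, Cmod_1 in X. symmetry in X. rewrite <- exp_0 in X. apply exp_inv in X.
  assert (2 * PI * Im z = 0)%R by lra. apply Rmult_integral in H0. destruct H0; lra. }
assert (C1 : (cos (2 * PI * Re z) = 1)%R).
{ assert (X : Re (ee z) = 1%R) by (now rewrite H). unfold ee, Cexp in X. rewrite re_2PIi, im_2PIi, I0 in X.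
  rewrite Rmult_0_r, Ropp_0, exp_0 in X. rewrite re_scal_l in X. unfold Re at 1 in X. simpl in X. lra. }
assert (S0 : (sin (PI * Re z) = 0)%R).
{ replace (2 * PI * Re z)%R with (2 * (PI * Re z))%R in C1 by ring. rewrite cos_2a_sin in C1. nra. }
destruct (sin_eq_0_0 _ S0) as [k Hk]. exists k.
apply C_eq_parts; simpl. apply Rmult_eq_reg_l with PI; lra. exact I0.
Qed.

Lemma cder_ee_affine a b z : cder (fun t => ee (a + b * t)) z (RtoC (2 * PI) * Ci * b * ee (a + b * z)).
Proof.
eapply cder_eq. 2:{ apply (cder_comp Cexp (fun t => RtoC (2 * PI) * Ci * (a + b * t))). apply cder_Cexp.
 apply cder_mult. apply cder_const. apply cder_plus. apply cder_const. apply cder_mult. apply cder_const. apply cder_id. }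
unfold ee. simpl. ring.
Qed.

Definition Pterm (u w : C) (n : nat) : C := - ee (RtoC (INR n) * u + w).
(** The product of 1 - q^n e(w) over n >= 1, with q = e(u). It is a function of the exponents rather
    than of q and e(w), so that fractional powers of q involve no choice of branch. *)
Definition Pp (u w : C) : C := Cinfprod (fun n => 1 + Pterm u w n).

Lemma geometric_bound K s : 0 <= K -> 0 < s < 1 -> partial_bound (fun n => (K * s ^ n)%R) (K / (1 - s)).
Proof.
intros HK Hs. split. intros n. apply Rmult_le_pos; trivial. apply pow_le. lra.
assert (G : forall n, (sum_f_R0 (fun n => K * s ^ n) n = K / (1 - s) - K * s ^ S n / (1 - s))%R).
{ induction n as [|n IH]. simpl. field. lra. cbn [sum_f_R0]. rewrite IH. simpl. field. lra. }
intros n. rewrite G. assert (0 <= K * s ^ S n / (1 - s)).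
{ apply Rmult_le_pos. apply Rmult_le_pos; trivial. apply pow_le. lra. left. apply Rinv_0_lt_compat. lra. }
lra.
Qed.

Lemma exp_nat_pow x n : exp (INR n * x) = (exp x ^ n)%R.
Proof. induction n as [|n IH]. simpl. rewrite Rmult_0_l. apply exp_0. rewrite S_INR, Rmult_plus_distr_r, exp_plus, IH, Rmult_1_l. simpl. ring. Qed.

Lemma im_nat_mult n u w : Im (RtoC (INR n) * u + w) = (INR n * Im u + Im w)%R.
Proof. now rewrite im_plus, im_scal_l. Qed.

Lemma Cmod_Pterm u w n : Cmod (Pterm u w n) = (exp (- (2 * PI * Im w)) * exp (- (2 * PI * Im u)) ^ n)%R.
Proof.
unfold Pterm. rewrite Cmod_opp, Cmod_ee, im_nat_mult, <- exp_nat_pow, <- exp_plus. f_equal. ring.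
Qed.

Lemma exp_neg_lt_1 x : 0 < x -> 0 < exp (- x) < 1.
Proof. intros H. split. apply exp_pos. rewrite <- exp_0. apply exp_increasing. lra. Qed.

Lemma Pterm_bound u w : 0 < Im u -> exists b B, partial_bound b B /\ forall n, Cmod (Pterm u w n) <= b n.
Proof.
intros Hu. eexists. eexists. split.
apply (geometric_bound (exp (- (2 * PI * Im w))) (exp (- (2 * PI * Im u)))).
left; apply exp_pos. apply exp_neg_lt_1. assert (PP := PI_RGT_0). nra.
intros n. rewrite Cmod_Pterm. lra.
Qed.

Lemma Pp_cv u w : 0 < Im u -> Ccv (Cprod (fun n => 1 + Pterm u w n)) (Pp u w).
Proof.
intros Hu. destruct (Pterm_bound u w Hu) as (b & B & Hb & Ha).
destruct (Cprod_cv (Pterm u w) b B Hb Ha) as [l Hl]. unfold Pp. now rewrite (Cinfprod_Ccv _ _ Hl).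
Qed.

Lemma Pp_unique u w l : Ccv (Cprod (fun n => 1 + Pterm u w n)) l -> Pp u w = l.
Proof. apply Cinfprod_Ccv. Qed.

Lemma Pp_nonzero u w : 0 < Im u -> (forall n, (1 <= n)%nat -> ee (RtoC (INR n) * u + w) <> 1) -> Pp u w <> 0.
Proof.
intros Hu H. destruct (Pterm_bound u w Hu) as (b & B & Hb & Ha).
apply (Cprod_cv_nonzero (Pterm u w) b B); trivial. 2: now apply Pp_cv.
intros n Hn E. apply (H n Hn). unfold Pterm in E.
replace (ee (RtoC (INR n) * u + w)) with (1 - (1 + - ee (RtoC (INR n) * u + w))) by ring. rewrite E. ring.
Qed.

Lemma Pp_ext u w u' w' : (forall n, (1 <= n)%nat -> ee (RtoC (INR n) * u + w) = ee (RtoC (INR n) * u' + w')) ->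
  0 < Im u' -> Pp u w = Pp u' w'.
Proof.
intros H Hu. apply Pp_unique. apply Ccv_ext with (2 := Pp_cv u' w' Hu). intros n.
apply Cprod_ext. intros k Hk. unfold Pterm. now rewrite H.
Qed.

Lemma Pp_plus_1 u w : 0 < Im u -> Pp u (w + 1) = Pp u w.
Proof. intros H. apply Pp_ext; trivial. intros n _. rewrite Cplus_assoc. apply ee_plus_1. Qed.

Lemma Pp_plus_1_l u w : 0 < Im u -> Pp (u + 1) w = Pp u w.
Proof.
intros H. apply Pp_ext; trivial. intros n _.
replace (RtoC (INR n) * (u + 1) + w) with (RtoC (INR n) * u + w + RtoC (INR n)) by ring. rewrite ee_plus, ee_nat. ring.
Qed.

Lemma Cprod_shift u n : Cprod u (S n) = u 1%nat * Cprod (fun k => u (S k)) n.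
Proof. induction n as [|n IH]. simpl. ring. change (Cprod u (S (S n))) with (Cprod u (S n) * u (S (S n))). rewrite IH. simpl. ring. Qed.

(** Passing from w to w - u starts the product one index earlier; the new first factor is 1 -
    e(w). *)
Lemma Pp_shift u w : 0 < Im u -> Pp u (w - u) = (1 - ee w) * Pp u w.
Proof.
intros Hu. apply Ccv_unique with (fun n => Cprod (fun k => 1 + Pterm u (w - u) k) (S n)).
- apply (Ccv_subseq _ _ S). lia. now apply Pp_cv.
- eapply Ccv_ext. 2: apply Ccv_mult; [apply Ccv_const|apply Pp_cv; exact Hu].
  intros n. rewrite Cprod_shift. f_equal.
  + unfold Pterm. simpl INR. replace (1 * u + (w - u)) with w by ring. ring.
  + apply Cprod_ext. intros k _. unfold Pterm. rewrite S_INR, RtoC_plus. apply (f_equal (fun z => 1 + - ee z)). ring.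
Qed.

Lemma Cprod_even_odd u n : Cprod u (2 * n) = Cprod (fun k => u (2 * k)%nat) n * Cprod (fun k => u (2 * k - 1)%nat) n.
Proof.
induction n as [|n IH]. simpl. ring.
replace (2 * S n)%nat with (S (S (2 * n))) by lia.
change (Cprod u (S (S (2 * n)))) with (Cprod u (2 * n) * u (S (2 * n)) * u (S (S (2 * n)))). rewrite IH.
change (Cprod (fun k => u (2 * k)%nat) (S n)) with (Cprod (fun k => u (2 * k)%nat) n * u (2 * S n)%nat).
change (Cprod (fun k => u (2 * k - 1)%nat) (S n)) with (Cprod (fun k => u (2 * k - 1)%nat) n * u (2 * S n - 1)%nat).
replace (2 * S n)%nat with (S (S (2 * n))) by lia. replace (S (S (2 * n)) - 1)%nat with (S (2 * n)) by lia. ring.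
Qed.

Lemma im_double u : Im (2 * u) = (2 * Im u)%R.
Proof. apply im_scal_l. Qed.

(** The factors of even and of odd index. *)
Lemma Pp_split u w : 0 < Im u -> Pp u w = Pp (2 * u) w * Pp (2 * u) (w - u).
Proof.
intros Hu. assert (Hu2 : 0 < Im (2 * u)) by (rewrite im_double; lra).
apply Ccv_unique with (fun n => Cprod (fun k => 1 + Pterm u w k) (2 * n)).
- apply (Ccv_subseq _ _ (fun n => (2 * n)%nat)). lia. now apply Pp_cv.
- eapply Ccv_ext. 2: apply Ccv_mult; apply Pp_cv; exact Hu2.
  intros n. rewrite Cprod_even_odd. f_equal; apply Cprod_ext; intros k Hk; unfold Pterm; apply (f_equal (fun z => 1 + - ee z)).
  + rewrite mult_INR, RtoC_mult. simpl INR. replace (1 + 1)%R with 2%R by ring. ring.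
  + rewrite minus_INR, mult_INR, RtoC_minus, RtoC_mult by lia. simpl INR. replace (1 + 1)%R with 2%R by ring. ring.
Qed.

(** Factor by factor this is (1 - x)(1 + x) = 1 - x^2, since e(1/2) = -1. *)
Lemma Pp_duplication u w : 0 < Im u -> Pp u w * Pp u (w + / 2) = Pp (2 * u) (2 * w).
Proof.
intros Hu. symmetry. apply Pp_unique.
eapply Ccv_ext. 2: apply Ccv_mult; apply Pp_cv; exact Hu.
intros n. cbv beta. rewrite Cprod_mult. apply Cprod_ext. intros k _. unfold Pterm.
rewrite Cplus_assoc, (ee_plus _ (/ 2)), ee_half.
replace (RtoC (INR k) * (2 * u) + 2 * w) with ((RtoC (INR k) * u + w) + (RtoC (INR k) * u + w)) by ring.
rewrite (ee_plus (_ + w)). ring.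
Qed.

Lemma Im_affine_near u0 u1 t0 eps : 0 < eps -> exists r, 0 < r /\
  forall t, Cmod (t - t0) < r -> Rabs (Im (u0 + u1 * t) - Im (u0 + u1 * t0)) <= eps.
Proof.
intros He. assert (P := Cmod_ge_0 u1). exists (eps / (Cmod u1 + 1))%R. split. apply Rdiv_lt_0_compat; lra.
intros t Ht. replace (Im (u0 + u1 * t) - Im (u0 + u1 * t0))%R with (Im (u1 * (t - t0))).
2:{ rewrite !im_plus, !im_mult. unfold Cminus. rewrite re_plus, im_plus, re_opp, im_opp. ring. }
eapply Rle_trans. apply im_le_Cmod. rewrite Cmod_mult.
replace eps with ((Cmod u1 + 1) * (eps / (Cmod u1 + 1)))%R by (field; lra).
apply Rmult_le_compat; try lra. apply Cmod_ge_0.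
Qed.

Lemma nat_exp_bound y n : 0 < y -> INR n * exp (- (INR n * y)) <= / y.
Proof.
intros Hy. rewrite exp_Ropp. assert (P := exp_pos (INR n * y)).
assert (X := exp_ineq1_le (INR n * y)).
apply Rmult_le_reg_r with (exp (INR n * y)); trivial. rewrite Rmult_assoc, Rinv_l by lra.
apply Rmult_le_reg_l with y; trivial. rewrite <- (Rmult_assoc y (/ y)), Rinv_r by lra. lra.
Qed.

Theorem cder_Pp (u0 u1 w0 w1 t0 : C) : 0 < Im (u0 + u1 * t0) ->
  exists D, cder (fun t => Pp (u0 + u1 * t) (w0 + w1 * t)) t0 D.
Proof.
intros Hy0. assert (PP := PI_RGT_0). set (y := (Im (u0 + u1 * t0) / 2)%R). assert (Hy : 0 < y) by (unfold y; lra).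
destruct (Im_affine_near u0 u1 t0 y Hy) as (r1 & Hr1 & H1).
destruct (Im_affine_near w0 w1 t0 1%R Rlt_0_1) as (r2 & Hr2 & H2).
set (W := (1 + Rabs (Im (w0 + w1 * t0)))%R).
set (K := exp (2 * PI * W)).
set (K' := (K * (1 + 2 * PI * (Cmod u1 / (PI * y) + Cmod w1)))%R).
(* On the chosen disc the imaginary part of u0 + u1 t stays above [y], so the n-th term decays like
   s^(2n). One factor s^n absorbs the n that differentiation brings down, the other serves as the
   majorant. *)
set (s := exp (- (PI * y))).
assert (PK : 0 < K) by apply exp_pos.
assert (Py : 0 < PI * y) by (apply Rmult_lt_0_compat; lra).
assert (Q0 : 0 <= Cmod u1 / (PI * y) + Cmod w1).
{ generalize (Cmod_ge_0 u1) (Cmod_ge_0 w1). intros. assert (0 <= Cmod u1 / (PI * y)). apply Rmult_le_pos; trivial. left. now apply Rinv_0_lt_compat. lra. }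
assert (PK' : 0 <= K'). { apply Rmult_le_pos. lra. nra. }
assert (B := geometric_bound K' s PK' (exp_neg_lt_1 _ Py)).
apply (cder_infinite_product (fun n t => Pterm (u0 + u1 * t) (w0 + w1 * t) n)
  (fun n t => RtoC (2 * PI) * Ci * (RtoC (INR n) * u1 + w1) * Pterm (u0 + u1 * t) (w0 + w1 * t) n)
  _ _ _ t0 (Rmin r1 r2) ltac:(now apply Rmin_glb_lt) B).
- intros n t Ht.
  specialize (H1 t ltac:(eapply Rlt_le_trans; [apply Ht|apply Rmin_l])). specialize (H2 t ltac:(eapply Rlt_le_trans; [apply Ht|apply Rmin_r])).
  apply Rabs_le_between in H1. apply Rabs_le_between in H2.
  assert (I1 : y <= Im (u0 + u1 * t)) by (unfold y in *; lra).
  assert (I2 : - W <= Im (w0 + w1 * t)). { unfold W. generalize (Rle_abs (- Im (w0 + w1 * t0))). rewrite Rabs_Ropp. lra. }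
  assert (S2 : (exp (- (2 * PI * y)) = s * s)%R). { unfold s. rewrite <- exp_plus. f_equal. ring. }
  assert (A : Cmod (Pterm (u0 + u1 * t) (w0 + w1 * t) n) <= K * (s ^ n * s ^ n)).
  { rewrite Cmod_Pterm. rewrite <- Rpow_mult_distr, <- S2. apply Rmult_le_compat.
    - left; apply exp_pos. - apply pow_le; left; apply exp_pos.
    - apply exp_le_mono. nra.
    - apply pow_incr. split. left; apply exp_pos. apply exp_le_mono. nra. }
  assert (Ps : 0 < s ^ n) by (apply pow_lt, exp_pos).
  assert (s1 : s ^ n <= 1). { rewrite <- (pow1 n). apply pow_incr. split; left; apply exp_neg_lt_1; trivial. }
  assert (A1 : K * (s ^ n * s ^ n) <= K' * s ^ n).
  { unfold K'. rewrite !Rmult_assoc. apply Rmult_le_compat_l. lra.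
    apply Rmult_le_compat_r. lra. assert (0 <= 2 * (PI * (Cmod u1 / (PI * y) + Cmod w1))) by (apply Rmult_le_pos; [lra|apply Rmult_le_pos; lra]). lra. }
  repeat split.
  + lra.
  + rewrite !Cmod_mult, Cmod_Ci, Cmod_R, Rabs_pos_eq, Rmult_1_r by lra.
    assert (N : INR n * s ^ n <= / (PI * y)).
    { unfold s. rewrite <- exp_nat_pow. replace (INR n * - (PI * y))%R with (- (INR n * (PI * y)))%R by ring. now apply nat_exp_bound. }
    assert (T : Cmod (RtoC (INR n) * u1 + w1) <= INR n * Cmod u1 + Cmod w1).
    { eapply Rle_trans. apply Cmod_triangle. rewrite Cmod_mult, Cmod_R, Rabs_pos_eq by apply pos_INR. lra. }
    apply Rle_trans with (2 * PI * (INR n * Cmod u1 + Cmod w1) * (K * (s ^ n * s ^ n)))%R.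
    { apply Rmult_le_compat; trivial. apply Rmult_le_pos. lra. apply Cmod_ge_0. apply Cmod_ge_0. apply Rmult_le_compat_l; lra. }
    replace (2 * PI * (INR n * Cmod u1 + Cmod w1) * (K * (s ^ n * s ^ n)))%R with
      (K * (2 * PI * (Cmod u1 * (INR n * s ^ n) + Cmod w1 * s ^ n)) * s ^ n)%R by ring.
    unfold K'. apply Rmult_le_compat_r. lra. apply Rmult_le_compat_l. lra.
    assert (Cmod u1 * (INR n * s ^ n) <= Cmod u1 / (PI * y)) by (apply Rmult_le_compat_l; [apply Cmod_ge_0|trivial]).
    assert (Cmod w1 * s ^ n <= Cmod w1) by (generalize (Cmod_ge_0 w1); nra).
    assert (2 * PI * (Cmod u1 * (INR n * s ^ n) + Cmod w1 * s ^ n) <= 2 * PI * (Cmod u1 / (PI * y) + Cmod w1)) by (apply Rmult_le_compat_l; lra). lra.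
  + unfold Pterm. apply cder_ext with (fun z => - ee (RtoC (INR n) * u0 + w0 + (RtoC (INR n) * u1 + w1) * z)).
    { intros z. apply (f_equal (fun z => - ee z)). ring. }
    eapply cder_eq. 2: apply cder_opp, cder_ee_affine.
    replace (RtoC (INR n) * u0 + w0 + (RtoC (INR n) * u1 + w1) * t) with (RtoC (INR n) * (u0 + u1 * t) + (w0 + w1 * t)) by ring. ring.
- intros t Ht. apply Pp_cv.
  specialize (H1 t ltac:(eapply Rlt_le_trans; [apply Ht|apply Rmin_l])). apply Rabs_le_between in H1. unfold y in *. lra.
Qed.

(** * Theta functions under inversion *)

(** The same [del] measures the neighbourhood and bounds the values by its inverse. A single gauge
    then suffices for [compactness_value_2d], and the inverse of the resulting d0 is a global
    bound. *)
Lemma rect_bounded (g : R -> R -> R) a b c d :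
  (forall u v, a <= u <= b -> c <= v <= d -> exists del : posreal,
     forall s t, a <= s <= b -> c <= t <= d -> Rabs (s - u) < del -> Rabs (t - v) < del -> g s t <= / del) ->
  exists M, forall s t, a <= s <= b -> c <= t <= d -> g s t <= M.
Proof.
intros H.
assert (H' : forall u v, {del : posreal | a <= u <= b -> c <= v <= d ->
  forall s t, a <= s <= b -> c <= t <= d -> Rabs (s - u) < del -> Rabs (t - v) < del -> g s t <= / del}).
{ intros u v. apply constructive_indefinite_description.
  destruct (excluded_middle_informative (a <= u <= b /\ c <= v <= d)) as [[Hu Hv]|N].
  - destruct (H u v Hu Hv) as [del Hd]. now exists del.
  - exists (mkposreal 1 Rlt_0_1). tauto. }
destruct (compactness_value_2d a b c d (fun u v => proj1_sig (H' u v))) as [d0 Hd0].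
exists (/ d0)%R. intros s t Hs Ht. apply Rnot_lt_le. intros L. apply (Hd0 s t Hs Ht).
intros (u & v & Hu & Hv & H1 & H2 & H3).
assert (X := proj2_sig (H' u v) Hu Hv s t Hs Ht H1 H2).
assert (/ proj1_sig (H' u v) <= / d0). { apply Rinv_le_contravar; trivial. apply cond_pos. }
apply (Rlt_irrefl (/ d0)). eapply Rlt_le_trans. apply L. eapply Rle_trans. apply X. trivial.
Qed.

(** A continuous function is bounded on the rectangle. If the supremum M of |f| were not attained, 1
    / (M - |f|) would be locally bounded, hence bounded, and M could be lowered. *)
Lemma rect_attains_max (f : C -> C) a b c d : a <= b -> c <= d ->
  (forall s t, a <= s <= b -> c <= t <= d -> ccont f (s, t)) ->
  exists s0 t0, a <= s0 <= b /\ c <= t0 <= d /\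
    forall s t, a <= s <= b -> c <= t <= d -> Cmod (f (s, t)) <= Cmod (f (s0, t0)).
Proof.
intros Hab Hcd Hf.
assert (LOC : forall u v eps, a <= u <= b -> c <= v <= d -> 0 < eps -> exists del, 0 < del /\
   forall s t, Rabs (s - u) < del -> Rabs (t - v) < del -> Cmod (f (s, t)) < Cmod (f (u, v)) + eps).
{ intros u v eps Hu Hv He. destruct (Hf u v Hu Hv eps He) as [del [Hd H]].
  exists (del / 2)%R. split. lra. intros s t Hs Ht. specialize (H (s, t)).
  assert (X : Cmod ((s, t) - (u, v)) < del).
  { eapply Rle_lt_trans. apply Cmod_le_parts. unfold Re, Im, Cminus, Cplus, Copp; simpl. unfold Rminus in *. lra. }
  specialize (H X). generalize (Cmod_sub_ge (f (s, t)) (f (u, v))). lra. }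
destruct (rect_bounded (fun s t => Cmod (f (s, t))) a b c d) as [B HB].
{ intros u v Hu Hv. destruct (LOC u v 1%R Hu Hv Rlt_0_1) as [del [Hd H]].
  assert (P : 0 < Cmod (f (u, v)) + 1) by (generalize (Cmod_ge_0 (f (u, v))); lra).
  assert (Q : 0 < Rmin del (/ (Cmod (f (u, v)) + 1))) by (apply Rmin_glb_lt; trivial; now apply Rinv_0_lt_compat).
  exists (mkposreal _ Q). simpl. intros s t _ _ Hs Ht. left. eapply Rlt_le_trans. apply H; (eapply Rlt_le_trans; [eassumption|apply Rmin_l]).
  rewrite <- (Rinv_inv (Cmod (f (u, v)) + 1)) at 1. apply Rinv_le_contravar; trivial. apply Rmin_r. }
destruct (completeness (fun r => exists s t, a <= s <= b /\ c <= t <= d /\ r = Cmod (f (s, t)))) as [M [M1 M2]].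
{ exists B. intros r (s & t & Hs & Ht & ->). now apply HB. }
{ exists (Cmod (f (a, c))). exists a, c. repeat split; lra. }
destruct (excluded_middle_informative (exists s0 t0, a <= s0 <= b /\ c <= t0 <= d /\ Cmod (f (s0, t0)) = M)) as [(s0 & t0 & Hs & Ht & E)|N].
- exists s0, t0. repeat split; try lra. intros s t Hs' Ht'. rewrite E. apply M1. now exists s, t.
- exfalso.
  assert (LT : forall s t, a <= s <= b -> c <= t <= d -> Cmod (f (s, t)) < M).
  { intros s t Hs Ht. destruct (M1 (Cmod (f (s, t)))) as [L|E]; trivial. now exists s, t. exfalso. apply N. now exists s, t. }
  destruct (rect_bounded (fun s t => / (M - Cmod (f (s, t))))%R a b c d) as [B' HB'].
  { intros u v Hu Hv. assert (G := LT u v Hu Hv). set (e := ((M - Cmod (f (u, v))) / 2)%R).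
    assert (He : 0 < e) by (unfold e; lra).
    destruct (LOC u v e Hu Hv He) as [del [Hd H]].
    assert (Q : 0 < Rmin del e) by (now apply Rmin_glb_lt).
    exists (mkposreal _ Q). simpl. intros s t _ _ Hs Ht. apply Rinv_le_contravar; trivial.
    assert (X : Cmod (f (s, t)) < Cmod (f (u, v)) + e) by (apply H; (eapply Rlt_le_trans; [eassumption|apply Rmin_l])).
    generalize (Rmin_r del e). unfold e in *. lra. }
  assert (PB : 0 < B'). { eapply Rlt_le_trans. 2: apply (HB' a c); lra. apply Rinv_0_lt_compat. generalize (LT a c ltac:(lra) ltac:(lra)). lra. }
  assert (M <= M - / B').
  { apply M2. intros r (s & t & Hs & Ht & ->). specialize (HB' s t Hs Ht). specialize (LT s t Hs Ht).
    assert (/ B' <= M - Cmod (f (s, t))). { rewrite <- (Rinv_inv (M - Cmod (f (s, t)))). apply Rinv_le_contravar; trivial. apply Rinv_0_lt_compat. lra. } lra. }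
  generalize (Rinv_0_lt_compat _ PB). lra.
Qed.

Lemma period_Z (K : C -> C) p : (forall z, K (z + p) = K z) -> forall (k : Z) z, K (z + RtoC (IZR k) * p) = K z.
Proof.
intros H.
assert (P : forall n z, K (z + RtoC (INR n) * p) = K z).
{ induction n as [|n IH]; intros z. simpl. f_equal. ring. rewrite S_INR, RtoC_plus.
  replace (z + (RtoC (INR n) + 1) * p) with (z + RtoC (INR n) * p + p) by ring. now rewrite H. }
intros k z. destruct (Z_le_gt_dec 0 k).
- rewrite <- (Z2Nat.id k) by lia. rewrite <- INR_IZR_INZ. apply P.
- rewrite <- (P (Z.to_nat (- k)) (z + _)). f_equal. rewrite INR_IZR_INZ, Z2Nat.id, opp_IZR, RtoC_opp by lia. ring.
Qed.

Lemma floor_shift (x p : R) : 0 < p -> exists k : Z, 0 <= x + IZR k * p <= p.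
Proof.
intros Hp. exists (1 - up (x / p))%Z. destruct (archimed (x / p)) as [A B].
rewrite minus_IZR. set (n := IZR (up (x / p))) in *.
assert (E : x = (x / p * p)%R) by (field; lra).
split; rewrite E at 1; nra.
Qed.

Lemma elliptic_constant (K : C -> C) u : 0 < Im u -> (forall z, exists d, cder K z d) ->
  (forall z, K (z + 1) = K z) -> (forall z, K (z + u) = K z) -> forall z z', K z = K z'.
Proof.
intros Hu HD H1 H2.
destruct (rect_attains_max K 0 1 0 (Im u) ltac:(lra) ltac:(lra)) as (s0 & t0 & Hs & Ht & HM).
{ intros s t _ _. destruct (HD (s, t)) as [d Hd]. eapply cder_ccont, Hd. }
set (z0 := (s0, t0) : C) in *.
assert (G : forall z, Cmod (K z) <= Cmod (K z0)).
(* The rectangle of sides 1 and Im u meets every class modulo the periods even if u is not purely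
   imaginary: multiples of u adjust the imaginary part first, and integers then move only the real
   part. *)
{ intros z. destruct (floor_shift (Im z) (Im u) Hu) as [l Hl].
  rewrite <- (period_Z K u H2 l z). set (z1 := z + RtoC (IZR l) * u).
  destruct (floor_shift (Re z1) 1 Rlt_0_1) as [k Hk].
  rewrite <- (period_Z K 1 H1 k z1). set (z2 := z1 + RtoC (IZR k) * 1).
  replace z2 with (Re z2, Im z2) by (now destruct z2). apply HM.
  unfold z2. rewrite re_plus, re_scal_l, re_RtoC. lra.
  unfold z2, z1. rewrite !im_plus, !im_scal_l, im_RtoC. lra. }
assert (C : forall z, K z = K z0).
{ intros z. apply (maximum_principle K z0 (Cmod (z - z0) + 1)). intros w _. apply HD. intros; apply G. lra. }
intros z z'. now rewrite (C z), (C z').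
Qed.

(** * The quotient of the theta functions and its removable singularities *)

Definition expquot (w : C) : C := if Ceq_dec w 0 then 1 else (Cexp w - 1) / w.

Lemma Cexp_bound_unit w : Cmod w <= 1 -> Cmod (Cexp w) <= 3.
Proof.
intros H. rewrite Cmod_Cexp. eapply Rle_trans. 2: apply exp_le_3. apply exp_le_mono.
generalize (re_le_Cmod w). intros X. apply Rabs_le_between in X. lra.
Qed.

Lemma Cmod_segment t h : 0 <= t <= 1 -> Cmod (0 + RtoC t * (h - 0)) <= Cmod h.
Proof.
intros Ht. replace (0 + RtoC t * (h - 0)) with (RtoC t * h) by ring. rewrite Cmod_mult, Cmod_R, Rabs_pos_eq by lra.
generalize (Cmod_ge_0 h). nra.
Qed.

(** Each order follows from the preceding one by the increment bound on the segment from 0 to h,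
    starting from |exp| <= 3 on the unit disc. *)
Lemma Cexp_taylor_2 h : Cmod h <= 1 -> Cmod (Cexp h - 1 - h - h * h / 2) <= 3 * Cmod h ^ 3.
Proof.
assert (B0 : forall h, Cmod h <= 1 -> Cmod (Cexp h - 1) <= 3 * Cmod h).
{ intros k Hk. assert (X := cder_increment_bound Cexp Cexp 0 k 3%R). rewrite Cexp_0 in X.
  replace (k - 0) with k in X by ring. apply X. intros; apply cder_Cexp. intros t Ht. apply Cexp_bound_unit.
  eapply Rle_trans. 2: apply Hk. replace k with (k - 0) at 1 by ring. now apply Cmod_segment. }
assert (B1 : forall h, Cmod h <= 1 -> Cmod (Cexp h - 1 - h) <= 3 * Cmod h ^ 2).
{ intros k Hk. assert (X := cder_increment_bound (fun w => Cexp w - w) (fun w => Cexp w - 1) 0 k (3 * Cmod k)%R).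
  cbv beta in X. rewrite Cexp_0 in X. replace (Cexp k - k - (1 - 0)) with (Cexp k - 1 - k) in X by ring.
  replace (3 * Cmod k ^ 2)%R with (3 * Cmod k * Cmod (k - 0))%R. 2: { replace (k - 0) with k by ring. ring. }
  apply X. intros; apply cder_minus; [apply cder_Cexp|apply cder_id].
  intros t Ht. assert (Y := Cmod_segment t k Ht). eapply Rle_trans. apply B0. lra. lra. }
intros Hh. assert (X := cder_increment_bound (fun w => Cexp w - w - w * w / 2) (fun w => Cexp w - 1 - w) 0 h (3 * Cmod h ^ 2)%R).
cbv beta in X. rewrite Cexp_0 in X. replace (Cexp h - h - h * h / 2 - (1 - 0 - 0 * 0 / 2)) with (Cexp h - 1 - h - h * h / 2) in X by field.
replace (3 * Cmod h ^ 3)%R with (3 * Cmod h ^ 2 * Cmod (h - 0))%R. 2: { replace (h - 0) with h by ring. ring. }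
apply X.
- intros t Ht. eapply cder_eq. 2: { apply cder_minus. apply cder_minus. apply cder_Cexp. apply cder_id.
   apply (cder_mult (fun w => w * w) (fun _ => / 2)). apply cder_mult; apply cder_id. apply cder_const. }
  simpl. field.
- intros t Ht. assert (Y := Cmod_segment t h Ht). eapply Rle_trans. apply B1. lra.
  apply Rmult_le_compat_l. lra. apply pow_incr. split; trivial. apply Cmod_ge_0.
Qed.

Lemma cder_expquot_0 : cder expquot 0 (/ 2).
Proof.
intros eps He. exists (Rmin 1 (eps / 3)). split. apply Rmin_glb_lt; lra.
intros h Hh. assert (h1 : Cmod h < 1) by (eapply Rlt_le_trans; [apply Hh|apply Rmin_l]).
assert (h2 : Cmod h < eps / 3) by (eapply Rlt_le_trans; [apply Hh|apply Rmin_r]).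
rewrite Cplus_0_l. unfold expquot. destruct (Ceq_dec 0 0) as [_|N]; [|now elim N].
destruct (Ceq_dec h 0) as [->|N].
- replace (1 - 1 - / 2 * 0) with (RtoC 0) by ring. rewrite Cmod_0. lra.
- replace ((Cexp h - 1) / h - 1 - / 2 * h) with ((Cexp h - 1 - h - h * h / 2) / h) by (field; trivial).
  assert (P := proj1 (Cmod_gt_0 h) N). rewrite Cmod_div by trivial. apply Rmult_le_reg_r with (Cmod h); trivial.
  unfold Rdiv. rewrite Rmult_assoc, Rinv_l, Rmult_1_r by lra.
  eapply Rle_trans. apply Cexp_taylor_2. lra. simpl.
  assert (3 * Cmod h <= eps) by lra. assert (0 <= Cmod h * Cmod h) by nra.
  replace (3 * (Cmod h * (Cmod h * (Cmod h * 1))))%R with (3 * Cmod h * (Cmod h * Cmod h))%R by ring.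
  replace (eps * Cmod h * Cmod h)%R with (eps * (Cmod h * Cmod h))%R by ring.
  apply Rmult_le_compat_r; lra.
Qed.

Lemma two_PI_i_neq_0 : RtoC (2 * PI) * Ci <> 0.
Proof. apply Cmult_neq_0. intros E. apply RtoC_inj in E. generalize PI_RGT_0. lra. apply Ci_nz. Qed.

(** The cofactor of the zero of 1 - e(z) at 0; it lets the zeros of the two theta functions at 0 be
    cancelled explicitly. *)
Definition ee_quot (z : C) : C := expquot (RtoC (2 * PI) * Ci * z).

Lemma ee_quot_spec z : 1 - ee z = - (RtoC (2 * PI) * Ci) * z * ee_quot z.
Proof.
assert (N := two_PI_i_neq_0). unfold ee_quot, expquot, ee. destruct Ceq_dec as [E|E].
- rewrite E, Cexp_0. destruct (Ceq_dec z 0) as [->|Nz]. ring. exfalso. now apply (Cmult_neq_0 _ _ N Nz).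
- set (w := RtoC (2 * PI) * Ci) in *. field. split; trivial; intros Z; apply E; rewrite Z; ring.
Qed.

Lemma cder_ee_quot_scaled a : exists d, cder (fun z => ee_quot (a * z)) 0 d.
Proof.
eexists. unfold ee_quot. apply (cder_comp expquot (fun z => RtoC (2 * PI) * Ci * (a * z))).
- rewrite !Cmult_0_r. apply cder_expquot_0.
- apply cder_mult. apply cder_const. apply cder_mult. apply cder_const. apply cder_id.
Qed.

Lemma ee_quot_0 : ee_quot 0 = 1.
Proof. unfold ee_quot, expquot. rewrite Cmult_0_r. destruct Ceq_dec as [_|N]; trivial. now elim N. Qed.

Definition theta (u z : C) : C := (1 - ee z) * Pp u z * Pp u (- z).

Lemma theta_plus_1 u z : 0 < Im u -> theta u (z + 1) = theta u z.
Proof.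
intros H. unfold theta. rewrite ee_plus_1, Pp_plus_1 by trivial.
rewrite <- (Pp_plus_1 u (- (z + 1))) by trivial. replace (- (z + 1) + 1) with (- z) by ring. reflexivity.
Qed.

Lemma theta_plus_u u z : 0 < Im u -> theta u (z + u) = - ee (- z) * theta u z.
Proof.
intros H. unfold theta. assert (A := Pp_shift u (z + u) H). replace (z + u - u) with z in A by ring.
replace (- (z + u)) with (- z - u) by ring. rewrite Pp_shift by trivial. rewrite <- A.
rewrite ee_opp. field. apply ee_neq_0.
Qed.

Lemma theta_zero u z : 0 < Im u -> theta u z = 0 -> exists k l : Z, z = RtoC (IZR k) + RtoC (IZR l) * u.
Proof.
intros Hu H. 
assert (Z : forall w, Pp u w = 0 -> exists k l : Z, w = RtoC (IZR k) + RtoC (IZR l) * u).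
{ intros w Hw. destruct (excluded_middle_informative (exists n, (1 <= n)%nat /\ ee (RtoC (INR n) * u + w) = 1)) as [(n & Hn & E)|N].
  - destruct (ee_eq_1 _ E) as [k Hk]. exists k, (- Z.of_nat n)%Z. rewrite opp_IZR, <- INR_IZR_INZ, RtoC_opp, <- Hk. ring.
  - exfalso. apply (Pp_nonzero u w Hu); trivial. intros n Hn E. apply N. now exists n. }
destruct (Ceq_dec (1 - ee z) 0) as [E|N1].
- destruct (ee_eq_1 z) as [k Hk]. symmetry. now apply Ceq_minus. exists k, 0%Z. rewrite Hk. ring.
- destruct (Ceq_dec (Pp u z) 0) as [E|N2]. now apply Z.
  destruct (Ceq_dec (Pp u (- z)) 0) as [E|N3].
  + destruct (Z _ E) as (k & l & Hkl). exists (- k)%Z, (- l)%Z. rewrite !opp_IZR, !RtoC_opp.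
    replace z with (- - z) by ring. rewrite Hkl. ring.
  + exfalso. unfold theta in H. now apply (Cmult_neq_0 _ _ (Cmult_neq_0 _ _ N1 N2) N3).
Qed.

Lemma cder_Pp_scaled u a z : 0 < Im u -> exists d, cder (fun z => Pp u (a * z)) z d.
Proof.
intros Hu. destruct (cder_Pp u 0 0 a z) as [d Hd]. now rewrite Cmult_0_l, Cplus_0_r.
exists d. apply cder_ext with (2 := Hd). intros w. now rewrite Cmult_0_l, Cplus_0_r, Cplus_0_l.
Qed.

Lemma cder_theta_scaled u a z : 0 < Im u -> exists d, cder (fun z => theta u (a * z)) z d.
Proof.
intros Hu. destruct (cder_Pp_scaled u a z Hu) as [d1 H1]. destruct (cder_Pp_scaled u (- a) z Hu) as [d2 H2].
eexists. unfold theta. apply cder_mult. apply cder_mult. apply cder_minus. apply cder_const.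
apply cder_ext with (fun z => ee (0 + a * z)). intros w. now rewrite Cplus_0_l. apply cder_ee_affine. apply H1.
apply cder_ext with (2 := H2). intros w. f_equal. ring.
Qed.

Lemma Im_neg_inv u : 0 < Im u -> 0 < Im (- / u).
Proof.
intros H. destruct u as [x y]. unfold Im, Cinv, Copp in *; simpl in *.
assert (0 < x * (x * 1) + y * (y * 1)) by nra.
replace (- (- y / (x * (x * 1) + y * (y * 1))))%R with (y / (x * (x * 1) + y * (y * 1)))%R by (field; lra).
now apply Rdiv_lt_0_compat.
Qed.

Lemma Pp_0_nonzero u : 0 < Im u -> Pp u 0 <> 0.
Proof.
intros Hu. apply Pp_nonzero; trivial. intros n Hn E. assert (PP := PI_RGT_0).
assert (X := Cmod_ee (RtoC (INR n) * u + 0)). rewrite E, Cmod_1, im_nat_mult in X. simpl in X.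
assert (1 <= INR n) by (apply (le_INR 1); trivial).
assert (exp (- (2 * PI * (INR n * Im u + 0))) < 1). { apply exp_neg_lt_1. apply Rmult_lt_0_compat. lra. nra. }
lra.
Qed.

Lemma ccont_nonzero f z : ccont f z -> f z <> 0 -> exists r, 0 < r /\ forall w, Cmod (w - z) < r -> f w <> 0.
Proof.
intros H N. assert (P := proj1 (Cmod_gt_0 _) N). destruct (H _ P) as [r [Hr H1]]. exists r. split; trivial.
intros w Hw E. specialize (H1 w Hw). rewrite E in H1. replace (0 - f z) with (- f z) in H1 by ring. rewrite Cmod_opp in H1. lra.
Qed.

(** The Gaussian e(-z^2 / (2u)) corrects the multipliers under z -> z + u and z -> z - 1. The linear
    terms appear because [theta u z] is e(z/2) times an odd function of z, and likewise for -1/u at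
    z/u. *)
Definition theta_mult (u z : C) : C := ee (- (z * z) / (2 * u) + z / 2 - z / (2 * u)).
Definition theta_dual (u z : C) : C := theta_mult u z * theta (- / u) (/ u * z).

Section Inversion.
Variable u : C.
Hypothesis Hu : 0 < Im u.

Lemma im_pos_neq_0 (w : C) : 0 < Im w -> w <> 0.
Proof. intros H E. rewrite E in H. simpl in H. lra. Qed.

Lemma theta_dual_plus_u z : theta_dual u (z + u) = - ee (- z) * theta_dual u z.
Proof.
assert (N := im_pos_neq_0 u Hu). unfold theta_dual.
replace (/ u * (z + u)) with (/ u * z + 1) by (field; trivial). rewrite theta_plus_1 by now apply Im_neg_inv.
rewrite Cmult_assoc. f_equal. unfold theta_mult.
replace (- ((z + u) * (z + u)) / (2 * u) + (z + u) / 2 - (z + u) / (2 * u)) with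
  ((- (z * z) / (2 * u) + z / 2 - z / (2 * u)) + - z + - / 2) by (field; trivial).
rewrite !ee_plus. rewrite (ee_opp (/ 2)), ee_half. field.
Qed.

(** The step is -1 because it moves z/u by -1/u, the quasi-period of the dual theta function. *)
Lemma theta_dual_minus_1 z : theta_dual u (z - 1) = theta_dual u z.
Proof.
assert (N := im_pos_neq_0 u Hu). unfold theta_dual.
replace (/ u * (z - 1)) with (/ u * z + - / u) by (field; trivial). rewrite theta_plus_u by now apply Im_neg_inv.
rewrite Cmult_assoc. f_equal. unfold theta_mult.
replace (- ((z - 1) * (z - 1)) / (2 * u) + (z - 1) / 2 - (z - 1) / (2 * u)) with
  ((- (z * z) / (2 * u) + z / 2 - z / (2 * u)) + / u * z + - / 2) by (field; trivial).
rewrite !ee_plus. rewrite (ee_opp (/ 2)), ee_half, ee_opp. field. apply ee_neq_0.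
Qed.

(* The quotient of the two theta functions in a neighbourhood of 0, the common factor [z] being cancelled. *)
Definition theta_ratio_near_0 (z : C) : C :=
  theta_mult u z * (/ u * (ee_quot (/ u * z) * (Pp (- / u) (/ u * z) * Pp (- / u) (- / u * z)))) /
  (ee_quot (1 * z) * (Pp u (1 * z) * Pp u (- (1) * z))).

(** The zeros of [theta u] are the lattice points, so by periodicity the removable value at 0 is the
    right one at all of them. *)
Definition theta_ratio (z : C) : C :=
  if Ceq_dec (theta u z) 0 then theta_ratio_near_0 0 else theta_dual u z / theta u z.

Lemma theta_ratio_plus_u z : theta_ratio (z + u) = theta_ratio z.
Proof.
unfold theta_ratio. rewrite theta_plus_u, theta_dual_plus_u by trivial.
assert (N := ee_neq_0 (- z)).
destruct (Ceq_dec (- ee (- z) * theta u z) 0) as [E|E]; destruct (Ceq_dec (theta u z) 0) as [E'|E']; trivial.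
- exfalso. apply (Cmult_neq_0 _ _ N E'). replace (ee (- z) * theta u z) with (- (- ee (- z) * theta u z)) by ring. rewrite E. ring.
- exfalso. apply E. rewrite E'. ring.
- field. now split.
Qed.

Lemma theta_ratio_plus_1 z : theta_ratio (z + 1) = theta_ratio z.
Proof.
unfold theta_ratio. rewrite theta_plus_1 by trivial. rewrite <- (theta_dual_minus_1 (z + 1)).
replace (z + 1 - 1) with z by ring. reflexivity.
Qed.

Lemma cder_theta_mult z : exists d, cder (theta_mult u) z d.
Proof.
eexists. unfold theta_mult. apply (cder_comp Cexp (fun z => RtoC (2 * PI) * Ci * (- (z * z) / (2 * u) + z / 2 - z / (2 * u)))).
apply cder_Cexp. apply cder_mult. apply cder_const. apply cder_minus. apply cder_plus.
- apply (cder_mult (fun z => - (z * z)) (fun _ => / (2 * u))). apply cder_opp. apply cder_mult; apply cder_id. apply cder_const.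
- apply (cder_mult (fun z => z) (fun _ => / 2)). apply cder_id. apply cder_const.
- apply (cder_mult (fun z => z) (fun _ => / (2 * u))). apply cder_id. apply cder_const.
Qed.

(** As long as the cofactor [D] does not vanish, 0 is the only zero of the denominator, and the
    ratio agrees with [theta_ratio_near_0], which is a quotient of differentiable functions. *)
Lemma cder_theta_ratio_0 : exists d, cder theta_ratio 0 d.
Proof.
assert (N := im_pos_neq_0 u Hu). assert (Hu' := Im_neg_inv u Hu).
set (D := fun z => ee_quot (1 * z) * (Pp u (1 * z) * Pp u (- (1) * z))).
destruct (cder_ee_quot_scaled 1) as [d1 H1]. destruct (cder_ee_quot_scaled (/ u)) as [d2 H2].
destruct (cder_Pp_scaled u 1 0 Hu) as [d3 H3]. destruct (cder_Pp_scaled u (- (1)) 0 Hu) as [d4 H4].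
destruct (cder_Pp_scaled (- / u) (/ u) 0 Hu') as [d5 H5]. destruct (cder_Pp_scaled (- / u) (- / u) 0 Hu') as [d6 H6].
destruct (cder_theta_mult 0) as [d7 H7].
assert (DD : exists d, cder D 0 d).
{ eexists. unfold D. apply cder_mult. exact H1. apply cder_mult. exact H3. exact H4. }
assert (D0 : D 0 <> 0).
{ unfold D. rewrite !Cmult_0_r, ee_quot_0. assert (X := Pp_0_nonzero u Hu). repeat apply Cmult_neq_0; trivial. apply C1_nz. }
destruct DD as [dD DD].
destruct (ccont_nonzero D 0 (cder_ccont _ _ _ DD) D0) as (r & Hr & HD).
assert (R0 : exists d, cder theta_ratio_near_0 0 d).
{ eexists. unfold theta_ratio_near_0. apply (cder_div _ D). 2: exact DD. 2: exact D0.
  apply cder_mult. exact H7. apply cder_mult. apply cder_const. apply cder_mult. exact H2. apply cder_mult. exact H5. exact H6. }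
destruct R0 as [d Hd]. exists d. apply cder_ext_loc with (2 := Hd).
exists r. split; trivial. intros z Hz. specialize (HD z Hz).
assert (P2 := two_PI_i_neq_0).
assert (T : theta u z = - (RtoC (2 * PI) * Ci) * z * D z).
{ unfold theta, D. rewrite ee_quot_spec. replace (1 * z) with z by ring. replace (- (1) * z) with (- z) by ring. ring. }
unfold theta_ratio. destruct Ceq_dec as [E|E].
- assert (Z0 : z = 0).
  { destruct (Ceq_dec z 0) as [|Nz]; trivial. exfalso. rewrite T in E.
    apply (Cmult_neq_0 _ _ (Cmult_neq_0 _ _ P2 Nz) HD). replace (RtoC (2 * PI) * Ci * z * D z) with (- (- (RtoC (2 * PI) * Ci) * z * D z)) by ring. rewrite E. ring. }
  now rewrite Z0.
- assert (Nz : z <> 0). { intros ->. apply E. rewrite T. ring. }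
  unfold theta_dual. rewrite T. unfold theta_ratio_near_0. fold (D z).
  unfold theta. rewrite ee_quot_spec. replace (- / u * z) with (- (/ u * z)) by ring.
  set (w := RtoC (2 * PI) * Ci) in *. field. repeat split; trivial.
Qed.

Lemma cder_theta_ratio z : exists d, cder theta_ratio z d.
Proof.
destruct (Ceq_dec (theta u z) 0) as [E|E].
- destruct (theta_zero u z Hu E) as (k & l & Hz). destruct cder_theta_ratio_0 as [d Hd]. exists d.
  intros eps He. destruct (Hd eps He) as [del [H1 H2]]. exists del. split; trivial. intros h Hh.
  specialize (H2 h Hh). rewrite Cplus_0_l in H2.
  assert (P : forall w, theta_ratio (w + z) = theta_ratio w).
  { intros w. rewrite Hz. rewrite Cplus_assoc, (period_Z _ u theta_ratio_plus_u).
    rewrite <- (Cmult_1_r (RtoC (IZR k))). now rewrite (period_Z _ 1 theta_ratio_plus_1). }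
  rewrite (Cplus_comm z h), P. replace z with (0 + z) at 1 by ring. now rewrite P.
- destruct (cder_theta_scaled u 1 z Hu) as [d1 H1].
  assert (H1' : cder (theta u) z d1). { apply cder_ext with (2 := H1). intros w. f_equal. ring. }
  destruct (cder_theta_scaled (- / u) (/ u) z (Im_neg_inv u Hu)) as [d2 H2]. destruct (cder_theta_mult z) as [d3 H3].
  destruct (ccont_nonzero _ z (cder_ccont _ _ _ H1') E) as (r & Hr & HD).
  eexists. apply cder_ext_loc with (fun z => theta_dual u z / theta u z).
  + exists r. split; trivial. intros w Hw. unfold theta_ratio. destruct Ceq_dec as [E'|]; trivial. exfalso. now apply (HD w).
  + apply cder_div; trivial. 2: exact H1'. unfold theta_dual. apply cder_mult. exact H3. exact H2.
Qed.

(* [theta_ratio] is entire and has the periods 1 and [u]. *)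
Theorem theta_ratio_constant z z' : theta_ratio z = theta_ratio z'.
Proof.
apply (elliptic_constant theta_ratio u Hu).
apply cder_theta_ratio. apply theta_ratio_plus_1. apply theta_ratio_plus_u.
Qed.

End Inversion.

(** * The Hauptmodul and the Fricke involution *)

Lemma qpow_ee r tau : qpow r tau = ee (RtoC r * tau).
Proof. unfold qpow, ee. apply (f_equal Cexp). rewrite RtoC_mult. ring. Qed.

Lemma siegel_theta (v : Q) tau : 0 < Im tau ->
  siegel v 0 tau = - ee (RtoC (/ 2 * B2 (Q2R v)) * tau) * theta tau (RtoC (Q2R v) * tau).
Proof.
intros Ht. unfold siegel. rewrite RMicromega.Q2R_0, !Rmult_0_r, Rmult_0_l.
rewrite Cmult_0_l, Copp_0, Cexp_0, !qpow_ee, !Cmult_1_r.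
set (x := RtoC (Q2R v)).
rewrite (Cinfprod_Ccv _ (Pp tau (x * tau) * Pp tau (- (x * tau)))).
- unfold theta. ring.
- eapply Ccv_ext. 2: apply Ccv_mult; apply Pp_cv; exact Ht.
  intros n. cbv beta. rewrite Cprod_mult. apply Cprod_ext. intros k _. unfold Pterm. rewrite !qpow_ee, RtoC_plus, RtoC_minus.
  rewrite !Cmult_1_r. fold x.
  replace ((RtoC (INR k) + x) * tau) with (RtoC (INR k) * tau + x * tau) by ring.
  replace ((RtoC (INR k) - x) * tau) with (RtoC (INR k) * tau + - (x * tau)) by ring. reflexivity.
Qed.

Lemma im_scal_pos (r : R) (tau : C) : 0 < r -> 0 < Im tau -> 0 < Im (RtoC r * tau).
Proof. intros. rewrite im_scal_l. now apply Rmult_lt_0_compat. Qed.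

Lemma theta_real_multiple_neq_0 u (r : R) : 0 < Im u -> (forall k : Z, r <> IZR k) -> theta u (RtoC r * u) <> 0.
Proof.
intros Hu Hr E. destruct (theta_zero u _ Hu E) as (k & l & H). apply (Hr l).
apply (f_equal Im) in H. rewrite im_plus, !im_scal_l, im_RtoC in H. nra.
Qed.

Lemma theta_real_neq_0 u (r : R) : 0 < Im u -> (forall k : Z, r <> IZR k) -> theta u (RtoC r) <> 0.
Proof.
intros Hu Hr E. destruct (theta_zero u _ Hu E) as (k & l & H).
assert (H2 := H). apply (f_equal Im) in H. rewrite im_plus, im_scal_l, !im_RtoC in H.
assert (L : IZR l = 0%R) by nra. rewrite L, Cmult_0_l, Cplus_0_r in H2. apply RtoC_inj in H2. now apply (Hr k).
Qed.

Lemma half_not_Z k : (/ 2 <> IZR k)%R.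
Proof. intros H. assert (E : (1 = IZR (2 * k))%R) by (rewrite mult_IZR, <- H; field). apply eq_IZR in E. lia. Qed.
Lemma quarter_not_Z k : (/ 4 <> IZR k)%R.
Proof. intros H. assert (E : (1 = IZR (4 * k))%R) by (rewrite mult_IZR, <- H; field). apply eq_IZR in E. lia. Qed.

Lemma RtoC_half : RtoC (/ 2) = / 2.
Proof. rewrite RtoC_inv; [reflexivity|lra]. Qed.
Lemma RtoC_quarter : RtoC (/ 4) = / 4.
Proof. rewrite RtoC_inv; [reflexivity|lra]. Qed.

Lemma g_theta tau : 0 < Im tau ->
  g_lower14 tau = ee (- tau) * (theta (4 * tau) (/ 2 * (4 * tau)) / theta (4 * tau) (/ 4 * (4 * tau))) ^ 8.
Proof.
intros Ht. assert (Hu : 0 < Im (4 * tau)) by (apply im_scal_pos; lra || trivial).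
unfold g_lower14. rewrite !siegel_theta by trivial.
replace (Q2R (1 # 2)) with (/ 2)%R by (unfold Q2R; simpl; field). replace (Q2R (1 # 4)) with (/ 4)%R by (unfold Q2R; simpl; field).
assert (N := theta_real_multiple_neq_0 _ _ Hu quarter_not_Z). rewrite RtoC_quarter in N.
rewrite RtoC_half, RtoC_quarter.
set (a := theta (4 * tau) (/ 2 * (4 * tau))). set (b := theta (4 * tau) (/ 4 * (4 * tau))) in *.
(* Here 2 (B2(1/2) - B2(1/4)) = -1/8, whose eighth power yields the factor 1/q. *)
replace (RtoC (/ 2 * B2 (/ 2)) * (4 * tau)) with (RtoC (/ 2 * B2 (/ 4)) * (4 * tau) + - / 8 * tau).
2:{ unfold B2. replace (- / 8) with (RtoC (- / 8)) by (rewrite RtoC_opp, RtoC_inv; trivial; lra).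
  rewrite !Cmult_assoc, <- !RtoC_mult. rewrite <- Cmult_plus_distr_r. rewrite <- RtoC_plus. apply (f_equal (fun r => RtoC r * tau)). field. }
rewrite ee_plus. set (e := ee (RtoC (/ 2 * B2 (/ 4)) * (4 * tau))).
assert (Ne : e <> 0) by apply ee_neq_0.
replace (ee (- tau)) with (ee (- / 8 * tau) ^ 8).
2:{ rewrite ee_pow. apply (f_equal ee). simpl. replace (RtoC (1 + 1 + 1 + 1 + 1 + 1 + 1 + 1)) with (RtoC 8) by (apply (f_equal RtoC); ring). field. }
rewrite <- Cpow_mult_l. apply (f_equal (fun z => z ^ 8)). field. now split.
Qed.

Lemma g_neq_0 tau : 0 < Im tau -> g_lower14 tau <> 0.
Proof.
intros Ht. assert (Hu : 0 < Im (4 * tau)) by (apply im_scal_pos; lra || trivial). rewrite g_theta by trivial.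
assert (N := theta_real_multiple_neq_0 _ _ Hu quarter_not_Z). rewrite RtoC_quarter in N.
assert (N' := theta_real_multiple_neq_0 _ _ Hu half_not_Z). rewrite RtoC_half in N'.
apply Cmult_neq_0. apply ee_neq_0. apply Cpow_nz. unfold Cdiv. apply Cmult_neq_0; trivial.
intros E. apply C1_nz. rewrite <- (Cinv_r _ N), E. ring.
Qed.

Lemma g_plus_1 tau : 0 < Im tau -> g_lower14 (tau + 1) = g_lower14 tau.
Proof.
intros Ht. assert (Hu : 0 < Im (4 * tau)) by (apply im_scal_pos; lra || trivial).
assert (Ht1 : 0 < Im (tau + 1)) by (rewrite im_plus, im_RtoC; lra).
rewrite !g_theta by trivial.
assert (P : forall u z, 0 < Im u -> theta (u + 1) z = theta u z). { intros. unfold theta. now rewrite !Pp_plus_1_l. }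
assert (P4 : forall z, theta (4 * (tau + 1)) z = theta (4 * tau) z).
{ intros z. replace (4 * (tau + 1)) with (4 * tau + 1 + 1 + 1 + 1) by ring.
  rewrite !P; trivial; repeat (rewrite im_plus, im_RtoC, Rplus_0_r); trivial. }
rewrite !P4. replace (/ 2 * (4 * (tau + 1))) with (/ 2 * (4 * tau) + 1 + 1) by field.
replace (/ 4 * (4 * (tau + 1))) with (/ 4 * (4 * tau) + 1) by field. rewrite !theta_plus_1 by trivial.
f_equal. rewrite <- (ee_plus_1 (- (tau + 1))). apply (f_equal ee). ring.
Qed.

Definition fricke (tau : C) : C := - / (4 * tau).

Lemma im_fricke tau : 0 < Im tau -> 0 < Im (fricke tau).
Proof. intros. apply Im_neg_inv. apply im_scal_pos; lra || trivial. Qed.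

Lemma fricke_fricke tau : 0 < Im tau -> fricke (fricke tau) = tau.
Proof. intros H. apply im_pos_neq_0 in H. unfold fricke. field. repeat split; trivial. Qed.

Lemma g_fricke_theta tau : 0 < Im tau -> g_lower14 (fricke tau) = (theta tau (/ 2) / theta tau (/ 4)) ^ 8.
Proof.
intros Ht. assert (Nt := im_pos_neq_0 tau Ht).
set (u := - / tau). assert (Hu : 0 < Im u) by (now apply Im_neg_inv).
assert (Nu := im_pos_neq_0 u Hu).
rewrite g_theta by now apply im_fricke.
replace (4 * fricke tau) with u by (unfold fricke, u; field; trivial).
replace (- fricke tau) with (- / 4 * u) by (unfold fricke, u; field; trivial).
assert (N1 := theta_real_multiple_neq_0 _ _ Hu quarter_not_Z). rewrite RtoC_quarter in N1.
assert (N2 := theta_real_multiple_neq_0 _ _ Hu half_not_Z). rewrite RtoC_half in N2.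
assert (N3 := theta_real_neq_0 _ _ Ht quarter_not_Z). rewrite RtoC_quarter in N3.
(* With u = -1/tau the dual theta function is that of tau, evaluated at 1/2 and 1/4. The constant of
   the inversion formula disappears from the comparison. *)
assert (K := theta_ratio_constant u Hu (/ 2 * u) (/ 4 * u)).
unfold theta_ratio in K. destruct Ceq_dec as [E|_]; [easy|]. destruct Ceq_dec as [E|_]; [easy|].
unfold theta_dual in K.
replace (- / u) with tau in K by (unfold u; field; trivial).
replace (/ u * (/ 2 * u)) with (/ 2) in K by (field; trivial).
replace (/ u * (/ 4 * u)) with (/ 4) in K by (field; trivial).
unfold theta_mult in K.
(* The two Gaussian exponents differ by (u/4 - 1)/8. The eighth power of this quotient is e(u/4),
   exactly what the factor e(-u/4) of [g_theta] removes. *)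
replace (- (/ 2 * u * (/ 2 * u)) / (2 * u) + / 2 * u / 2 - / 2 * u / (2 * u)) with
  ((- (/ 4 * u * (/ 4 * u)) / (2 * u) + / 4 * u / 2 - / 4 * u / (2 * u)) + / 8 * (/ 4 * u - 1)) in K by (field; trivial).
rewrite ee_plus in K. set (e := ee (- (/ 4 * u * (/ 4 * u)) / (2 * u) + / 4 * u / 2 - / 4 * u / (2 * u))) in *.
assert (Ne : e <> 0) by apply ee_neq_0.
set (x := ee (/ 8 * (/ 4 * u - 1))) in *.
replace (ee (- / 4 * u)) with ((/ x) ^ 8).
2:{ unfold x. rewrite <- ee_opp, ee_pow. rewrite <- (ee_plus_1 (- / 4 * u)). apply (f_equal ee).
  simpl. replace (RtoC (1 + 1 + 1 + 1 + 1 + 1 + 1 + 1)) with (RtoC 8) by (apply (f_equal RtoC); ring). field. }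
rewrite <- Cpow_mult_l. apply (f_equal (fun z => z ^ 8)).
assert (Nx : x <> 0) by apply ee_neq_0.
set (a := theta u (/ 2 * u)) in *. set (b := theta u (/ 4 * u)) in *. set (c := theta tau (/ 2)) in *. set (d := theta tau (/ 4)) in *.
assert (K2 : x * c * b = d * a).
{ assert (E : e * (x * c * b - d * a) = a * b * (e * x * c / a - e * d / b)) by (field; now split).
  rewrite K in E. replace (a * b * (e * d / b - e * d / b)) with (RtoC 0) in E by (field; trivial).
  destruct (Ceq_dec (x * c * b - d * a) 0) as [Z|Z]. now apply Ceq_minus. exfalso. now apply (Cmult_neq_0 _ _ Ne Z). }
replace c with (d * a / (x * b)). field. repeat split; trivial.
rewrite <- K2. field. now split.
Qed.

(** [Pp_shift] absorbs the factor 1 - e(z) of the theta function and makes the two products of the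
    numerator equal. In terms of q this reads q^-1 times the eighth power of prod (1 - q^(4n-2))^2 /
    prod (1 - q^(2n-1)). *)
Lemma g_Pp tau : 0 < Im tau ->
  g_lower14 tau = ee (- tau) * (Pp (4 * tau) (- (2 * tau)) ^ 2 / Pp (2 * tau) (- tau)) ^ 8.
Proof.
intros Ht. assert (Hu : 0 < Im (4 * tau)) by (apply im_scal_pos; lra || trivial).
assert (Hu2 : 0 < Im (2 * tau)) by (apply im_scal_pos; lra || trivial).
rewrite g_theta by trivial.
replace (/ 2 * (4 * tau)) with (2 * tau) by field. replace (/ 4 * (4 * tau)) with tau by field.
unfold theta. rewrite <- !Pp_shift by trivial.
replace (2 * tau - 4 * tau) with (- (2 * tau)) by ring.
rewrite (Pp_split (2 * tau) (- tau)) by trivial. replace (2 * (2 * tau)) with (4 * tau) by ring.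
replace (- tau - 2 * tau) with (tau - 4 * tau) by ring.
rewrite (Cmult_comm (Pp (4 * tau) (- tau))). repeat f_equal. simpl. ring.
Qed.

Lemma Pp_minus_1 u w : 0 < Im u -> Pp u (w - 1) = Pp u w.
Proof. intros H. rewrite <- (Pp_plus_1 u (w - 1)) by trivial. f_equal. ring. Qed.

Lemma im_plus_half tau : Im (tau + / 2) = Im tau.
Proof. rewrite im_plus, <- RtoC_half, im_RtoC. ring. Qed.

(** Since [/ 0] is 0, a vanishing denominator in [g_Pp] would force g = 0. *)
Lemma Pp_odd_nonzero tau : 0 < Im tau -> Pp (2 * tau) (- tau) <> 0.
Proof.
intros Ht E. apply (g_neq_0 tau Ht). rewrite g_Pp, E by trivial. unfold Cdiv.
replace (/ 0) with (RtoC 0). simpl. ring. unfold Cinv, RtoC; simpl. f_equal; unfold Rdiv; ring.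
Qed.

(** The product over 1 - q^(2n) is computed twice, by duplication and by splitting prod (1 - q^n)
    into even and odd indices; it is nonzero and cancels. *)
Lemma Pp_euler tau : 0 < Im tau -> Pp tau (/ 2) * Pp (2 * tau) (- tau) = 1.
Proof.
intros Ht. assert (Hu2 : 0 < Im (2 * tau)) by (apply im_scal_pos; lra || trivial).
assert (A := Pp_duplication tau 0 Ht). rewrite Cplus_0_l, Cmult_0_r in A.
assert (B := Pp_split tau 0 Ht). replace (0 - tau) with (- tau) in B by ring.
assert (N0 := Pp_0_nonzero _ Hu2). rewrite B in A.
replace (Pp tau (/ 2) * Pp (2 * tau) (- tau)) with (Pp (2 * tau) 0 * Pp (2 * tau) (- tau) * Pp tau (/ 2) / Pp (2 * tau) 0) by (field; trivial).
rewrite A. field. trivial.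
Qed.

(** With theta(1/2) = 2 prod (1 + q^n)^2 and theta(1/4) = (1 - i) prod (1 + q^(2n)), Euler's
    identity and the splitting of prod (1 + q^n) reduce both sides to the same monomial. The
    constant is 256 / (1 - i)^8 = 16, and the sign comes from e(-(tau + 1/2)). *)
Theorem g_fricke tau : 0 < Im tau ->
  g_lower14 (fricke tau) * g_lower14 (tau + / 2) = - (16) * g_lower14 tau.
Proof.
intros Ht. assert (Hu : 0 < Im (4 * tau)) by (apply im_scal_pos; lra || trivial).
assert (Hu2 : 0 < Im (2 * tau)) by (apply im_scal_pos; lra || trivial).
assert (Hth : 0 < Im (tau + / 2)) by (now rewrite im_plus_half).
rewrite g_fricke_theta by trivial. rewrite !g_Pp by trivial.
replace (4 * (tau + / 2)) with (4 * tau + 1 + 1) by field. replace (2 * (tau + / 2)) with (2 * tau + 1) by field.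
rewrite !Pp_plus_1_l by (trivial; now rewrite im_plus, im_RtoC, Rplus_0_r).
replace (- (2 * tau + 1)) with (- (2 * tau) - 1) by ring. rewrite Pp_minus_1 by trivial.
assert (N1 := Pp_odd_nonzero tau Ht).
assert (N2 : Pp (2 * tau) (- (tau + / 2)) <> 0).
{ assert (X := Pp_odd_nonzero _ Hth). replace (2 * (tau + / 2)) with (2 * tau + 1) in X by field. now rewrite Pp_plus_1_l in X. }
assert (E2 : Pp (2 * tau) (- (tau + / 2)) = Pp (2 * tau) (/ 2 - tau)).
{ rewrite <- (Pp_plus_1 _ (- (tau + / 2))) by trivial. f_equal. field. }
rewrite E2 in *.
assert (T2 : theta tau (/ 2) = 2 * Pp tau (/ 2) ^ 2).
{ unfold theta. rewrite ee_half. rewrite <- (Pp_plus_1 tau (- / 2)) by trivial. replace (- / 2 + 1) with (/ 2) by field. simpl. ring. }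
assert (T4 : theta tau (/ 4) = (1 - Ci) * Pp (2 * tau) (/ 2)).
{ unfold theta. rewrite ee_quarter. rewrite <- Cmult_assoc. f_equal.
  rewrite Cmult_comm. replace (/ 4) with (- / 4 + / 2) at 2 by field. rewrite Pp_duplication by trivial.
  rewrite <- (Pp_plus_1 _ (2 * - / 4)) by trivial. f_equal. field. }
rewrite T2, T4.
assert (S1 : Pp tau (/ 2) = Pp (2 * tau) (/ 2) * Pp (2 * tau) (/ 2 - tau)) by (now apply Pp_split).
assert (S2 := Pp_euler tau Ht).
set (a := Pp (2 * tau) (- tau)) in *. set (b := Pp (2 * tau) (/ 2 - tau)) in *. set (c := Pp (4 * tau) (- (2 * tau))).
set (e := Pp tau (/ 2)) in *. set (f := Pp (2 * tau) (/ 2)) in *.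
replace (- (tau + / 2)) with (- tau + - / 2) by ring. rewrite ee_plus, ee_opp, (ee_opp (/ 2)), ee_half.
assert (Nq := ee_neq_0 tau).
assert (Ef : f = e / b) by (rewrite S1; field; trivial).
assert (Ne : e <> 0). { intros Z. rewrite Z in S2. apply C1_nz. rewrite <- S2. ring. }
assert (Ea : a = / e). { replace a with (e * a / e) by (field; trivial). rewrite S2. field; trivial. }
rewrite Ef, Ea.
assert (NI : 1 - Ci <> 0). { intros Z. apply (f_equal Re) in Z. simpl in Z. lra. }
assert (I8 : (1 - Ci) ^ 8 = 16).
{ unfold Ci, Cminus, Cplus, Copp, RtoC, Cpow, Cmult; simpl. f_equal; ring. }
replace ((2 * e ^ 2 / ((1 - Ci) * (e / b))) ^ 8) with (256 / (1 - Ci) ^ 8 * (e * b) ^ 8).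
2:{ field. repeat split; trivial. }
rewrite I8. field. repeat split; trivial.
Qed.

(** * A Liouville theorem for [Gamma_1(4)] *)

(** The limit is uniform in the real part, so that it controls everything above a horizontal
    line. *)
Definition tends_at_infinity (f : C -> C) (l : C) : Prop :=
  forall eps : R, 0 < eps -> exists Y : R, forall tau : C, 0 < Im tau -> Y < Im tau -> Cmod (f tau - l) < eps.

Lemma tends_const c : tends_at_infinity (fun _ => c) c.
Proof. intros eps He. exists 0%R. intros. replace (c - c) with (RtoC 0) by ring. now rewrite Cmod_0. Qed.

Lemma tends_ext f g l : (forall tau, 0 < Im tau -> f tau = g tau) -> tends_at_infinity f l -> tends_at_infinity g l.
Proof. intros E H eps He. destruct (H eps He) as [Y HY]. exists Y. intros. rewrite <- E by trivial. now apply HY. Qed.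

Lemma tends_lim f l l' : l = l' -> tends_at_infinity f l -> tends_at_infinity f l'.
Proof. now intros ->. Qed.

Lemma tends_plus f g a b : tends_at_infinity f a -> tends_at_infinity g b -> tends_at_infinity (fun t => f t + g t) (a + b).
Proof.
intros H H' eps He. destruct (H (eps / 2)%R ltac:(lra)) as [Y HY]. destruct (H' (eps / 2)%R ltac:(lra)) as [Y' HY'].
exists (Rmax Y Y'). intros t Ht HM. specialize (HY t Ht ltac:(eapply Rle_lt_trans; [apply Rmax_l|apply HM])).
specialize (HY' t Ht ltac:(eapply Rle_lt_trans; [apply Rmax_r|apply HM])).
replace (f t + g t - (a + b)) with ((f t - a) + (g t - b)) by ring. eapply Rle_lt_trans. apply Cmod_triangle. lra.
Qed.

Lemma tends_mult f g a b : tends_at_infinity f a -> tends_at_infinity g b -> tends_at_infinity (fun t => f t * g t) (a * b).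
Proof.
intros H H' eps He. assert (P := Cmod_ge_0 a). assert (P' := Cmod_ge_0 b).
destruct (H 1%R ltac:(lra)) as [Y0 H0].
destruct (H (eps / (2 * (Cmod b + 1)))%R) as [Y1 H1]. apply Rdiv_lt_0_compat; lra.
destruct (H' (eps / (2 * (Cmod a + 1)))%R) as [Y2 H2]. apply Rdiv_lt_0_compat; lra.
exists (Rmax Y0 (Rmax Y1 Y2)). intros t Ht HM.
assert (M1 := Rmax_l Y0 (Rmax Y1 Y2)). assert (M2 := Rmax_r Y0 (Rmax Y1 Y2)). assert (M3 := Rmax_l Y1 Y2). assert (M4 := Rmax_r Y1 Y2).
specialize (H0 t Ht ltac:(lra)). specialize (H1 t Ht ltac:(lra)). specialize (H2 t Ht ltac:(lra)).
assert (B : Cmod (f t) <= Cmod a + 1) by (generalize (Cmod_sub_ge (f t) a); lra).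
replace (f t * g t - a * b) with (f t * (g t - b) + b * (f t - a)) by ring.
eapply Rle_lt_trans. apply Cmod_triangle. rewrite !Cmod_mult.
assert (A1 : Cmod (f t) * Cmod (g t - b) < eps / 2).
{ apply Rle_lt_trans with ((Cmod a + 1) * Cmod (g t - b))%R. apply Rmult_le_compat_r; trivial. apply Cmod_ge_0.
  replace (eps / 2)%R with ((Cmod a + 1) * (eps / (2 * (Cmod a + 1))))%R by (field; lra). apply Rmult_lt_compat_l; lra. }
assert (B1 : Cmod b * Cmod (f t - a) <= eps / 2).
{ replace (eps / 2)%R with ((Cmod b + 1) * (eps / (2 * (Cmod b + 1))))%R by (field; lra).
  apply Rmult_le_compat; try lra. apply Cmod_ge_0. }
lra.
Qed.

Lemma tends_minus f g a b : tends_at_infinity f a -> tends_at_infinity g b -> tends_at_infinity (fun t => f t - g t) (a - b).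
Proof.
intros H H'. apply tends_lim with (a + - (1) * b). ring.
apply tends_ext with (fun t => f t + - (1) * g t). intros; ring.
apply tends_plus; trivial. apply tends_mult; trivial. apply tends_const.
Qed.

Lemma tends_inv f (a : C) : a <> 0 -> tends_at_infinity f a -> tends_at_infinity (fun t => / f t) (/ a).
Proof.
intros Na H eps He. assert (P := proj1 (Cmod_gt_0 a) Na).
assert (P2 : 0 < eps * (Cmod a * Cmod a) / 2). { apply Rdiv_lt_0_compat; [|lra]. apply Rmult_lt_0_compat; nra. }
destruct (H _ P2) as [Y1 H1]. destruct (H (Cmod a / 2)%R ltac:(lra)) as [Y2 H2].
exists (Rmax Y1 Y2). intros t Ht HM. specialize (H1 t Ht ltac:(eapply Rle_lt_trans; [apply Rmax_l|apply HM])).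
specialize (H2 t Ht ltac:(eapply Rle_lt_trans; [apply Rmax_r|apply HM])).
assert (B : Cmod a / 2 < Cmod (f t)). { rewrite Cmod_minus_sym in H2. generalize (Cmod_sub_ge a (f t)). lra. }
assert (Nf : f t <> 0) by (apply Cmod_gt_0; lra).
replace (/ f t - / a) with (- (f t - a) / (a * f t)) by (field; now split).
rewrite Cmod_div, Cmod_opp, Cmod_mult by (now apply Cmult_neq_0).
apply Rmult_lt_reg_r with (Cmod a * Cmod (f t))%R. apply Rmult_lt_0_compat; lra.
unfold Rdiv. rewrite Rmult_assoc, Rinv_l, Rmult_1_r. 2:{ apply Rgt_not_eq, Rmult_lt_0_compat; lra. }
eapply Rlt_trans. apply H1. replace (eps * (Cmod a * Cmod a) / 2)%R with (eps * (Cmod a * (Cmod a / 2)))%R by field.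
apply Rmult_lt_compat_l; trivial. apply Rmult_lt_compat_l; lra.
Qed.

Lemma tends_quarter f l : tends_at_infinity f l -> tends_at_infinity (fun t => f (t / 4)) l.
Proof.
intros H eps He. destruct (H eps He) as [Y HY]. exists (4 * Y)%R. intros t Ht HM.
assert (E : Im (t / 4) = (Im t / 4)%R) by (unfold Cdiv; rewrite <- RtoC_quarter, im_scal_r; field).
apply HY; rewrite E; lra.
Qed.

Definition holo (F : C -> C) : Prop := forall tau, 0 < Im tau -> exists d, cder F tau d.

Lemma UHP_disc tau z : Cmod (z - tau) < Im tau -> 0 < Im z.
Proof.
intros H. assert (X := im_le_Cmod (z - tau)). unfold Cminus in X. rewrite im_plus, im_opp in X. apply Rabs_le_between in X.
unfold Cminus in H. lra.
Qed.

(* By the maximum principle on discs the extremal value propagates to points of arbitrarily large imaginary part. *)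
Lemma maximum_at_point_zero F (tau0 : C) : holo F -> tends_at_infinity F 0 -> 0 < Im tau0 ->
  (forall tau, 0 < Im tau -> Cmod (F tau) <= Cmod (F tau0)) -> F tau0 = 0.
Proof.
intros HF HL H0 HM.
assert (UP : forall n, exists t, 0 < Im t /\ F t = F tau0 /\ Im tau0 * (1 + INR n / 2) <= Im t).
{ induction n as [|n (t & Ht & Et & It)].
  - exists tau0. simpl. repeat split; trivial. lra.
  - exists (t + RtoC (Im t / 2) * Ci).
    assert (E : Im (t + RtoC (Im t / 2) * Ci) = (Im t * 3 / 2)%R) by (rewrite im_plus, im_scal_l; simpl; field).
    rewrite E. split. lra. split.
    + rewrite <- Et. apply (maximum_principle F t (Im t)).
      * intros z Hz. apply HF. now apply UHP_disc with t.
      * intros z Hz. rewrite Et. apply HM. now apply UHP_disc with t.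
      * replace (t + RtoC (Im t / 2) * Ci - t) with (RtoC (Im t / 2) * Ci) by ring.
        rewrite Cmod_mult, Cmod_Ci, Cmod_R, Rabs_pos_eq; lra.
    + rewrite S_INR. generalize (pos_INR n). nra. }
apply Cmod_eq_0. apply Rle_antisym; [|apply Cmod_ge_0]. apply le_epsilon. intros eps He. rewrite Rplus_0_l.
destruct (HL eps He) as [Y HY]. 
destruct (INR_unbounded (2 * Y / Im tau0)) as [n Hn].
destruct (UP n) as (t & Ht & Et & It). specialize (HY t Ht). rewrite Et in HY.
replace (F tau0 - 0) with (F tau0) in HY by ring. left. apply HY.
apply Rlt_le_trans with (Im tau0 * (1 + INR n / 2))%R; trivial.
apply Rmult_lt_compat_l with (r := Im tau0) in Hn; trivial.
replace (Im tau0 * (2 * Y / Im tau0))%R with (2 * Y)%R in Hn by (field; lra). lra.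
Qed.

Definition inv_S (tau : C) : C := - / tau.

Lemma im_inv_S tau : 0 < Im tau -> 0 < Im (inv_S tau).
Proof. apply Im_neg_inv. Qed.

Lemma im_plus_RtoC tau r : Im (tau + RtoC r) = Im tau.
Proof. rewrite im_plus, im_RtoC. ring. Qed.

Lemma UHP_neq tau r : 0 < Im tau -> tau + RtoC r <> 0.
Proof. intros H. apply im_pos_neq_0. now rewrite im_plus_RtoC. Qed.

Lemma inv_S_inv_S tau : 0 < Im tau -> inv_S (inv_S tau) = tau.
Proof. intros H. unfold inv_S. field. now apply im_pos_neq_0. Qed.

(** The relation (ST)^3 = 1 in the form S T S = T^-1 S T^-1. *)
Lemma inv_S_S_plus_1 rho : 0 < Im rho -> inv_S (inv_S rho + 1) = inv_S (rho + - (1)) + - (1).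
Proof.
intros H. assert (N1 := im_pos_neq_0 _ H). assert (N2 := UHP_neq rho (-1) H). 
assert (N3 := UHP_neq _ 1 (im_inv_S _ H)). unfold inv_S in *. replace (RtoC (-1)) with (- (1)) in N2 by (now rewrite <- RtoC_opp).
field. repeat split; trivial.
intros E. apply N2. rewrite <- E. ring.
Qed.

Lemma inv_S_S_minus_1 rho : 0 < Im rho -> inv_S (inv_S rho + - (1)) = inv_S (rho + 1) + 1.
Proof.
intros H. assert (H1 : 0 < Im (rho + 1)) by (now rewrite im_plus_RtoC).
assert (X := inv_S_S_plus_1 (rho + 1) H1).
assert (H2 : 0 < Im (inv_S (rho + 1) + 1)) by (rewrite im_plus_RtoC; now apply im_inv_S).
assert (Y := f_equal inv_S X). rewrite inv_S_inv_S in Y by trivial.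
rewrite Y. f_equal. replace (rho + 1 + - (1)) with rho by ring. reflexivity.
Qed.

(** In this box |sigma|^2 <= 1/2, and Im (S sigma) is Im sigma / |sigma|^2. The doubling is what
    makes the reduction below terminate. *)
Lemma half_box_norm sigma : 0 < Im sigma -> Im sigma <= / 2 -> - / 2 <= Re sigma <= / 2 -> 2 * Im sigma <= Im (inv_S sigma).
Proof.
destruct sigma as [x y]. unfold inv_S, Im, Re, Copp, Cinv; simpl. intros Hy H1 H2.
assert (P : 0 < x * (x * 1) + y * (y * 1)) by nra.
replace (- (- y / (x * (x * 1) + y * (y * 1))))%R with (y / (x * (x * 1) + y * (y * 1)))%R by (field; lra).
apply Rmult_le_reg_r with (x * (x * 1) + y * (y * 1))%R; trivial.
replace (y / (x * (x * 1) + y * (y * 1)) * (x * (x * 1) + y * (y * 1)))%R with y by (field; lra). assert (x * (x * 1) + y * (y * 1) <= / 2) by nra. nra.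
Qed.

Lemma round_shift (x : R) : exists k : Z, - / 2 <= x + IZR k <= / 2.
Proof.
destruct (floor_shift (x + / 2) 1 Rlt_0_1) as [k Hk]. exists k. lra.
Qed.

Lemma period_Z_UHP (F : C -> C) p : (forall tau, 0 < Im tau -> F (tau + RtoC p) = F tau) ->
  forall (k : Z) tau, 0 < Im tau -> F (tau + RtoC (IZR k) * RtoC p) = F tau.
Proof.
intros H.
assert (P : forall n z, 0 < Im z -> F (z + RtoC (INR n) * RtoC p) = F z).
{ induction n as [|n IH]; intros z Hz. simpl. f_equal. ring. rewrite S_INR, RtoC_plus.
  replace (z + (RtoC (INR n) + 1) * RtoC p) with (z + RtoC (INR n) * RtoC p + RtoC p) by ring. rewrite H. now apply IH.
  now rewrite <- RtoC_mult, im_plus_RtoC. }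
intros k z Hz. destruct (Z_le_gt_dec 0 k).
- rewrite <- (Z2Nat.id k) by lia. rewrite <- INR_IZR_INZ. now apply P.
- rewrite <- (P (Z.to_nat (- k)) (z + _)). f_equal. rewrite INR_IZR_INZ, Z2Nat.id, opp_IZR, RtoC_opp by lia. ring.
  now rewrite <- RtoC_mult, im_plus_RtoC.
Qed.

Section Liouville.
Variable F : C -> C.
Hypothesis HF : holo F.
Hypothesis F_1 : forall tau, 0 < Im tau -> F (tau + 1) = F tau.
(** Invariance under the parabolic generator fixing 0, written as a translation conjugated by S. *)
Hypothesis F_4 : forall tau, 0 < Im tau -> F (inv_S (tau + 4)) = F (inv_S tau).

(** [F] seen from the cusps infinity, 0 and -1/2, the last being equivalent to 1/2; the widths are
    1, 4 and 1. All indices from 2 on mean the third cusp. *)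
Definition cusp_fun (i : nat) (tau : C) : C :=
  match i with
  | 0%nat => F tau
  | 1%nat => F (inv_S tau)
  | _ => F (inv_S (inv_S tau + 2))
  end.

Lemma F_period k tau : 0 < Im tau -> F (tau + RtoC (IZR k)) = F tau.
Proof. intros H. rewrite <- (Cmult_1_r (RtoC (IZR k))). now apply (period_Z_UHP F 1). Qed.

Lemma F_S_period k tau : 0 < Im tau -> F (inv_S (tau + RtoC (IZR (4 * k)))) = F (inv_S tau).
Proof.
intros H. rewrite mult_IZR, RtoC_mult, Cmult_comm. now apply (period_Z_UHP (fun t => F (inv_S t)) 4).
Qed.

(** By [F_4] the shift 2 may be replaced by -2, and S(S(tau + 1) + 2) + 1 = tau / (2 tau + 1) = S(S
    tau - 2). *)
Lemma cusp_2_period_1 tau : 0 < Im tau -> cusp_fun 2 (tau + 1) = cusp_fun 2 tau.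
Proof.
intros H. simpl.
assert (I1 := im_inv_S _ H). assert (N := im_pos_neq_0 _ H).
assert (H1 : 0 < Im (tau + 1)) by (now rewrite im_plus_RtoC). assert (N1 := im_pos_neq_0 _ H1).
assert (A : F (inv_S (inv_S tau + 2)) = F (inv_S (inv_S tau + - (2)))).
{ rewrite <- (F_4 (inv_S tau + - (2))). apply (f_equal (fun z => F (inv_S z))). ring. rewrite <- RtoC_opp, im_plus_RtoC. trivial. }
rewrite A.
assert (I2 : 0 < Im (inv_S tau + - (2))) by (rewrite <- RtoC_opp, im_plus_RtoC; trivial).
assert (I3 : 0 < Im (inv_S (tau + 1) + 2)) by (rewrite im_plus_RtoC; now apply im_inv_S).
rewrite <- (F_1 (inv_S (inv_S (tau + 1) + 2))) by (now apply im_inv_S). f_equal.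
assert (N2 : 1 + 2 * tau <> 0). { apply im_pos_neq_0. rewrite im_plus, im_RtoC, im_scal_l. lra. }
assert (E1 : RtoC (-1) = - RtoC 1) by (now rewrite <- RtoC_opp).
assert (E2 : RtoC (-2) = - RtoC 2) by (now rewrite <- RtoC_opp).
unfold inv_S. field. repeat split; trivial; intros E; apply N2.
- rewrite E1, E2 in E. replace (1 + 2 * tau) with (- (- (1) + - (2) * tau)) by ring. rewrite E. ring.
- rewrite ?E1, ?E2 in E. rewrite <- E. ring.
Qed.

Lemma cusp_2_period k tau : 0 < Im tau -> cusp_fun 2 (tau + RtoC (IZR k)) = cusp_fun 2 tau.
Proof. intros H. rewrite <- (Cmult_1_r (RtoC (IZR k))). apply (period_Z_UHP (cusp_fun 2) 1); trivial. exact cusp_2_period_1. Qed.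

Lemma cusp_period k i tau : 0 < Im tau -> cusp_fun i (tau + RtoC (IZR (4 * k))) = cusp_fun i tau.
Proof.
intros H. destruct i as [|[|i]]. now apply F_period. now apply F_S_period. now apply (cusp_2_period (4 * k)).
Qed.

(** An integral translation followed by S at least doubles the imaginary part, and the three
    functions are permuted up to further translations, which do not change the imaginary part. *)
Lemma cusp_step i tau : 0 < Im tau -> Im tau <= / 2 ->
  exists i' rho, 2 * Im tau <= Im rho /\ cusp_fun i tau = cusp_fun i' rho.
Proof.
intros H1 H2. destruct (round_shift (Re tau)) as [k Hk].
set (sigma := tau + RtoC (IZR k)).
assert (Is : Im sigma = Im tau) by apply im_plus_RtoC.
assert (Hs : 0 < Im sigma) by lra.
assert (Rs : - / 2 <= Re sigma <= / 2) by (unfold sigma; rewrite re_plus, re_RtoC; trivial).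
assert (X := half_box_norm sigma Hs ltac:(lra) Rs). rewrite Is in X.
set (rho := inv_S sigma) in *. assert (Hr : 0 < Im rho) by lra.
assert (E : inv_S rho = sigma) by now apply inv_S_inv_S.
destruct i as [|[|i]].
- exists 1%nat, rho. split; trivial. simpl. rewrite E. unfold sigma. now rewrite F_period.
(* The cusp 0 has width 4, so only the residue m of the translation counts: 0 leads to infinity, 2
   to the third cusp, and 1 and 3 lead back to the cusp 0 by the relation between S and T. *)
- simpl. set (m := ((- k) mod 4)%Z). set (d := ((- k) / 4)%Z).
  assert (Dm : (- k = 4 * d + m)%Z) by (apply Z.div_mod; lia).
  assert (Bm : (0 <= m < 4)%Z) by (apply Z.mod_pos_bound; lia).
  assert (T : F (inv_S tau) = F (inv_S (sigma + RtoC (IZR m)))).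
  { rewrite <- (F_S_period d (sigma + _)) by (now rewrite im_plus_RtoC). apply (f_equal (fun z => F (inv_S z))). unfold sigma.
    rewrite <- !Cplus_assoc, <- !RtoC_plus, <- !plus_IZR. replace (k + (m + 4 * d))%Z with 0%Z by lia. now rewrite Cplus_0_r. }
  rewrite T, <- E.
  assert (C4 : (m = 0 \/ m = 1 \/ m = 2 \/ m = 3)%Z) by lia. destruct C4 as [->|[->|[->| ->]]].
  + exists 0%nat, rho. split; trivial. simpl. rewrite Cplus_0_r. now rewrite inv_S_inv_S.
  + exists 1%nat, (rho + - (1)). rewrite <- RtoC_opp at 1. rewrite im_plus_RtoC. split; trivial. simpl.
    rewrite inv_S_S_plus_1 by trivial. rewrite <- RtoC_opp. apply (F_period (-1)). apply im_inv_S. now rewrite im_plus_RtoC.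
  + exists 2%nat, rho. split; trivial.
  + exists 1%nat, (rho + 1). rewrite im_plus_RtoC. split; trivial. simpl.
    rewrite <- (F_1 (inv_S (rho + 1))) by (apply im_inv_S; now rewrite im_plus_RtoC). rewrite <- inv_S_S_minus_1 by trivial.
    rewrite <- (F_S_period (-1) (inv_S rho + _)). apply (f_equal (fun z => F (inv_S z))). simpl Z.mul.
    rewrite <- Cplus_assoc, <- RtoC_plus, <- RtoC_opp. apply (f_equal (fun z => inv_S rho + RtoC z)). ring.
    rewrite im_plus_RtoC, E. trivial.
- exists 1%nat, (rho + 2). rewrite im_plus_RtoC. split; trivial.
  change (cusp_fun 2 tau = F (inv_S (rho + 2))). rewrite <- (cusp_2_period k tau H1). reflexivity.
Qed.

Lemma cusp_reduction tau : 0 < Im tau -> exists i rho, / 2 <= Im rho /\ 0 <= Re rho <= 4 /\ F tau = cusp_fun i rho.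
Proof.
intros H.
assert (G : forall n i t, 0 < Im t -> / 2 <= Im t * 2 ^ n -> exists i' rho, / 2 <= Im rho /\ cusp_fun i t = cusp_fun i' rho).
{ induction n as [|n IH]; intros i t Ht Hn.
  - exists i, t. split; trivial. simpl in Hn. lra.
  - destruct (Rle_dec (/ 2) (Im t)) as [L|L]. exists i, t. now split.
    destruct (cusp_step i t Ht ltac:(lra)) as (i' & rho & H1 & H2).
    rewrite H2. apply IH. lra. simpl in Hn. assert (0 < 2 ^ n) by (apply pow_lt; lra). nra. }
destruct (INR_unbounded (/ Im tau)) as [n Hn].
destruct (G n 0%nat tau H) as (i & rho & H1 & H2).
{ assert (INR n <= 2 ^ n). { left. replace (2 ^ n)%R with (INR (2 ^ n)). apply lt_INR. apply Nat.pow_gt_lin_r. lia. now rewrite pow_INR. }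
  apply Rmult_lt_compat_l with (r := Im tau) in Hn; trivial. rewrite Rinv_r in Hn by lra. nra. }
destruct (floor_shift (Re rho) 4 ltac:(lra)) as [k Hk].
exists i, (rho + RtoC (IZR (4 * k))). rewrite im_plus_RtoC, re_plus, re_RtoC, mult_IZR. repeat split; try lra.
rewrite <- mult_IZR. rewrite cusp_period by lra. exact H2.
Qed.

Lemma cder_inv_S_comp f tau r : 0 < Im tau -> (exists d, cder f (inv_S tau + r) d) -> exists d, cder (fun t => f (inv_S t + r)) tau d.
Proof.
intros Ht [d Hd]. eexists. apply (cder_comp f (fun t => inv_S t + r)). exact Hd. apply cder_plus.
unfold inv_S. apply cder_opp. apply cder_inv. now apply im_pos_neq_0. apply cder_const.
Qed.

Lemma cder_cusp_fun i tau : 0 < Im tau -> exists d, cder (cusp_fun i) tau d.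
Proof.
intros Ht. destruct i as [|[|i]]; simpl.
- now apply HF.
- destruct (cder_inv_S_comp F tau 0 Ht) as [d Hd]. apply HF. rewrite Cplus_0_r. now apply im_inv_S.
  exists d. apply cder_ext with (2 := Hd). intros w. now rewrite Cplus_0_r.
- apply (cder_inv_S_comp (fun t => F (inv_S t)) tau 2 Ht).
  assert (H2 : 0 < Im (inv_S tau + 2)) by (rewrite im_plus_RtoC; now apply im_inv_S).
  destruct (cder_inv_S_comp F (inv_S tau + 2) 0 H2) as [d Hd]. apply HF. rewrite Cplus_0_r. now apply im_inv_S.
  exists d. apply cder_ext with (2 := Hd). intros w. now rewrite Cplus_0_r.
Qed.

Lemma cusp_fun_value i rho : 0 < Im rho -> exists p, 0 < Im p /\ cusp_fun i rho = F p.
Proof.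
intros H. destruct i as [|[|i]]; simpl.
- now exists rho.
- exists (inv_S rho). split; trivial. now apply im_inv_S.
- eexists. split; [|reflexivity]. apply im_inv_S. rewrite im_plus_RtoC. now apply im_inv_S.
Qed.

Lemma liouville_zero_cusps : (forall i, tends_at_infinity (cusp_fun i) 0) -> forall tau, 0 < Im tau -> F tau = 0.
Proof.
intros HL tau1 H1. destruct (Ceq_dec (F tau1) 0) as [|N]; trivial. exfalso.
assert (He := proj1 (Cmod_gt_0 _) N). set (eps := Cmod (F tau1)) in *.
destruct (HL 0%nat eps He) as [Y0 HY0]. destruct (HL 1%nat eps He) as [Y1 HY1]. destruct (HL 2%nat eps He) as [Y2 HY2].
(* Above [Y] all three functions are smaller than [eps], a value that |F| takes. The largest maximum
   over the three compact rectangles is therefore a maximum of |F| on the whole half-plane. *)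
set (Y := Rmax 1 (Rmax Y0 (Rmax Y1 Y2))).
assert (B1 := Rmax_l 1 (Rmax Y0 (Rmax Y1 Y2))). assert (B2 := Rmax_r 1 (Rmax Y0 (Rmax Y1 Y2))).
assert (B3 := Rmax_l Y0 (Rmax Y1 Y2)). assert (B4 := Rmax_r Y0 (Rmax Y1 Y2)).
assert (B5 := Rmax_l Y1 Y2). assert (B6 := Rmax_r Y1 Y2). fold Y in B1, B2.
assert (HY : forall i t, 0 < Im t -> Y < Im t -> Cmod (cusp_fun i t) < eps).
{ intros i t Ht HYt. rewrite <- (Cplus_0_r (cusp_fun i t)). rewrite <- Copp_0.
  destruct i as [|[|i]]. apply HY0; lra. apply HY1; lra. apply (HY2 t); lra. }
assert (MX : forall i, exists p, 0 < Im p /\ forall rho, / 2 <= Im rho <= Y -> 0 <= Re rho <= 4 -> Cmod (cusp_fun i rho) <= Cmod (F p)).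
{ intros i. destruct (rect_attains_max (cusp_fun i) 0 4 (/ 2) Y ltac:(lra) ltac:(lra)) as (s0 & t0 & Hs & Ht & HM).
  - intros s t Hs Ht. destruct (cder_cusp_fun i (s, t)) as [d Hd]. simpl; lra. eapply cder_ccont, Hd.
  - destruct (cusp_fun_value i (s0, t0)) as (p & Hp & Ep). simpl; lra.
    exists p. split; trivial. intros rho Hi Hr. rewrite <- Ep. specialize (HM (Re rho) (Im rho) Hr Hi). now destruct rho. }
assert (MXX : exists p, 0 < Im p /\ forall i rho, / 2 <= Im rho <= Y -> 0 <= Re rho <= 4 -> Cmod (cusp_fun i rho) <= Cmod (F p)).
{ destruct (MX 0%nat) as (p0 & P0 & M0). destruct (MX 1%nat) as (p1 & P1 & M1). destruct (MX 2%nat) as (p2 & P2 & M2).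
  assert (exists p, 0 < Im p /\ Cmod (F p0) <= Cmod (F p) /\ Cmod (F p1) <= Cmod (F p) /\ Cmod (F p2) <= Cmod (F p)) as (p & Pp' & L0 & L1 & L2).
  { destruct (Rle_dec (Cmod (F p0)) (Cmod (F p1))); destruct (Rle_dec (Cmod (F p1)) (Cmod (F p2))); destruct (Rle_dec (Cmod (F p0)) (Cmod (F p2)));
    ((exists p0; repeat split; trivial; lra) || (exists p1; repeat split; trivial; lra) || (exists p2; repeat split; trivial; lra)). }
  exists p. split; trivial. intros i rho Hi Hr. destruct i as [|[|i]].
  - specialize (M0 rho Hi Hr). lra.
  - specialize (M1 rho Hi Hr). lra.
  - specialize (M2 rho Hi Hr). simpl in *. lra. }
destruct MXX as (p & Hp & MP).
assert (EP : eps <= Cmod (F p)).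
{ destruct (cusp_reduction tau1 H1) as (i & rho & Hi & Hr & E). destruct (Rle_dec (Im rho) Y) as [L|L].
  - unfold eps. rewrite E. apply MP; lra.
  - exfalso. assert (X := HY i rho ltac:(lra) ltac:(lra)). rewrite <- E in X. unfold eps in X. lra. }
assert (Z : F p = 0).
{ apply maximum_at_point_zero; trivial. exact (HL 0%nat).
  intros t Ht. destruct (cusp_reduction t Ht) as (i & rho & Hi & Hr & E). rewrite E. destruct (Rle_dec (Im rho) Y) as [L|L].
  - apply MP; lra.
  - assert (X := HY i rho ltac:(lra) ltac:(lra)). lra. }
rewrite Z, Cmod_0 in EP. lra.
Qed.

End Liouville.

(* [F (F - l1) (F - l2)] vanishes at all cusps, so [F] takes finitely many values and has a maximum. *)
Theorem liouville_Gamma1_4 (F : C -> C) (l1 l2 : C) : holo F ->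
  (forall tau, 0 < Im tau -> F (tau + 1) = F tau) ->
  (forall tau, 0 < Im tau -> F (inv_S (tau + 4)) = F (inv_S tau)) ->
  tends_at_infinity F 0 -> tends_at_infinity (fun t => F (inv_S t)) l1 ->
  tends_at_infinity (fun t => F (inv_S (inv_S t + 2))) l2 ->
  forall tau, 0 < Im tau -> F tau = 0.
Proof.
intros HF F1 F4 L0 L1 L2.
set (G := fun t => F t * ((F t - l1) * (F t - l2))).
assert (HG : forall t, 0 < Im t -> G t = 0).
{ apply liouville_zero_cusps.
  - intros t Ht. destruct (HF t Ht) as [d Hd]. eexists. unfold G. apply cder_mult. apply Hd.
    apply cder_mult; (apply cder_minus; [apply Hd|apply cder_const]).
  - intros t Ht. unfold G. now rewrite F1.
  - intros t Ht. unfold G. now rewrite F4.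
  - assert (T : forall h l, tends_at_infinity h l -> l * ((l - l1) * (l - l2)) = 0 -> tends_at_infinity (fun t => h t * ((h t - l1) * (h t - l2))) 0).
    { intros h l Hh El. rewrite <- El. apply tends_mult; trivial. apply tends_mult; (apply tends_minus; [trivial|apply tends_const]). }
    intros [|[|i]]; simpl; unfold G.
    apply (T _ 0 L0). ring. apply (T _ l1 L1). ring. apply (T _ l2 L2). ring. }
assert (V : forall t, 0 < Im t -> F t = 0 \/ F t = l1 \/ F t = l2).
{ intros t Ht. specialize (HG t Ht). unfold G in HG.
  destruct (Ceq_dec (F t) 0) as [|N0]; [tauto|]. destruct (Ceq_dec (F t) l1) as [|N1]; [tauto|]. destruct (Ceq_dec (F t) l2) as [|N2]; [tauto|].
  exfalso. apply Cminus_eq_contra in N1, N2. now apply (Cmult_neq_0 _ _ N0 (Cmult_neq_0 _ _ N1 N2)). }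
(* The value of larger modulus is treated first: where it is taken, |F| is maximal, so it is 0. Then
   the other value is the largest possible one, and the argument repeats. *)
assert (W : forall a b, Cmod b <= Cmod a -> (forall t, 0 < Im t -> F t = 0 \/ F t = a \/ F t = b) -> forall t, 0 < Im t -> F t = 0).
{ intros a b Hab Vab.
  assert (M : forall c, Cmod b <= Cmod c -> (forall t, 0 < Im t -> Cmod (F t) <= Cmod c) -> forall t, 0 < Im t -> F t = c -> F t = 0).
  { intros c Hc Hm t Ht E. apply maximum_at_point_zero; trivial. rewrite E. exact Hm. }
  assert (A : forall t, 0 < Im t -> F t = a -> F t = 0).
  { apply M; trivial. intros t Ht. destruct (Vab t Ht) as [E|[E|E]]; rewrite E; try lra. rewrite Cmod_0. apply Cmod_ge_0. }
  assert (B : forall t, 0 < Im t -> F t = b -> F t = 0).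
  { apply M. lra. intros t Ht. destruct (Vab t Ht) as [E|[E|E]].
    - rewrite E, Cmod_0. apply Cmod_ge_0.
    - rewrite (A t Ht E), Cmod_0. apply Cmod_ge_0.
    - rewrite E. lra. }
  intros t Ht. destruct (Vab t Ht) as [E|[E|E]]; trivial. now apply A. now apply B. }
destruct (Rle_dec (Cmod l2) (Cmod l1)) as [L|L].
- now apply (W l1 l2).
- apply (W l2 l1). lra. intros t Ht. destruct (V t Ht) as [|[|]]; tauto.
Qed.

(** * Power series *)

Fixpoint Csum (u : nat -> C) (n : nat) : C :=
  match n with O => u O | S k => Csum u k + u (S k) end.

Definition cps (a : nat -> C) (x l : C) : Prop := Ccv (Csum (fun n => a n * x ^ n)) l.

Lemma Csum_ext u v n : (forall k, (k <= n)%nat -> u k = v k) -> Csum u n = Csum v n.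
Proof. intros H. induction n as [|n IH]; simpl. apply H. lia. rewrite IH, H; trivial; intros; apply H; lia. Qed.
Lemma Csum_plus u v n : Csum (fun k => u k + v k) n = Csum u n + Csum v n.
Proof. induction n as [|n IH]; simpl; trivial. rewrite IH. ring. Qed.
Lemma Csum_scal c u n : Csum (fun k => c * u k) n = c * Csum u n.
Proof. induction n as [|n IH]; simpl; trivial. rewrite IH. ring. Qed.
Lemma Csum_Re u n : Re (Csum u n) = sum_f_R0 (fun k => Re (u k)) n.
Proof. induction n as [|n IH]; simpl; trivial. rewrite <- IH. apply re_plus. Qed.
Lemma Csum_Im u n : Im (Csum u n) = sum_f_R0 (fun k => Im (u k)) n.
Proof. induction n as [|n IH]; simpl; trivial. rewrite <- IH. apply im_plus. Qed.

Lemma Csum_sum_n (u : nat -> C) n : @sum_n C_AbelianMonoid u n = Csum u n.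
Proof. induction n as [|n IH]; simpl. apply sum_O. rewrite sum_Sn, IH. reflexivity. Qed.

Lemma pow_n_Cpow (x : C) n : @pow_n C_Ring x n = x ^ n.
Proof. induction n as [|n IH]; simpl; trivial; now rewrite IH. Qed.

Lemma Ccv_filterlim v l : Ccv v l <-> filterlim v eventually (@locally C_UniformSpace l).
Proof.
split; intros H.
- apply filterlim_locally. intros eps. destruct (H eps (cond_pos eps)) as [N HN]. exists N. intros n Hn.
  apply C_NormedModule_mixin_compat1. now apply HN.
- intros eps He. assert (P := Rdiv_lt_0_compat _ _ He (sqrt_lt_R0 2 ltac:(lra))).
  destruct (proj1 (filterlim_locally _ _) H (mkposreal _ P)) as [N HN]. exists N. intros n Hn.
  assert (X := C_NormedModule_mixin_compat2 _ _ _ (HN n Hn)). simpl in X.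
  replace (sqrt 2 * (eps / sqrt 2))%R with eps in X. exact X. field. apply Rgt_not_eq, sqrt_lt_R0. lra.
Qed.

Lemma cps_is_pseries a x l : cps a x l <-> @is_pseries C_AbsRing C_NormedModule a x l.
Proof.
unfold cps, is_pseries, is_series. rewrite Ccv_filterlim.
assert (E : forall n, Csum (fun n => a n * x ^ n) n = @sum_n C_AbelianMonoid (fun k => @scal C_AbsRing C_NormedModule (pow_n x k) (a k)) n).
{ intros n. rewrite Csum_sum_n. apply Csum_ext. intros k _. rewrite Cmult_comm, <- pow_n_Cpow. reflexivity. }
split; apply filterlim_ext; intros n; [|symmetry]; apply E.
Qed.

Lemma cps_unique a x l l' : cps a x l -> cps a x l' -> l = l'.
Proof. apply Ccv_unique. Qed.

Lemma cps_ext a b x l : (forall n, a n = b n) -> cps a x l -> cps b x l.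
Proof. intros H. apply Ccv_ext. intros n. apply Csum_ext. intros k _. now rewrite H. Qed.

Lemma cps_plus a b x l l' : cps a x l -> cps b x l' -> cps (fun n => a n + b n) x (l + l').
Proof.
intros H H'. eapply Ccv_ext. 2: apply (Ccv_plus _ _ _ _ H H'). intros n. cbv beta. rewrite <- Csum_plus.
apply Csum_ext. intros. ring.
Qed.

Lemma cps_scal c a x l : cps a x l -> cps (fun n => c * a n) x (c * l).
Proof.
intros H. eapply Ccv_ext. 2: apply (Ccv_mult _ _ _ _ (Ccv_const c) H). intros n. cbv beta. rewrite <- Csum_scal.
apply Csum_ext. intros. ring.
Qed.

Definition shift1 (a : nat -> C) (n : nat) : C := match n with O => 0 | S k => a k end.

Lemma cps_shift1 a x l : cps a x l -> cps (shift1 a) x (x * l).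
Proof.
intros H.
assert (E : forall n, Csum (fun k => shift1 a k * x ^ k) (S n) = x * Csum (fun k => a k * x ^ k) n).
{ induction n as [|n IH]. simpl. ring.
  change (Csum (fun k => shift1 a k * x ^ k) (S (S n))) with (Csum (fun k => shift1 a k * x ^ k) (S n) + shift1 a (S (S n)) * x ^ S (S n)).
  rewrite IH. simpl. ring. }
assert (X := Ccv_mult _ _ _ _ (Ccv_const x) H). intros eps He. destruct (X eps He) as [N HN].
exists (S N). intros [|n] Hn; [lia|]. rewrite E. apply HN. lia.
Qed.

Lemma cps_unshift1 (a : nat -> C) (x l : C) : x <> 0 -> a 0%nat = 0 -> cps a x (x * l) -> cps (fun n => a (S n)) x l.
Proof.
intros Hx H0 H.
assert (E : forall n, Csum (fun k => a k * x ^ k) (S n) = x * Csum (fun k => a (S k) * x ^ k) n).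
{ induction n as [|n IH]. simpl. rewrite H0. ring.
  change (Csum (fun k => a k * x ^ k) (S (S n))) with (Csum (fun k => a k * x ^ k) (S n) + a (S (S n)) * x ^ S (S n)).
  rewrite IH. simpl. ring. }
assert (X : Ccv (fun n => Csum (fun k => a k * x ^ k) (S n)) (x * l)) by (apply (Ccv_subseq _ _ S); [lia|exact H]).
assert (Y := Ccv_mult _ _ _ _ (Ccv_const (/ x)) X).
replace (/ x * (x * l)) with l in Y by (field; trivial).
apply Ccv_ext with (2 := Y). intros n. cbv beta. rewrite E. field. trivial.
Qed.

Definition delta0 (c : C) (n : nat) : C := match n with O => c | S _ => 0 end.

Lemma cps_const c x : cps (delta0 c) x c.
Proof.
assert (E : forall n, Csum (fun n => delta0 c n * x ^ n) n = c).
{ induction n as [|n IH]; simpl in *. ring. rewrite IH. ring. }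
intros eps He. exists 0%nat. intros n _. rewrite E. replace (c - c) with (RtoC 0) by ring. now rewrite Cmod_0.
Qed.

Lemma cps_0 a : cps a 0 (a 0%nat).
Proof.
assert (E : forall n, Csum (fun n => a n * 0 ^ n) n = a 0%nat).
{ induction n as [|n IH]; simpl in *. ring. rewrite IH. ring. }
intros eps He. exists 0%nat. intros n _. rewrite E. replace (a 0%nat - a 0%nat) with (RtoC 0) by ring. now rewrite Cmod_0.
Qed.

Lemma cps_terms_bounded a x l : cps a x l -> exists M, 0 < M /\ forall n, Cmod (a n) * Cmod x ^ n <= M.
Proof.
intros H. destruct (H 1%R Rlt_0_1) as [N HN].
assert (B : forall N0, exists M, 0 < M /\ forall n, (n <= N0)%nat -> Cmod (a n) * Cmod x ^ n <= M).
{ induction N0 as [|N0 (M & HM & IH)].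
  - exists (Cmod (a 0%nat) + 1)%R. generalize (Cmod_ge_0 (a 0%nat)). split. lra. intros n Hn. replace n with 0%nat by lia. simpl. lra.
  - exists (M + Cmod (a (S N0)) * Cmod x ^ S N0)%R.
    assert (0 <= Cmod (a (S N0)) * Cmod x ^ S N0) by (apply Rmult_le_pos; [apply Cmod_ge_0|apply pow_le, Cmod_ge_0]).
    split. lra. intros n Hn. destruct (Nat.eq_dec n (S N0)) as [->|]. lra. specialize (IH n ltac:(lia)). lra. }
destruct (B (S N)) as (M & HM & HB). exists (M + 2)%R. split. lra. intros n.
destruct (le_ge_dec n (S N)) as [L|L]. specialize (HB n L). lra.
destruct n as [|n]; [lia|].
assert (A1 := HN n ltac:(lia)). assert (A2 := HN (S n) ltac:(lia)).
rewrite <- Cmod_pow, <- Cmod_mult.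
replace (a (S n) * x ^ S n) with ((Csum (fun n => a n * x ^ n) (S n) - l) - (Csum (fun n => a n * x ^ n) n - l)) by (simpl; ring).
eapply Rle_trans. apply Cmod_triangle. rewrite Cmod_opp. lra.
Qed.

Lemma sum_geometric_tail (u : nat -> C) K s N : 0 <= K -> 0 <= s < 1 -> (forall n, Cmod (u n) <= K * s ^ n) ->
  forall m, (N <= m)%nat -> Cmod (Csum u m - Csum u N) <= K * s ^ S N / (1 - s) - K * s ^ S m / (1 - s).
Proof.
intros HK Hs Hu m Hm. induction Hm as [|m Hm IH].
- replace (Csum u N - Csum u N) with (RtoC 0) by ring. rewrite Cmod_0. lra.
- simpl Csum. replace (Csum u m + u (S m) - Csum u N) with ((Csum u m - Csum u N) + u (S m)) by ring.
  eapply Rle_trans. apply Cmod_triangle. specialize (Hu (S m)).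
  replace (K * s ^ S (S m) / (1 - s))%R with (K * s ^ S m / (1 - s) - K * s ^ S m)%R by (simpl; field; lra). lra.
Qed.

Lemma geometric_dominated_tail (u : nat -> C) K s l N : 0 <= K -> 0 <= s < 1 -> (forall n, Cmod (u n) <= K * s ^ n) ->
  Ccv (Csum u) l -> Cmod (l - Csum u N) <= K * s ^ S N / (1 - s).
Proof.
intros HK Hs Hu Hl. apply (Ccv_Cmod_le (fun m => Csum u m - Csum u N)). apply Ccv_minus; trivial. apply Ccv_const.
exists N. intros m Hm. eapply Rle_trans. apply (sum_geometric_tail u K s N HK Hs Hu m Hm).
assert (0 <= K * s ^ S m / (1 - s)). { apply Rmult_le_pos. apply Rmult_le_pos; trivial. apply pow_le. lra. left. apply Rinv_0_lt_compat. lra. }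
lra.
Qed.

Lemma pow_tends_0 s : 0 <= s < 1 -> forall eps, 0 < eps -> exists N, forall n, (N <= n)%nat -> s ^ n < eps.
Proof.
intros Hs eps He. destruct (pow_lt_1_zero s ltac:(rewrite Rabs_pos_eq; lra) eps He) as [N HN]. exists N.
intros n Hn. specialize (HN n Hn). rewrite Rabs_pos_eq in HN; trivial. apply pow_le. lra.
Qed.

Lemma ratio_bound (a : nat -> C) (x0 x : C) M : x0 <> 0 -> (forall n, Cmod (a n) * Cmod x0 ^ n <= M) ->
  forall n, Cmod (a n * x ^ n) <= M * (Cmod x / Cmod x0) ^ n.
Proof.
intros H0 H n. assert (P := proj1 (Cmod_gt_0 x0) H0). rewrite Cmod_mult, Cmod_pow.
unfold Rdiv. rewrite Rpow_mult_distr, pow_inv.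
replace (Cmod (a n) * Cmod x ^ n)%R with (Cmod (a n) * Cmod x0 ^ n * (Cmod x ^ n * / Cmod x0 ^ n))%R.
2:{ field. apply pow_nonzero. lra. }
apply Rmult_le_compat_r; trivial. apply Rmult_le_pos. apply pow_le, Cmod_ge_0. left. apply Rinv_0_lt_compat. now apply pow_lt.
Qed.

Lemma cps_near_0 a (x0 : C) M : x0 <> 0 -> (forall n, Cmod (a n) * Cmod x0 ^ n <= M) ->
  forall x l, 2 * Cmod x <= Cmod x0 -> cps a x l -> Cmod (l - a 0%nat) <= 2 * M / Cmod x0 * Cmod x.
Proof.
intros H0 HM x l Hx H. assert (P := proj1 (Cmod_gt_0 x0) H0).
assert (PM : 0 <= M). { eapply Rle_trans. 2: apply (HM 0%nat). simpl. generalize (Cmod_ge_0 (a 0%nat)). lra. }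
set (s := (Cmod x / Cmod x0)%R).
assert (Hs : 0 <= s <= / 2).
{ unfold s. split. apply Rmult_le_pos. apply Cmod_ge_0. left. now apply Rinv_0_lt_compat.
  apply Rmult_le_reg_r with (Cmod x0); trivial. unfold Rdiv. rewrite Rmult_assoc, Rinv_l by lra. lra. }
assert (T := geometric_dominated_tail (fun n => a n * x ^ n) M s l 0 PM ltac:(lra) (ratio_bound a x0 x M H0 HM) H).
simpl in T. rewrite Cmult_1_r, Rmult_1_r in T. eapply Rle_trans. apply T.
replace (2 * M / Cmod x0 * Cmod x)%R with (M * s * 2)%R by (unfold s; field; lra).
apply Rmult_le_compat_l. apply Rmult_le_pos; lra.
rewrite <- (Rinv_inv 2). apply Rinv_le_contravar; lra.
Qed.

Lemma abs_dominated_ex_series (u : nat -> R) K s : 0 <= s < 1 -> (forall n, Rabs (u n) <= K * s ^ n) -> ex_series (fun n => Rabs (u n)).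
Proof.
intros Hs Hu. apply (ex_series_le (K := R_AbsRing) (V := R_CompleteNormedModule) _ (fun n => (K * s ^ n)%R)).
- intros n. unfold norm; simpl. unfold abs; simpl. rewrite Rabs_Rabsolu. apply Hu.
- apply (ex_series_scal_l (K := R_AbsRing) (V := R_NormedModule) K (fun n => (s ^ n)%R)). apply ex_series_geom. rewrite Rabs_pos_eq; lra.
Qed.

Lemma is_series_Re u l : Ccv (Csum u) l -> is_series (fun n => Re (u n)) (Re l).
Proof.
intros H. destruct (Ccv_parts _ _ H) as [A _]. apply is_series_Reals. apply is_lim_seq_Reals.
apply is_lim_seq_ext with (2 := A). intros n. now rewrite Csum_Re.
Qed.
Lemma is_series_Im u l : Ccv (Csum u) l -> is_series (fun n => Im (u n)) (Im l).
Proof.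
intros H. destruct (Ccv_parts _ _ H) as [_ A]. apply is_series_Reals. apply is_lim_seq_Reals.
apply is_lim_seq_ext with (2 := A). intros n. now rewrite Csum_Im.
Qed.
Lemma is_series_parts u l : is_series (fun n => Re (u n)) (Re l) -> is_series (fun n => Im (u n)) (Im l) -> Ccv (Csum u) l.
Proof.
intros A B. apply is_series_Reals in A. apply is_series_Reals in B. intros eps He.
destruct (A (eps / 2)%R ltac:(lra)) as [N1 H1]. destruct (B (eps / 2)%R ltac:(lra)) as [N2 H2].
exists (Nat.max N1 N2). intros n Hn. specialize (H1 n ltac:(lia)). specialize (H2 n ltac:(lia)).
eapply Rle_lt_trans. apply Cmod_le_parts. unfold Cminus. rewrite re_plus, im_plus, re_opp, im_opp, Csum_Re, Csum_Im.
unfold R_dist, Rminus in *. lra.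
Qed.

(** Geometric domination gives absolute convergence of the real and imaginary parts, so that four
    real Cauchy products combine to the complex one. *)
Lemma Cauchy_product (u v : nat -> C) l l' K s : 0 <= s < 1 -> (forall n, Cmod (u n) <= K * s ^ n) -> (forall n, Cmod (v n) <= K * s ^ n) ->
  Ccv (Csum u) l -> Ccv (Csum v) l' -> Ccv (Csum (fun n => Csum (fun k => u k * v (n - k)%nat) n)) (l * l').
Proof.
intros Hs Hu Hv H H'.
assert (uR : ex_series (fun n => Rabs (Re (u n)))) by (apply (abs_dominated_ex_series _ K s Hs); intros; eapply Rle_trans; [apply re_le_Cmod|apply Hu]).
assert (uI : ex_series (fun n => Rabs (Im (u n)))) by (apply (abs_dominated_ex_series _ K s Hs); intros; eapply Rle_trans; [apply im_le_Cmod|apply Hu]).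
assert (vR : ex_series (fun n => Rabs (Re (v n)))) by (apply (abs_dominated_ex_series _ K s Hs); intros; eapply Rle_trans; [apply re_le_Cmod|apply Hv]).
assert (vI : ex_series (fun n => Rabs (Im (v n)))) by (apply (abs_dominated_ex_series _ K s Hs); intros; eapply Rle_trans; [apply im_le_Cmod|apply Hv]).
apply is_series_Re in H as HR. apply is_series_Im in H as HI. apply is_series_Re in H' as HR'. apply is_series_Im in H' as HI'.
apply is_series_parts.
- rewrite re_mult. eapply is_series_ext; [|apply (is_series_minus (K := R_AbsRing) (V := R_NormedModule) _ _ _ _ (is_series_mult _ _ _ _ HR HR' uR vR) (is_series_mult _ _ _ _ HI HI' uI vI))].
  intros n. cbv beta. rewrite Csum_Re. unfold minus, plus, opp; simpl.
  rewrite (sum_eq (fun k => Re (u k * v (n - k)%nat)) (fun k => (Re (u k) * Re (v (n - k)%nat) - Im (u k) * Im (v (n - k)%nat))%R)) by (intros; apply re_mult).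
  rewrite minus_sum. reflexivity.
- rewrite im_mult. eapply is_series_ext; [|apply (is_series_plus (K := R_AbsRing) (V := R_NormedModule) _ _ _ _ (is_series_mult _ _ _ _ HR HI' uR vI) (is_series_mult _ _ _ _ HI HR' uI vR))].
  intros n. cbv beta. rewrite Csum_Im. unfold plus; simpl.
  rewrite (sum_eq (fun k => Im (u k * v (n - k)%nat)) (fun k => (Re (u k) * Im (v (n - k)%nat) + Im (u k) * Re (v (n - k)%nat))%R)) by (intros; apply im_mult).
  rewrite plus_sum. reflexivity.
Qed.

(** * Germs of power series with coefficients in a subring *)

Definition cauchy_coef (a b : nat -> C) (n : nat) : C := Csum (fun k => a k * b (n - k)%nat) n.

(** The condition [k] on the coefficients is part of the notion, so that the same closure lemmas
    serve rational and arbitrary coefficients. *)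
Definition germ (k : C -> Prop) (F : C -> C) (a : nat -> C) : Prop :=
  (forall n, k (a n)) /\ exists r, 0 < r /\ forall x, Cmod x < r -> cps a x (F x).

Definition subring (k : C -> Prop) : Prop :=
  k 1 /\ (forall x y, k x -> k y -> k (x + y)) /\ (forall x y, k x -> k y -> k (x * y)) /\ (forall x, k x -> k (- x)).

Section Germ.
Variable k : C -> Prop.
Hypothesis Hk : subring k.

Lemma k_0 : k 0.
Proof. destruct Hk as (H1 & H2 & H3 & H4). replace (RtoC 0) with (1 + - (1)) by ring. apply H2; trivial. now apply H4. Qed.

Lemma k_Csum u n : (forall i, k (u i)) -> k (Csum u n).
Proof. intros H. destruct Hk as (H1 & H2 & H3 & H4). induction n as [|n IH]; simpl. apply H. apply H2; trivial. Qed.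

Lemma germ_const c : k c -> germ k (fun _ => c) (delta0 c).
Proof.
intros H. split. intros [|n]; simpl; trivial. apply k_0. exists 1%R. split. lra. intros; apply cps_const.
Qed.

Lemma germ_plus F G a b : germ k F a -> germ k G b -> germ k (fun x => F x + G x) (fun n => a n + b n).
Proof.
intros (A1 & r & Hr & A2) (B1 & r' & Hr' & B2). split. intros n. apply Hk; trivial.
exists (Rmin r r'). split. now apply Rmin_glb_lt. intros x Hx. apply cps_plus.
apply A2. eapply Rlt_le_trans; [apply Hx|apply Rmin_l]. apply B2. eapply Rlt_le_trans; [apply Hx|apply Rmin_r].
Qed.

Lemma germ_X F a : germ k F a -> germ k (fun x => x * F x) (shift1 a).
Proof.
intros (A1 & r & Hr & A2). split. intros [|n]; simpl; trivial. apply k_0. exists r. split; trivial.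
intros x Hx. apply cps_shift1. now apply A2.
Qed.

Lemma germ_mult F G a b : germ k F a -> germ k G b -> germ k (fun x => F x * G x) (cauchy_coef a b).
Proof.
intros (A1 & r & Hr & A2) (B1 & r' & Hr' & B2). split. intros n. apply k_Csum. intros; apply Hk; trivial.
set (R := Rmin r r'). assert (HR : 0 < R) by now apply Rmin_glb_lt.
assert (L1 : R <= r) by apply Rmin_l. assert (L2 : R <= r') by apply Rmin_r.
set (x0 := RtoC (R / 2)).
assert (M0 : Cmod x0 = (R / 2)%R) by (unfold x0; rewrite Cmod_R, Rabs_pos_eq; lra).
assert (N0 : x0 <> 0) by (apply Cmod_gt_0; lra).
destruct (cps_terms_bounded a x0 _ (A2 x0 ltac:(lra))) as (Ma & PMa & HMa).
destruct (cps_terms_bounded b x0 _ (B2 x0 ltac:(lra))) as (Mb & PMb & HMb).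
exists (R / 2)%R. split. lra. intros x Hx.
set (s := (Cmod x / Cmod x0)%R).
assert (Hs : 0 <= s < 1).
{ unfold s. rewrite M0. split. apply Rmult_le_pos. apply Cmod_ge_0. left. apply Rinv_0_lt_compat. lra.
  apply Rmult_lt_reg_r with (R / 2)%R. lra. unfold Rdiv at 1. rewrite Rmult_assoc, Rinv_l by lra. lra. }
assert (Ps : forall n, 0 <= s ^ n) by (intros; apply pow_le; lra).
assert (P := Cauchy_product (fun n => a n * x ^ n) (fun n => b n * x ^ n) (F x) (G x) (Ma + Mb) s Hs).
eapply Ccv_ext. 2: apply P.
- intros n. apply Csum_ext. intros i _. unfold cauchy_coef. rewrite Cmult_comm, <- Csum_scal. apply Csum_ext.
  intros j Hj. replace (x ^ i) with (x ^ j * x ^ (i - j)). ring. rewrite <- Cpow_add_r. f_equal. lia.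
- intros n. eapply Rle_trans. apply (ratio_bound a x0 x Ma N0 HMa). apply Rmult_le_compat_r; [apply Ps|lra].
- intros n. eapply Rle_trans. apply (ratio_bound b x0 x Mb N0 HMb). apply Rmult_le_compat_r; [apply Ps|lra].
- apply A2. lra.
- apply B2. lra.
Qed.

Lemma germ_ext F G a : (forall x, F x = G x) -> germ k F a -> germ k G a.
Proof. intros E (H1 & r & Hr & H2). split; trivial. exists r. split; trivial. intros. rewrite <- E. now apply H2. Qed.

Definition is_germ (F : C -> C) : Prop := exists a, germ k F a.

Lemma is_germ_pow F n : is_germ F -> is_germ (fun x => F x ^ n).
Proof.
intros [a H]. induction n as [|n [b IH]]; simpl.
- eexists. apply germ_const. apply Hk.
- eexists. apply germ_mult; eassumption.
Qed.

(* Coefficients of the partial products of [prod (1 + s x^(e n))]. *)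
Fixpoint prod_coef (s : C) (e : nat -> nat) (m : nat) (n : nat) : C :=
  match m with
  | O => delta0 1 n
  | S m' => prod_coef s e m' n + (if le_lt_dec (e m) n then s * prod_coef s e m' (n - e m)%nat else 0)
  end.

Definition Xprod (s : C) (e : nat -> nat) (x : C) : C := Cinfprod (fun n => 1 + s * x ^ e n).

Definition shiftn (d : nat) (a : nat -> C) (n : nat) : C := if le_lt_dec d n then a (n - d)%nat else 0.

Lemma cps_shiftn d a x l : cps a x l -> cps (shiftn d a) x (x ^ d * l).
Proof.
intros H. induction d as [|d IH].
- simpl. rewrite Cmult_1_l. apply cps_ext with (2 := H). intros n. unfold shiftn. destruct le_lt_dec; [|lia]. f_equal. lia.
- rewrite Cpow_S, <- Cmult_assoc. apply cps_ext with (2 := cps_shift1 _ _ _ IH).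
  intros [|n]; unfold shift1, shiftn; repeat destruct le_lt_dec; trivial; lia.
Qed.

Lemma prod_coef_cps s e x m : cps (prod_coef s e m) x (Cprod (fun n => 1 + s * x ^ e n) m).
Proof.
induction m as [|m IH]. apply cps_const.
simpl Cprod.
replace (Cprod (fun n => 1 + s * x ^ e n) m * (1 + s * x ^ e (S m))) with
  (Cprod (fun n => 1 + s * x ^ e n) m + s * (x ^ e (S m) * Cprod (fun n => 1 + s * x ^ e n) m)) by ring.
apply cps_ext with (2 := cps_plus _ _ _ _ _ IH (cps_scal s _ _ _ (cps_shiftn (e (S m)) _ _ _ IH))).
intros n. simpl. f_equal. unfold shiftn. destruct le_lt_dec; trivial. ring.
Qed.

(** The factor of index m only affects coefficients from x^(e m) on, and e m >= m; the n-th
    coefficient is final once n factors have been multiplied. *)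
Lemma prod_coef_stable s e : (forall n, (n <= e n)%nat) -> forall n m, (n <= m)%nat -> prod_coef s e m n = prod_coef s e n n.
Proof.
intros He n m H. induction H as [|m H IH]; trivial. simpl. specialize (He (S m)). destruct le_lt_dec; [lia|].
rewrite IH. ring.
Qed.

(** A shift by e m >= m gains a factor 2^-m against the weight 2^n. The factors 1 + 2^-m multiply to
    at most exp (1 - 2^-m), so the bound 3 * 2^n holds uniformly in m. *)
Lemma prod_coef_bound s e : Cmod s <= 1 -> (forall n, (n <= e n)%nat) ->
  forall m n, Cmod (prod_coef s e m n) <= exp (1 - / 2 ^ m) * 2 ^ n.
Proof.
intros Hs He. induction m as [|m IH]; intros n.
- simpl. rewrite Rinv_1, Rminus_diag, exp_0, Rmult_1_l. assert (1 <= 2 ^ n) by (apply pow_R1_Rle; lra).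
  destruct n; simpl delta0. rewrite Cmod_1. simpl. lra. rewrite Cmod_0. lra.
- assert (P2 : forall i, 0 < 2 ^ i) by (intros; apply pow_lt; lra).
  assert (X : exp (1 - / 2 ^ m) * (1 + / 2 ^ S m) <= exp (1 - / 2 ^ S m)).
  { replace (1 - / 2 ^ S m)%R with ((1 - / 2 ^ m) + / 2 ^ S m)%R. rewrite exp_plus.
    apply Rmult_le_compat_l. left; apply exp_pos. apply exp_ineq1_le.
    simpl. field. apply Rgt_not_eq, P2. }
  apply Rle_trans with (exp (1 - / 2 ^ m) * (1 + / 2 ^ S m) * 2 ^ n)%R.
  2:{ apply Rmult_le_compat_r; trivial. left. apply P2. }
  cbn [prod_coef]. eapply Rle_trans. apply Cmod_triangle.
  assert (Y : Cmod (if le_lt_dec (e (S m)) n then s * prod_coef s e m (n - e (S m))%nat else 0) <= exp (1 - / 2 ^ m) * (/ 2 ^ S m * 2 ^ n)).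
  { destruct le_lt_dec as [L|L].
    - rewrite Cmod_mult. apply Rle_trans with (1 * (exp (1 - / 2 ^ m) * 2 ^ (n - e (S m))))%R.
      apply Rmult_le_compat; trivial; apply Cmod_ge_0. rewrite Rmult_1_l. apply Rmult_le_compat_l. left; apply exp_pos.
      apply Rmult_le_reg_l with (2 ^ S m)%R. apply P2. rewrite <- Rmult_assoc, Rinv_r, Rmult_1_l by (apply Rgt_not_eq, P2).
      rewrite <- pow_add. apply Rle_pow. lra. specialize (He (S m)). lia.
    - rewrite Cmod_0. repeat apply Rmult_le_pos. left; apply exp_pos. left. apply Rinv_0_lt_compat, P2. left. apply P2. }
  specialize (IH n). lra.
Qed.

Lemma prod_coef_in s e : k s -> forall m n, k (prod_coef s e m n).
Proof.
intros Hs. induction m as [|m IH]; intros n.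
- destruct n; simpl. apply Hk. apply k_0.
- simpl. destruct Hk as (H1 & H2 & H3 & H4). apply H2; trivial. destruct le_lt_dec. apply H3; trivial. apply k_0.
Qed.

Lemma Xprod_cv s e x : Cmod s <= 1 -> (forall n, (n <= e n)%nat) -> Cmod x < 1 ->
  Ccv (Cprod (fun n => 1 + s * x ^ e n)) (Xprod s e x).
Proof.
intros Hs He Hx. set (t := ((Cmod x + 1) / 2)%R). assert (P := Cmod_ge_0 x).
assert (Ht : 0 < t < 1) by (unfold t; lra).
assert (PB : exists B, partial_bound (fun n => t ^ n)%R B).
{ exists (1 / (1 - t))%R. split. intros. apply pow_le. lra. intros n.
  assert (G : forall n, (sum_f_R0 (fun n => t ^ n) n = 1 / (1 - t) - t ^ S n / (1 - t))%R).
  { induction n0 as [|n0 IH]. simpl. field. lra. cbn [sum_f_R0]. rewrite IH. simpl. field. lra. }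
  rewrite G. assert (0 <= t ^ S n / (1 - t)). { apply Rmult_le_pos. apply pow_le; lra. left. apply Rinv_0_lt_compat. lra. } lra. }
destruct PB as [B HB].
destruct (Cprod_cv (fun n => s * x ^ e n) (fun n => t ^ n)%R B HB) as [l Hl].
{ intros n. rewrite Cmod_mult, Cmod_pow. apply Rle_trans with (1 * t ^ e n)%R.
  - apply Rmult_le_compat; trivial. apply Cmod_ge_0. apply pow_le. trivial. apply pow_incr. unfold t. lra.
  - rewrite Rmult_1_l. replace (e n) with (n + (e n - n))%nat by (specialize (He n); lia). rewrite pow_add.
    rewrite <- (Rmult_1_r (t ^ n)) at 2. apply Rmult_le_compat_l. apply pow_le; lra. rewrite <- (pow1 (e n - n)). apply pow_incr. lra. }
unfold Xprod. now rewrite (Cinfprod_Ccv _ _ Hl).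
Qed.

Lemma germ_Xprod s e : k s -> Cmod s <= 1 -> (forall n, (n <= e n)%nat) -> germ k (Xprod s e) (fun n => prod_coef s e n n).
Proof.
intros ks Hs He. split. intros; now apply prod_coef_in. exists (/ 4)%R. split. lra. intros x Hx.
assert (L := Xprod_cv s e x Hs He ltac:(lra)).
intros eps Heps. destruct (L (eps / 2)%R ltac:(lra)) as [N1 H1].
destruct (pow_tends_0 (/ 2) ltac:(lra) (eps / 16)%R ltac:(lra)) as [N2 H2].
exists (Nat.max N1 N2). intros n Hn. specialize (H1 n ltac:(lia)). specialize (H2 n ltac:(lia)).
set (P := Cprod (fun n => 1 + s * x ^ e n) n) in *.
assert (E : Csum (fun i => prod_coef s e i i * x ^ i) n = Csum (fun i => prod_coef s e n i * x ^ i) n).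
{ apply Csum_ext. intros i Hi. now rewrite (prod_coef_stable s e He i n Hi). }
rewrite E.
(* For |x| < 1/4 the i-th term of the n-th partial product is at most 3 * 2^i / 4^i = 3 / 2^i, so
   the terms of degree above n, whose coefficients need not be final, are negligible. *)
assert (T : Cmod (P - Csum (fun i => prod_coef s e n i * x ^ i) n) <= 3 * (/ 2) ^ S n / (1 - / 2)).
{ apply geometric_dominated_tail; try lra.
  - intros i. rewrite Cmod_mult, Cmod_pow.
    apply Rle_trans with (3 * 2 ^ i * (/ 4) ^ i)%R.
    + apply Rmult_le_compat. apply Cmod_ge_0. apply pow_le, Cmod_ge_0.
      eapply Rle_trans. apply prod_coef_bound; trivial. apply Rmult_le_compat_r. apply pow_le; lra.
      eapply Rle_trans. 2: apply exp_le_3. apply exp_le_mono. assert (0 < / 2 ^ n) by (apply Rinv_0_lt_compat, pow_lt; lra). lra.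
      apply pow_incr. split. apply Cmod_ge_0. lra.
    + rewrite Rmult_assoc, <- Rpow_mult_distr. replace (2 * / 4)%R with (/ 2)%R by field. lra.
  - apply prod_coef_cps. }
replace (Csum (fun i => prod_coef s e n i * x ^ i) n - Xprod s e x) with ((P - Xprod s e x) + - (P - Csum (fun i => prod_coef s e n i * x ^ i) n)) by ring.
eapply Rle_lt_trans. apply Cmod_triangle. rewrite Cmod_opp. simpl in T. lra.
Qed.

Lemma Xprod_0 s e : (forall n, (n <= e n)%nat) -> Xprod s e 0 = 1.
Proof.
intros He. unfold Xprod. apply Cinfprod_Ccv. apply Ccv_ext with (2 := Ccv_const 1). intros n.
symmetry. transitivity (Cprod (fun _ => 1) n); [apply Cprod_ext|apply Cprod_1]. intros i Hi. specialize (He i).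
destruct (e i); [lia|]. simpl. ring.
Qed.

End Germ.

(** * The Hauptmodul at the cusps *)

Lemma germ_scale k F a z : subring k -> k z -> germ k F a -> germ k (fun x => F (z * x)) (fun n => a n * z ^ n).
Proof.
intros Hk kz (H1 & r & Hr & H2). split.
- intros n. apply Hk; trivial. induction n as [|n IH]; simpl; apply Hk; trivial.
- assert (P := Cmod_ge_0 z). exists (r / (Cmod z + 1))%R. split. apply Rdiv_lt_0_compat; lra. intros x Hx.
  assert (X : Cmod (z * x) < r).
  { rewrite Cmod_mult. assert (Q := Cmod_ge_0 x). apply Rmult_lt_compat_l with (r := (Cmod z + 1)%R) in Hx; [|lra].
    replace ((Cmod z + 1) * (r / (Cmod z + 1)))%R with r in Hx by (field; lra). lra. }
  specialize (H2 _ X). apply Ccv_ext with (2 := H2). intros n. apply Csum_ext. intros i _. rewrite Cpow_mult_l. ring.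
Qed.

Lemma germ_unshift k F a : germ k F a -> a 0%nat = 0 ->
  germ k (fun x => if Ceq_dec x 0 then a 1%nat else F x / x) (fun n => a (S n)).
Proof.
intros (H1 & r & Hr & H2) H0. split. intros; apply H1. exists r. split; trivial. intros x Hx.
destruct (Ceq_dec x 0) as [->|N]. apply (cps_0 (fun n => a (S n))).
apply cps_unshift1; trivial. replace (x * (F x / x)) with (F x) by (field; trivial). now apply H2.
Qed.

Lemma germ_near_0 k F a : germ k F a -> exists r K, 0 < r /\ 0 < K /\ forall x, Cmod x < r -> Cmod (F x - a 0%nat) <= K * Cmod x.
Proof.
intros (H1 & r & Hr & H2).
set (x0 := RtoC (r / 2)). assert (M0 : Cmod x0 = (r / 2)%R) by (unfold x0; rewrite Cmod_R, Rabs_pos_eq; lra).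
assert (N0 : x0 <> 0) by (apply Cmod_gt_0; lra).
destruct (cps_terms_bounded a x0 _ (H2 x0 ltac:(lra))) as (M & PM & HM).
exists (r / 4)%R, (2 * M / Cmod x0)%R. split. lra. split. apply Rdiv_lt_0_compat; lra.
intros x Hx. apply (cps_near_0 a x0 M N0 HM). lra. apply H2. lra.
Qed.

Lemma ee_small del : 0 < del -> exists Y, forall tau, Y < Im tau -> Cmod (ee tau) < del.
Proof.
intros Hd. assert (PP := PI_RGT_0). exists (- ln del / (2 * PI))%R. intros tau H. rewrite Cmod_ee.
apply Rlt_le_trans with (exp (ln del)). 2: rewrite exp_ln; lra. apply exp_increasing.
apply Rmult_lt_compat_l with (r := (2 * PI)%R) in H; [|lra].
replace (2 * PI * (- ln del / (2 * PI)))%R with (- ln del)%R in H by (field; lra). lra.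
Qed.

Lemma germ_tends k F a : germ k F a -> tends_at_infinity (fun tau => F (ee tau)) (a 0%nat).
Proof.
intros H. destruct (germ_near_0 _ _ _ H) as (r & K & Hr & HK & HB). intros eps He.
destruct (ee_small (Rmin r (eps / K))) as [Y HY]. apply Rmin_glb_lt; trivial. now apply Rdiv_lt_0_compat.
exists Y. intros tau _ Ht. specialize (HY tau Ht).
assert (A : Cmod (ee tau) < r) by (eapply Rlt_le_trans; [apply HY|apply Rmin_l]).
assert (B : Cmod (ee tau) < eps / K) by (eapply Rlt_le_trans; [apply HY|apply Rmin_r]).
eapply Rle_lt_trans. apply HB. exact A.
apply Rmult_lt_compat_l with (r := K) in B; trivial. replace (K * (eps / K))%R with eps in B by (field; lra). exact B.
Qed.

Lemma tends_ee : tends_at_infinity ee 0.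
Proof.
intros eps He. destruct (ee_small eps He) as [Y HY]. exists Y. intros tau _ Ht.
replace (ee tau - 0) with (ee tau) by ring. now apply HY.
Qed.

Lemma tends_shift_half f l : tends_at_infinity f l -> tends_at_infinity (fun t => f (t + / 2)) l.
Proof.
intros H eps He. destruct (H eps He) as [Y HY]. exists Y. intros t Ht HM. apply HY; now rewrite im_plus_half.
Qed.

Definition coeff_rat (x : C) : Prop := exists q : Q, x = RtoC (Q2R q).
Definition coeff_any (x : C) : Prop := True.

Lemma subring_rat : subring coeff_rat.
Proof.
repeat split.
- exists 1%Q. now rewrite RMicromega.Q2R_1.
- intros x y [p ->] [q ->]. exists (p + q)%Q. now rewrite Q2R_plus, RtoC_plus.
- intros x y [p ->] [q ->]. exists (p * q)%Q. now rewrite Q2R_mult, RtoC_mult.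
- intros x [p ->]. exists (- p)%Q. now rewrite Q2R_opp, RtoC_opp.
Qed.
Lemma subring_any : subring coeff_any.
Proof. repeat split. Qed.

Lemma Pp_Xprod u w s e x : 0 < Im u -> (forall n, (1 <= n)%nat -> - ee (RtoC (INR n) * u + w) = s * x ^ e n) -> Pp u w = Xprod s e x.
Proof.
intros Hu H. unfold Xprod. symmetry. apply Cinfprod_Ccv. apply Ccv_ext with (2 := Pp_cv u w Hu).
intros n. apply Cprod_ext. intros k Hk. unfold Pterm. now rewrite H.
Qed.

Definition serD := Xprod (- (1)) (fun n => 2 * n - 1)%nat.
Definition serN := Xprod (- (1)) (fun n => 4 * n - 2)%nat.
Definition serE := Xprod 1 (fun n => n).
Definition serE2 := Xprod 1 (fun n => 2 * n)%nat.
(** [serA] at q is q g and [serB] at q is 1 / (q g). Euler's identity replaces each product in a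
    denominator by one in the numerator. *)
Definition serA (x : C) : C := (serN x ^ 2 * serE x) ^ 8.
Definition serB (x : C) : C := (serE2 x ^ 2 * serD x) ^ 8.

Section Products.
Variable tau : C.
Hypothesis Ht : 0 < Im tau.

Let H2 : 0 < Im (2 * tau).
Proof. apply im_scal_pos; lra || trivial. Qed.
Let H4 : 0 < Im (4 * tau).
Proof. apply im_scal_pos; lra || trivial. Qed.

Lemma serD_Pp : Pp (2 * tau) (- tau) = serD (ee tau).
Proof.
apply Pp_Xprod; trivial. intros n Hn. rewrite ee_pow, minus_INR, mult_INR by lia.
replace (RtoC (INR 2 * INR n - INR 1) * tau) with (RtoC (INR n) * (2 * tau) + - tau). ring.
rewrite RtoC_minus, RtoC_mult. simpl INR. replace (1 + 1)%R with 2%R by ring. ring.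
Qed.
Lemma serN_Pp : Pp (4 * tau) (- (2 * tau)) = serN (ee tau).
Proof.
apply Pp_Xprod; trivial. intros n Hn. rewrite ee_pow, minus_INR, mult_INR by lia.
replace (RtoC (INR 4 * INR n - INR 2) * tau) with (RtoC (INR n) * (4 * tau) + - (2 * tau)). ring.
rewrite RtoC_minus, RtoC_mult. simpl INR. replace (1 + 1 + 1 + 1)%R with 4%R by ring. replace (1 + 1)%R with 2%R by ring. ring.
Qed.
Lemma serE_Pp : Pp tau (/ 2) = serE (ee tau).
Proof.
apply Pp_Xprod; trivial. intros n Hn. rewrite ee_pow, ee_plus, ee_half. ring.
Qed.
Lemma serE2_Pp : Pp (2 * tau) (/ 2) = serE2 (ee tau).
Proof.
apply Pp_Xprod; trivial. intros n Hn. rewrite ee_pow, ee_plus, ee_half, mult_INR.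
replace (RtoC (INR 2 * INR n) * tau) with (RtoC (INR n) * (2 * tau)). ring.
rewrite RtoC_mult. simpl INR. replace (1 + 1)%R with 2%R by ring. ring.
Qed.

Lemma g_serA : ee tau * g_lower14 tau = serA (ee tau).
Proof.
rewrite g_Pp by trivial. unfold serA. rewrite <- serN_Pp, <- serE_Pp.
assert (E := Pp_euler tau Ht). assert (N := Pp_odd_nonzero tau Ht). assert (Nq := ee_neq_0 tau).
rewrite ee_opp. replace (Pp tau (/ 2)) with (/ Pp (2 * tau) (- tau)). field. now split.
replace (Pp tau (/ 2)) with (Pp tau (/ 2) * Pp (2 * tau) (- tau) / Pp (2 * tau) (- tau)) by (field; trivial).
rewrite E. field. trivial.
Qed.

Lemma g_inv_serB : / g_lower14 tau = ee tau * serB (ee tau).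
Proof.
assert (E : serA (ee tau) * serB (ee tau) = 1).
{ unfold serA, serB. rewrite <- Cpow_mult_l. rewrite <- serN_Pp, <- serE_Pp, <- serE2_Pp, <- serD_Pp.
  assert (E1 := Pp_euler tau Ht). assert (E2 := Pp_euler _ H2). replace (2 * (2 * tau)) with (4 * tau) in E2 by ring.
  match goal with |- ?x ^ 8 = _ => replace x with ((Pp (2 * tau) (/ 2) * Pp (4 * tau) (- (2 * tau))) ^ 2 * (Pp tau (/ 2) * Pp (2 * tau) (- tau))) by ring end.
  rewrite E1, E2. ring. }
rewrite <- g_serA in E. assert (N := g_neq_0 tau Ht).
replace (/ g_lower14 tau) with (ee tau * g_lower14 tau * serB (ee tau) / g_lower14 tau). field; trivial.
rewrite E. field. trivial.
Qed.
End Products.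

Lemma coeff_m1 k : subring k -> k (- (1)).
Proof. intros (H1 & _ & _ & H4). now apply H4. Qed.

Lemma Cmod_m1' : Cmod (- (1)) <= 1.
Proof. rewrite Cmod_opp, Cmod_1. lra. Qed.

Lemma is_germ_serA k : subring k -> is_germ k serA.
Proof.
intros Hk. unfold serA. apply is_germ_pow; trivial. destruct (is_germ_pow k Hk serN 2) as [a Ha].
{ eexists. apply germ_Xprod; trivial. now apply coeff_m1. apply Cmod_m1'. intros; lia. }
eexists. apply germ_mult; trivial. exact Ha. apply germ_Xprod; trivial. apply Hk. rewrite Cmod_1; lra.
Qed.
Lemma is_germ_serB k : subring k -> is_germ k serB.
Proof.
intros Hk. unfold serB. apply is_germ_pow; trivial. destruct (is_germ_pow k Hk serE2 2) as [a Ha].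
{ eexists. apply germ_Xprod; trivial. apply Hk. rewrite Cmod_1; lra. intros; lia. }
eexists. apply germ_mult; trivial. exact Ha. apply germ_Xprod; trivial. now apply coeff_m1. apply Cmod_m1'. intros; lia.
Qed.
Lemma serA_0 : serA 0 = 1.
Proof. unfold serA, serN, serE. rewrite !Xprod_0 by (intros; lia). ring. Qed.
Lemma serB_0 : serB 0 = 1.
Proof. unfold serB, serE2, serD. rewrite !Xprod_0 by (intros; lia). ring. Qed.

Lemma germ_coef_0 k F a : germ k F a -> a 0%nat = F 0.
Proof. intros (_ & r & Hr & H). eapply cps_unique. apply cps_0. apply H. now rewrite Cmod_0. Qed.

Lemma tends_serA : tends_at_infinity (fun t => serA (ee t)) 1.
Proof. destruct (is_germ_serA _ subring_any) as [a Ha]. rewrite <- serA_0, <- (germ_coef_0 _ _ _ Ha). eapply germ_tends, Ha. Qed.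
Lemma tends_serB : tends_at_infinity (fun t => serB (ee t)) 1.
Proof. destruct (is_germ_serB _ subring_any) as [a Ha]. rewrite <- serB_0, <- (germ_coef_0 _ _ _ Ha). eapply germ_tends, Ha. Qed.

Lemma tends_g_inv : tends_at_infinity (fun t => / g_lower14 t) 0.
Proof.
apply tends_ext with (fun t => ee t * serB (ee t)). intros; symmetry; now apply g_inv_serB.
apply tends_lim with (0 * 1). ring. apply tends_mult. apply tends_ee. apply tends_serB.
Qed.

Definition g_half (tau : C) : C := g_lower14 (tau + / 2).

Lemma UHP_half tau : 0 < Im tau -> 0 < Im (tau + / 2).
Proof. now rewrite im_plus_half. Qed.

Lemma g_half_neq_0 tau : 0 < Im tau -> g_half tau <> 0.
Proof. intros H. now apply g_neq_0, UHP_half. Qed.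

Lemma g_half_half tau : 0 < Im tau -> g_half (tau + / 2) = g_lower14 tau.
Proof. intros H. unfold g_half. replace (tau + / 2 + / 2) with (tau + 1) by field. now apply g_plus_1. Qed.

Lemma tends_g_ratio : tends_at_infinity (fun t => g_lower14 t / g_half t) (- (1)).
Proof.
apply tends_ext with (fun t => - (1) * (serA (ee t) * serB (ee (t + / 2)))).
- intros t Ht. rewrite <- g_serA by trivial. unfold Cdiv, g_half. rewrite g_inv_serB by now apply UHP_half.
  rewrite (ee_plus t (/ 2)) at 2. rewrite ee_half. ring.
- apply tends_lim with (- (1) * (1 * 1)). ring. apply tends_mult. apply tends_const. apply tends_mult. apply tends_serA.
  apply (tends_shift_half (fun t => serB (ee t))). apply tends_serB.
Qed.

Lemma tends_g_half_inv : tends_at_infinity (fun t => / g_half t) 0.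
Proof. apply (tends_shift_half (fun t => / g_lower14 t)). apply tends_g_inv. Qed.

Lemma g_fricke_quot tau : 0 < Im tau -> g_lower14 (fricke tau) = - (16) * (g_lower14 tau / g_half tau).
Proof.
intros H. assert (N := g_half_neq_0 tau H). assert (E := g_fricke tau H). fold (g_half tau) in E.
replace (g_lower14 (fricke tau)) with (g_lower14 (fricke tau) * g_half tau / g_half tau) by (field; trivial).
rewrite E. field. trivial.
Qed.

(** The formula for g(W tau) is applied at W tau; W being an involution, it can be solved for g(W
    tau + 1/2). *)
Lemma g_half_fricke tau : 0 < Im tau -> g_half (fricke tau) = 256 * / g_half tau.
Proof.
intros H. assert (N := g_half_neq_0 tau H). assert (N' := g_neq_0 tau H).
assert (Hf := im_fricke tau H). assert (Nf := g_half_neq_0 _ Hf).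
assert (E := g_fricke_quot _ Hf). rewrite fricke_fricke, g_fricke_quot in E by trivial.
replace (g_half (fricke tau)) with (g_half (fricke tau) * g_lower14 tau / g_lower14 tau) by (field; trivial).
rewrite E at 1. field. now repeat split.
Qed.

Lemma inv_S_fricke tau : inv_S tau = fricke (tau / 4).
Proof. unfold inv_S, fricke. f_equal. f_equal. field. Qed.

(** Since (S tau + 2) / 4 = W tau + 1/2, the third cusp is reached by W, the half shift and W again,
    whose effect on [g] and [g_half] is known. *)
Lemma inv_S_S_2_fricke tau : 0 < Im tau -> inv_S (inv_S tau + 2) = fricke (fricke tau + / 2).
Proof.
intros H. rewrite inv_S_fricke. f_equal. unfold inv_S, fricke. field. now apply im_pos_neq_0.
Qed.

Lemma im_quarter tau : Im (tau / 4) = (Im tau / 4)%R.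
Proof. unfold Cdiv. rewrite <- RtoC_quarter, im_scal_r. reflexivity. Qed.

Lemma g_cusp_half tau : 0 < Im tau -> g_lower14 (inv_S (inv_S tau + 2)) = 256 * / g_lower14 tau.
Proof.
intros H. assert (Hf := im_fricke tau H). rewrite inv_S_S_2_fricke, g_fricke_quot by (trivial; now apply UHP_half).
rewrite g_half_half by trivial. fold (g_half (fricke tau)). rewrite g_half_fricke, g_fricke_quot by trivial.
assert (N1 := g_half_neq_0 tau H). assert (N2 := g_neq_0 tau H). field. now split.
Qed.

Lemma g_half_cusp_half tau : 0 < Im tau -> g_half (inv_S (inv_S tau + 2)) = - (16) * / (g_lower14 tau / g_half tau).
Proof.
intros H. assert (Hf := im_fricke tau H). rewrite inv_S_S_2_fricke, g_half_fricke by (trivial; now apply UHP_half).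
rewrite g_half_half, g_fricke_quot by trivial. assert (N1 := g_half_neq_0 tau H). assert (N2 := g_neq_0 tau H). field. now split.
Qed.

Lemma holo_ext f h : (forall tau, 0 < Im tau -> f tau = h tau) -> holo f -> holo h.
Proof.
intros E H tau Ht. destruct (H tau Ht) as [d Hd]. exists d. apply cder_ext_loc with (2 := Hd).
exists (Im tau). split; trivial. intros w Hw. apply E. now apply UHP_disc with tau.
Qed.

Lemma holo_shift f r : holo f -> holo (fun t => f (t + RtoC r)).
Proof.
intros H tau Ht. destruct (H (tau + RtoC r)) as [d Hd]. now rewrite im_plus_RtoC. eexists.
apply (cder_comp f (fun t => t + RtoC r)). exact Hd. apply cder_plus. apply cder_id. apply cder_const.
Qed.

Lemma holo_scale f r : 0 < r -> holo f -> holo (fun t => f (RtoC r * t)).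
Proof.
intros Hr H tau Ht. destruct (H (RtoC r * tau)) as [d Hd]. now apply im_scal_pos. eexists.
apply (cder_comp f (fun t => RtoC r * t)). exact Hd. apply cder_mult. apply cder_const. apply cder_id.
Qed.

Lemma holo_g : holo g_lower14.
Proof.
apply holo_ext with (fun tau => ee (- tau) * (Pp (4 * tau) (- (2 * tau)) ^ 2 / Pp (2 * tau) (- tau)) ^ 8).
intros; symmetry; now apply g_Pp.
intros tau Ht.
destruct (cder_Pp 0 4 0 (- (2)) tau) as [d1 H1]. rewrite Cplus_0_l. apply im_scal_pos; lra || trivial.
destruct (cder_Pp 0 2 0 (- (1)) tau) as [d2 H2]. rewrite Cplus_0_l. apply im_scal_pos; lra || trivial.
assert (H1' : cder (fun t => Pp (4 * t) (- (2 * t))) tau d1).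
{ apply cder_ext with (2 := H1). intros w. f_equal; ring. }
assert (H2' : cder (fun t => Pp (2 * t) (- t)) tau d2).
{ apply cder_ext with (2 := H2). intros w. f_equal; ring. }
destruct (cder_pow _ _ _ 2 H1') as [d3 H3].
assert (N := Pp_odd_nonzero tau Ht).
destruct (cder_pow _ _ _ 8 (cder_div _ _ _ _ _ H3 H2' N)) as [d4 H4].
eexists. apply cder_mult. 2: exact H4.
apply cder_ext with (fun t => ee (0 + - (1) * t)). intros w. apply (f_equal ee). ring. apply cder_ee_affine.
Qed.

Lemma g_inv_S_plus_4 tau : 0 < Im tau -> g_lower14 (inv_S (tau + 4)) = g_lower14 (inv_S tau).
Proof.
intros H. assert (Hq : 0 < Im (tau / 4)) by (rewrite im_quarter; lra).
rewrite !inv_S_fricke. replace ((tau + 4) / 4) with (tau / 4 + 1) by field.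
rewrite !g_fricke_quot by (trivial; now rewrite im_plus_RtoC). unfold g_half.
replace (tau / 4 + 1 + / 2) with (tau / 4 + / 2 + 1) by ring. now rewrite !g_plus_1 by (trivial; now apply UHP_half).
Qed.

Lemma g_half_inv_S_plus_4 tau : 0 < Im tau -> g_half (inv_S (tau + 4)) = g_half (inv_S tau).
Proof.
intros H. assert (Hq : 0 < Im (tau / 4)) by (rewrite im_quarter; lra).
rewrite !inv_S_fricke. replace ((tau + 4) / 4) with (tau / 4 + 1) by field.
rewrite !g_half_fricke by (trivial; now rewrite im_plus_RtoC). unfold g_half.
replace (tau / 4 + 1 + / 2) with (tau / 4 + / 2 + 1) by ring. now rewrite !g_plus_1 by (trivial; now apply UHP_half).
Qed.

(* [g(tau) + g(tau + 1/2)] has a finite limit [kappa] at infinity and the limit 16 at the two other cusps,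
   so it is constant. *)
Theorem g_jacobi tau : 0 < Im tau -> g_lower14 tau + g_half tau = 16.
Proof.
destruct (is_germ_serA _ subring_any) as [a Ha].
(* At q the function q (g(tau) + g(tau + 1/2)) is serA(q) - serA(-q), because the half shift changes
   the sign of q. It vanishes at q = 0, so the poles cancel, and [kappa] is its linear
   coefficient. *)
assert (Hd := germ_plus _ subring_any _ _ _ _ Ha (germ_mult _ subring_any _ _ _ _ (germ_const _ subring_any (- (1)) I) (germ_scale _ _ _ (- (1)) subring_any I Ha))).
assert (C0 := germ_coef_0 _ _ _ Hd). cbv beta in C0. rewrite Cmult_0_r in C0.
assert (Hu := germ_unshift _ _ _ Hd ltac:(cbv beta; rewrite C0; ring)).
match type of Hu with germ _ _ (fun n => ?c (S n)) => set (kappa := c 1%nat) end.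
assert (T := germ_tends _ _ _ Hu). match type of T with tends_at_infinity _ ?c => change c with kappa in T end.
assert (T0 : tends_at_infinity (fun t => g_lower14 t + g_half t - kappa) 0).
{ apply tends_lim with (kappa - kappa). ring. apply tends_minus; [|apply tends_const].
  apply tends_ext with (2 := T). intros t Ht. destruct (Ceq_dec (ee t) 0) as [E|N]. now apply ee_neq_0 in E.
  rewrite <- g_serA by trivial. replace (- (1) * ee t) with (ee (t + / 2)) by (rewrite ee_plus, ee_half; ring).
  rewrite <- g_serA by now apply UHP_half. rewrite ee_plus, ee_half. unfold g_half. field. trivial. }
assert (T1 : tends_at_infinity (fun t => g_lower14 (inv_S t) + g_half (inv_S t) - kappa) (16 - kappa)).
{ apply tends_minus; [|apply tends_const].
  apply tends_ext with (fun t => - (16) * (g_lower14 (t / 4) / g_half (t / 4)) + 256 * / g_half (t / 4)).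
  - intros t Ht. rewrite inv_S_fricke. assert (0 < Im (t / 4)) by (rewrite im_quarter; lra).
    now rewrite g_fricke_quot, g_half_fricke.
  - apply (tends_quarter (fun t => - (16) * (g_lower14 t / g_half t) + 256 * / g_half t)).
    apply tends_lim with (- (16) * - (1) + 256 * 0). ring.
    apply tends_plus; apply tends_mult; try apply tends_const. apply tends_g_ratio. apply tends_g_half_inv. }
assert (T2 : tends_at_infinity (fun t => g_lower14 (inv_S (inv_S t + 2)) + g_half (inv_S (inv_S t + 2)) - kappa) (16 - kappa)).
{ apply tends_minus; [|apply tends_const].
  apply tends_ext with (fun t => 256 * / g_lower14 t + - (16) * / (g_lower14 t / g_half t)).
  - intros t Ht. now rewrite g_cusp_half, g_half_cusp_half.
  - apply tends_lim with (256 * 0 + - (16) * / - (1)). field.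
    apply tends_plus; apply tends_mult; try apply tends_const. apply tends_g_inv.
    apply tends_inv. 2: apply tends_g_ratio. intros E. apply C1_nz. replace (RtoC 1) with (- - (1)) by ring. rewrite E. ring. }
assert (Z : forall t, 0 < Im t -> g_lower14 t + g_half t - kappa = 0).
{ apply (liouville_Gamma1_4 (fun t => g_lower14 t + g_half t - kappa) _ _ ) with (4 := T0) (5 := T1) (6 := T2).
  - intros t Ht. destruct (holo_g t Ht) as [d1 H1]. 
    destruct (holo_shift _ (/ 2) holo_g t Ht) as [d2 H2]. rewrite RtoC_half in H2.
    eexists. apply cder_minus. apply cder_plus. exact H1. exact H2. apply cder_const.
  - intros t Ht. unfold g_half. replace (t + 1 + / 2) with (t + / 2 + 1) by ring. now rewrite !g_plus_1 by (trivial; now apply UHP_half).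
  - intros t Ht. now rewrite g_inv_S_plus_4, g_half_inv_S_plus_4. }
(* The function is identically zero but tends to 16 - kappa at the cusp 0. *)
assert (K : 16 - kappa = 0).
{ apply Cmod_eq_0, Rle_antisym; [|apply Cmod_ge_0]. apply le_epsilon. intros eps He. rewrite Rplus_0_l.
  destruct (T1 eps He) as [Y HY]. set (Y' := (Rmax 0 Y + 1)%R).
  assert (L1 := Rmax_l 0 Y). assert (L2 := Rmax_r 0 Y).
  specialize (HY (0, Y')). simpl in HY. specialize (HY ltac:(unfold Y'; lra) ltac:(unfold Y'; lra)).
  rewrite Z in HY by (apply im_inv_S; simpl; unfold Y'; lra).
  replace (0 - (16 - kappa)) with (- (16 - kappa)) in HY by ring. rewrite Cmod_opp in HY. lra. }
intros Ht. specialize (Z tau Ht). apply Ceq_minus.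
replace (g_lower14 tau + g_half tau - 16) with ((g_lower14 tau + g_half tau - kappa) - (16 - kappa)) by ring. rewrite Z, K. ring.
Qed.

(** * The Hauptmodul under [SL_2(Z)] *)

Lemma g_half_eq tau : 0 < Im tau -> g_half tau = 16 - g_lower14 tau.
Proof. intros H. rewrite <- (g_jacobi tau H). ring. Qed.

Lemma g_minus_16_neq_0 tau : 0 < Im tau -> g_lower14 tau - 16 <> 0.
Proof.
intros H E. apply (g_half_neq_0 tau H). rewrite (g_half_eq tau H).
replace (16 - g_lower14 tau) with (- (g_lower14 tau - 16)) by ring. rewrite E. ring.
Qed.

(* The action of the Fricke involution on the values of the Hauptmodul. *)
Definition fricke_val (x : C) : C := 16 * x / (x - 16).

Lemma g_fricke_val tau : 0 < Im tau -> g_lower14 (fricke tau) = fricke_val (g_lower14 tau).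
Proof.
intros H. assert (N := g_minus_16_neq_0 tau H). assert (N' := g_half_neq_0 tau H).
rewrite (g_fricke_quot tau H). rewrite (g_half_eq tau H) in *. unfold fricke_val. field. now split.
Qed.

Lemma g_inv_S tau : 0 < Im tau -> g_lower14 (inv_S tau) = fricke_val (g_lower14 (tau / 4)).
Proof. intros H. rewrite inv_S_fricke. apply g_fricke_val. rewrite im_quarter. lra. Qed.

Lemma g_period (k : Z) tau : 0 < Im tau -> g_lower14 (tau + RtoC (IZR k)) = g_lower14 tau.
Proof. intros H. rewrite <- (Cmult_1_r (RtoC (IZR k))). apply (period_Z_UHP g_lower14 1); trivial. exact g_plus_1. Qed.

Lemma C16_neq_0 : RtoC 16 <> 0.
Proof. intros E. apply RtoC_inj in E. lra. Qed.

Lemma fricke_val_involutive (x : C) : x - 16 <> 0 -> fricke_val (fricke_val x) = x.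
Proof.
intros N. assert (N16 := C16_neq_0). unfold fricke_val. field. split; trivial.
replace (16 * x - 16 * (x - 16)) with (RtoC 16 * 16) by ring. now apply Cmult_neq_0.
Qed.

Lemma fricke_val_minus_16 (x : C) : x - 16 <> 0 -> fricke_val x - 16 = 256 * / (x - 16).
Proof. intros N. unfold fricke_val. field. trivial. Qed.

Definition g_quarter (m : Z) (tau : C) : C := g_lower14 ((tau + RtoC (IZR m)) / 4).

Lemma im_g_quarter m tau : 0 < Im tau -> 0 < Im ((tau + RtoC (IZR m)) / 4).
Proof. intros H. rewrite im_quarter, im_plus_RtoC. lra. Qed.

Lemma g_quarter_period m k tau : 0 < Im tau -> g_quarter (m + 4 * k) tau = g_quarter m tau.
Proof.
intros H. unfold g_quarter. rewrite <- (g_period k ((tau + RtoC (IZR m)) / 4)) by now apply im_g_quarter.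
apply (f_equal g_lower14). rewrite plus_IZR, mult_IZR, RtoC_plus, RtoC_mult. field.
Qed.

Lemma g_quarter_mod m n tau : 0 < Im tau -> (exists k, m = n + 4 * k)%Z -> g_quarter m tau = g_quarter n tau.
Proof. intros H [k ->]. now apply g_quarter_period. Qed.

(* [g] on the coset of a matrix with bottom row [(c, d)]. *)
Definition g_coset (c d : Z) (tau : C) : C :=
  if (c mod 4 =? 0)%Z then g_lower14 tau
  else if (c mod 4 =? 2)%Z then 256 * / g_lower14 tau
  else fricke_val (g_quarter (c * d) tau).

Lemma g_coset_0 c d tau : (c mod 4 = 0)%Z -> g_coset c d tau = g_lower14 tau.
Proof. intros E. unfold g_coset. now rewrite E. Qed.
Lemma g_coset_2 c d tau : (c mod 4 = 2)%Z -> g_coset c d tau = 256 * / g_lower14 tau.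
Proof. intros E. unfold g_coset. now rewrite E. Qed.
Lemma g_coset_odd c d tau : (c mod 2 = 1)%Z -> g_coset c d tau = fricke_val (g_quarter (c * d) tau).
Proof.
intros E. unfold g_coset. assert (c mod 4 = 1 \/ c mod 4 = 3)%Z as [X|X]; [|now rewrite X..].
Z.div_mod_to_equations. lia.
Qed.

Lemma mod4_cases c : ((exists k, c = 4 * k) /\ c mod 4 = 0 \/ (exists k, c = 4 * k + 2) /\ c mod 4 = 2 \/ (exists k, c = 2 * k + 1) /\ c mod 2 = 1)%Z.
Proof.
assert (c mod 4 = 0 \/ c mod 4 = 2 \/ c mod 2 = 1)%Z as [X|[X|X]] by (Z.div_mod_to_equations; lia).
- left. split; trivial. exists (c / 4)%Z. Z.div_mod_to_equations; lia.
- right; left. split; trivial. exists (c / 4)%Z. Z.div_mod_to_equations; lia.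
- right; right. split; trivial. exists (c / 2)%Z. Z.div_mod_to_equations; lia.
Qed.

(** For odd c the coset depends on d / c modulo 4, and c is its own inverse there, which is why c d
    occurs in [g_coset]. For c = 2 modulo 4 there is no dependence on d, the cusp having width 1. *)
Lemma g_coset_T c d k tau : 0 < Im tau -> g_coset c d (tau + RtoC (IZR k)) = g_coset c (d + k * c) tau.
Proof.
intros H. destruct (mod4_cases c) as [[_ X]|[[_ X]|[[j Hj] X]]].
- rewrite !g_coset_0 by trivial. now apply g_period.
- rewrite !g_coset_2 by trivial. now rewrite g_period.
- rewrite !g_coset_odd by trivial. f_equal.
  transitivity (g_quarter (c * d + k) tau).
  + unfold g_quarter. rewrite plus_IZR, RtoC_plus. apply (f_equal g_lower14). field.
  + apply g_quarter_mod; trivial. exists (- (k * (j * j + j)))%Z. subst c. ring.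
Qed.

(* For odd [e] with [e = 1] or [e = -1], [(S sigma + e) / 4] is equivalent to [(sigma - e) / 4] under the parabolic
   generator fixing 0. *)
Lemma g_quarter_inv_S_unit e sigma : 0 < Im sigma -> (e = 1 \/ e = -1)%Z -> g_quarter e (inv_S sigma) = g_quarter (- e) sigma.
Proof.
intros H He. set (rho := (sigma + RtoC (IZR (- e))) / 4). assert (Hr : 0 < Im rho) by now apply im_g_quarter.
unfold g_quarter. fold rho.
assert (Es : sigma = 4 * rho + RtoC (IZR e)) by (unfold rho; rewrite opp_IZR, RtoC_opp; field).
assert (Ns := im_pos_neq_0 _ H). assert (Nr := im_pos_neq_0 _ Hr).
assert (Hi := im_inv_S _ Hr).
assert (K : g_lower14 (inv_S (inv_S rho + RtoC (IZR (4 * (- e))))) = g_lower14 (inv_S (inv_S rho))).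
{ apply (F_S_period g_lower14 g_inv_S_plus_4). exact Hi. }
rewrite inv_S_inv_S in K by trivial. rewrite <- K. apply (f_equal g_lower14).
rewrite mult_IZR, opp_IZR, RtoC_mult, RtoC_opp. rewrite Es in Ns |- *.
assert (Em : RtoC (-1) = - RtoC 1) by (now rewrite <- RtoC_opp).
unfold inv_S. destruct He as [-> | ->]; rewrite ?Em in *.
- field. cbv beta. repeat split; trivial. intros E. apply Ns.
  replace (4 * rho + 1) with (- (RtoC (-1) + RtoC (-4) * rho)) by ring. rewrite E. ring.
- field. cbv beta. repeat split; trivial; intros E; apply Ns; rewrite <- E; ring.
Qed.

(** If one of c and d is even, this is the Fricke formula combined with Jacobi's identity for the
    residue 2. If both are odd, the parabolic generator fixing 0 relates the two quarter shifts. *)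
Lemma g_coset_S c d sigma : 0 < Im sigma -> (exists u v, u * c + v * d = 1)%Z ->
  g_coset c d (inv_S sigma) = g_coset d (- c) sigma.
Proof.
intros H (u & v & B). assert (Hi := im_inv_S _ H).
assert (Hq : 0 < Im (sigma / 4)) by (rewrite im_quarter; lra).
assert (Q0 : forall s, g_quarter 0 s = g_lower14 (s / 4)). { intros s. unfold g_quarter. now rewrite Cplus_0_r. }
assert (Q2 : g_quarter 2 sigma = g_half (sigma / 4)).
{ unfold g_quarter, g_half. apply (f_equal g_lower14). field. }
assert (N1 := g_minus_16_neq_0 sigma H). assert (N0 := g_neq_0 sigma H).
assert (M1 := g_minus_16_neq_0 _ Hq). assert (M0 := g_neq_0 _ Hq). assert (N16 := C16_neq_0).
destruct (mod4_cases c) as [[[j Hj] X]|[[[j Hj] X]|[[j Hj] X]]];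
destruct (mod4_cases d) as [[[i Hi'] Y]|[[[i Hi'] Y]|[[i Hi'] Y]]].
(* In these cases c and d are both even, contrary to the Bezout relation. *)
1,2,4,5: exfalso; lia.
- rewrite g_coset_0, g_coset_odd, g_inv_S by trivial. rewrite (g_quarter_mod _ 0), Q0; trivial.
  exists (- (d * j))%Z. subst c. ring.
- rewrite g_coset_2, g_coset_odd, g_inv_S by trivial. rewrite (g_quarter_mod _ 2); trivial.
  2:{ exists (- (2 * i * j + i + j + 1))%Z. subst c d. ring. }
  rewrite Q2, (g_half_eq _ Hq). set (x := g_lower14 (sigma / 4)) in *. unfold fricke_val. field.
  repeat split; trivial. replace (16 - x - 16) with (- x) by ring. intros E. apply M0. replace x with (- - x) by ring. rewrite E. ring.
- rewrite g_coset_odd, g_coset_0 by trivial. rewrite (g_quarter_mod _ 0), Q0; trivial.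
  2:{ exists (c * i)%Z. subst d. ring. }
  replace (inv_S sigma / 4) with (fricke sigma) by (unfold fricke, inv_S; field; now apply im_pos_neq_0).
  rewrite g_fricke_val by trivial. now apply fricke_val_involutive.
- rewrite g_coset_odd, g_coset_2 by trivial. rewrite (g_quarter_mod _ 2); trivial.
  2:{ exists (2 * j * i + i + j)%Z. subst c d. ring. }
  assert (Q3 : g_quarter 2 (inv_S sigma) = g_half (fricke sigma)).
  { unfold g_quarter, g_half. apply (f_equal g_lower14). unfold inv_S, fricke. field. now apply im_pos_neq_0. }
  rewrite Q3, (g_half_eq _ (im_fricke _ H)), g_fricke_val by trivial.
  set (x := g_lower14 sigma) in *. unfold fricke_val. field. repeat split; trivial.
  replace (16 * (x - 16) - 16 * x - 16 * (x - 16)) with (- (16 * x)) by ring.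
  intros E. apply (Cmult_neq_0 _ _ N16 N0). replace (16 * x) with (- - (16 * x)) by ring. rewrite E. ring.
- rewrite !g_coset_odd by trivial. f_equal.
  assert (exists e k, (e = 1 \/ e = -1) /\ c * d = e + 4 * k)%Z as (e & k & He & Hk).
  { assert ((c * d) mod 4 = 1 \/ (c * d) mod 4 = 3)%Z as [Z|Z].
    { assert (O : (c * d = 2 * (2 * j * i + j + i) + 1)%Z) by (subst c d; ring). rewrite O. Z.div_mod_to_equations. lia. }
    - exists 1%Z, ((c * d) / 4)%Z. split. tauto. generalize (Z.div_mod (c * d) 4 ltac:(lia)). lia.
    - exists (-1)%Z, ((c * d) / 4 + 1)%Z. split. tauto. generalize (Z.div_mod (c * d) 4 ltac:(lia)). lia. }
  rewrite (g_quarter_mod (c * d) e) by (trivial; now exists k).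
  rewrite (g_quarter_mod (d * - c) (- e)) by (trivial; exists (- k)%Z; lia).
  now apply g_quarter_inv_S_unit.
Qed.

Lemma UHP_affine (c d : Z) tau : 0 < Im tau -> (c <> 0 \/ d <> 0)%Z -> RtoC (IZR c) * tau + RtoC (IZR d) <> 0.
Proof.
intros H Hcd E. assert (I0 := f_equal Im E). assert (R0 := f_equal Re E).
rewrite im_plus, im_scal_l, im_RtoC in I0. simpl in I0.
assert (c = 0)%Z as ->. { apply eq_IZR. nra. }
rewrite Cmult_0_l, Cplus_0_l in E. apply RtoC_inj in E. apply eq_IZR in E. destruct Hcd; lia.
Qed.

(** On bare integers, without a proof of the determinant, so that the matrix can be changed freely
    along the Euclidean algorithm. *)
Definition moeb (a b c d : Z) (tau : C) : C :=
  (RtoC (IZR a) * tau + RtoC (IZR b)) / (RtoC (IZR c) * tau + RtoC (IZR d)).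

Lemma moeb_T a b c d k tau : moeb a b c d tau = moeb a (b - k * a) c (d - k * c) (tau + RtoC (IZR k)).
Proof. unfold moeb. rewrite !minus_IZR, !mult_IZR, !RtoC_minus, !RtoC_mult. apply f_equal2; ring. Qed.

Lemma moeb_S a b c d tau : 0 < Im tau -> (c <> 0 \/ d <> 0)%Z -> moeb a b c d tau = moeb (- b) a (- d) c (inv_S tau).
Proof.
intros H Hcd. assert (N := im_pos_neq_0 _ H). assert (N1 := UHP_affine c d tau H Hcd).
unfold moeb, inv_S. rewrite !opp_IZR, !RtoC_opp. field. repeat split; trivial.
intros E. apply N1. rewrite <- E. ring.
Qed.

(* Induction along the Euclidean algorithm on the bottom row [(c, d)]. *)
Theorem g_moeb a b c d tau : (a * d - b * c = 1)%Z -> 0 < Im tau -> g_lower14 (moeb a b c d tau) = g_coset c d tau.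
Proof.
remember (Z.to_nat (Z.abs c)) as n eqn:En.
revert a b c d tau En. induction n as [n IH] using lt_wf_ind. intros a b c d tau En D H.
destruct (Z.eq_dec c 0) as [->|Nc].
- rewrite g_coset_0 by reflexivity.
  assert (exists k, moeb a b 0 d tau = tau + RtoC (IZR k)) as [k ->].
  { assert ((a = 1 /\ d = 1) \/ (a = -1 /\ d = -1))%Z as [[-> ->]|[-> ->]].
    { assert (A : (a * d = 1)%Z) by lia. apply Z.eq_mul_1 in A as A'. lia. }
    - exists b. unfold moeb. field.
    - exists (- b)%Z. unfold moeb. rewrite opp_IZR, RtoC_opp, Cmult_0_l, Cplus_0_l.
      replace (RtoC (-1)) with (- RtoC 1) by (now rewrite <- RtoC_opp). field. }
  now apply g_period.
- set (k := (d / c)%Z). set (d' := (d mod c)%Z).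
  assert (Ed : (d' = d - k * c)%Z) by (unfold d', k; rewrite Z.mod_eq by trivial; ring).
  assert (Bd : (Z.abs d' < Z.abs c)%Z) by (unfold d'; apply Z.mod_bound_abs; trivial).
  rewrite (moeb_T a b c d k), <- Ed. set (b' := (b - k * a)%Z). set (s := tau + RtoC (IZR k)).
  assert (Hs : 0 < Im s) by (unfold s; now rewrite im_plus_RtoC).
  rewrite moeb_S by (trivial; now left).
  rewrite (IH (Z.to_nat (Z.abs (- d')))); try reflexivity.
  + rewrite g_coset_S; trivial.
    * rewrite Z.opp_involutive. unfold s. rewrite g_coset_T by trivial. f_equal. lia.
    * exists (- a)%Z, (- b')%Z. unfold b'. rewrite Ed. lia.
  + lia.
  + unfold b'. rewrite Ed. lia.
  + now apply im_inv_S.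
Qed.

(** * Laurent expansions at infinity *)

(* Laurent expansion at infinity, of pole order at most [m], in powers of [ee (c tau)]. *)
Definition laurent_order (k : C -> Prop) (c : R) (m : nat) (f : C -> C) : Prop :=
  exists F, is_germ k F /\ exists Y, forall tau, 0 < Im tau -> Y < Im tau ->
    ee (RtoC c * tau) ^ m * f tau = F (ee (RtoC c * tau)).
Definition laurent k c f := exists m, laurent_order k c m f.

Lemma laurent_ext k c f g : (forall tau, 0 < Im tau -> f tau = g tau) -> laurent k c f -> laurent k c g.
Proof. intros E (m & F & HF & Y & H). exists m, F. split; trivial. exists Y. intros tau H1 H2. rewrite <- E by trivial. now apply H. Qed.

Section LaurentRing.
Variable k : C -> Prop.
Hypothesis Hk : subring k.
Variable c : R.

Lemma is_germ_const x : k x -> is_germ k (fun _ => x).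
Proof. intros H. eexists. apply germ_const; eassumption. Qed.
Lemma is_germ_id : is_germ k (fun x => x).
Proof.
destruct (is_germ_const 1) as [a Ha]. apply Hk. eexists. apply germ_ext with (fun x => x * 1). intros; ring.
apply germ_X; trivial. exact Ha.
Qed.
Lemma is_germ_mult F G : is_germ k F -> is_germ k G -> is_germ k (fun x => F x * G x).
Proof. intros [a Ha] [b Hb]. eexists. apply germ_mult; eassumption. Qed.
Lemma is_germ_plus F G : is_germ k F -> is_germ k G -> is_germ k (fun x => F x + G x).
Proof. intros [a Ha] [b Hb]. eexists. apply germ_plus; eassumption. Qed.

Lemma laurent_const x : k x -> laurent k c (fun _ => x).
Proof. intros H. exists 0%nat, (fun _ => x). split. now apply is_germ_const. exists 0%R. intros. simpl. ring. Qed.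

Lemma laurent_plus f g : laurent k c f -> laurent k c g -> laurent k c (fun t => f t + g t).
Proof.
intros (m & F & HF & Y & Hf) (n & G & HG & Y' & Hg).
exists (m + n)%nat, (fun x => x ^ n * F x + x ^ m * G x). split.
- apply is_germ_plus; apply is_germ_mult; trivial; apply is_germ_pow; trivial; apply is_germ_id.
- exists (Rmax Y Y'). intros t Ht HM.
  rewrite <- Hf, <- Hg; trivial. rewrite Cpow_add_r. ring. eapply Rle_lt_trans; [apply Rmax_r|apply HM]. eapply Rle_lt_trans; [apply Rmax_l|apply HM].
Qed.

Lemma laurent_mult f g : laurent k c f -> laurent k c g -> laurent k c (fun t => f t * g t).
Proof.
intros (m & F & HF & Y & Hf) (n & G & HG & Y' & Hg).
exists (m + n)%nat, (fun x => F x * G x). split. now apply is_germ_mult.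
exists (Rmax Y Y'). intros t Ht HM.
rewrite <- Hf, <- Hg; trivial. rewrite Cpow_add_r. ring. eapply Rle_lt_trans; [apply Rmax_r|apply HM]. eapply Rle_lt_trans; [apply Rmax_l|apply HM].
Qed.

Lemma laurent_pow f n : laurent k c f -> laurent k c (fun t => f t ^ n).
Proof.
intros H. induction n as [|n IH]; simpl. apply laurent_const. apply Hk. now apply laurent_mult.
Qed.
End LaurentRing.

Lemma im_scaled c tau : Im (RtoC c * tau) = (c * Im tau)%R.
Proof. apply im_scal_l. Qed.

Lemma laurent_order_fourier k (h : positive) m f : laurent_order k (/ IZR (Zpos h)) m f ->
  exists a, (forall n, k (a n)) /\ fourier_expansion h f m a.
Proof.
intros (F & (a & Ha & r & Hr & Hc) & Y & H). exists a. split; trivial.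
destruct (ee_small r Hr) as [Y' HY]. assert (Ph : 0 < IZR (Zpos h)) by (apply IZR_lt; lia).
exists (Rmax Y (IZR (Zpos h) * Y')). intros tau Ht HM. cbv zeta. rewrite qpow_ee.
apply cps_is_pseries. rewrite H; trivial. 2: eapply Rle_lt_trans; [apply Rmax_l|apply HM].
apply Hc. apply HY. rewrite im_scaled. apply Rmult_lt_reg_l with (IZR (Zpos h)); trivial.
rewrite <- Rmult_assoc, Rinv_r, Rmult_1_l by lra. eapply Rle_lt_trans; [apply Rmax_r|apply HM].
Qed.

Lemma cps_converges a (x0 x : C) M : x0 <> 0 -> (forall n, Cmod (a n) * Cmod x0 ^ n <= M) -> Cmod x < Cmod x0 -> exists l, cps a x l.
Proof.
intros H0 HM Hx. assert (P := proj1 (Cmod_gt_0 x0) H0).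
assert (PM : 0 <= M). { eapply Rle_trans. 2: apply (HM 0%nat). simpl. generalize (Cmod_ge_0 (a 0%nat)). lra. }
set (s := (Cmod x / Cmod x0)%R).
assert (Hs : 0 <= s < 1).
{ unfold s. split. apply Rmult_le_pos. apply Cmod_ge_0. left. now apply Rinv_0_lt_compat.
  apply Rmult_lt_reg_r with (Cmod x0); trivial. unfold Rdiv. rewrite Rmult_assoc, Rinv_l by lra. lra. }
apply Ccv_cauchy. intros eps He.
destruct (pow_tends_0 s Hs (eps * (1 - s) / (M + 1))%R) as [N HN]. { apply Rdiv_lt_0_compat; [|lra]. apply Rmult_lt_0_compat; lra. }
assert (K : forall n m, (N <= n)%nat -> (n <= m)%nat -> Cmod (Csum (fun n => a n * x ^ n) m - Csum (fun n => a n * x ^ n) n) < eps).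
{ intros n m Hn Hm. eapply Rle_lt_trans. apply (sum_geometric_tail _ M s n PM Hs (ratio_bound a x0 x M H0 HM) m Hm).
  assert (A : 0 <= M * s ^ S m / (1 - s)). { apply Rmult_le_pos. apply Rmult_le_pos; trivial. apply pow_le. lra. left. apply Rinv_0_lt_compat. lra. }
  specialize (HN (S n) ltac:(lia)). apply Rle_lt_trans with (M * s ^ S n / (1 - s))%R. lra.
  apply Rmult_lt_reg_r with (1 - s)%R. lra. unfold Rdiv. rewrite Rmult_assoc, Rinv_l, Rmult_1_r by lra.
  apply Rle_lt_trans with ((M + 1) * s ^ S n)%R. { apply Rmult_le_compat_r. apply pow_le; lra. lra. }
  apply Rmult_lt_compat_l with (r := (M + 1)%R) in HN; [|lra].
  replace ((M + 1) * (eps * (1 - s) / (M + 1)))%R with (eps * (1 - s))%R in HN by (field; lra). exact HN. }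
exists N. intros n m Hn Hm. destruct (le_ge_dec m n). now apply K. rewrite Cmod_minus_sym. now apply K.
Qed.

Lemma fourier_laurent_order k (h : positive) m f a : (forall n, k (a n)) -> fourier_expansion h f m a ->
  laurent_order k (/ IZR (Zpos h)) m f.
Proof.
intros Ha [Y H]. assert (Ph : 0 < IZR (Zpos h)) by (apply IZR_lt; lia).
assert (H' : forall tau, 0 < Im tau -> Y < Im tau -> cps a (ee (RtoC (/ IZR (Zpos h)) * tau)) (ee (RtoC (/ IZR (Zpos h)) * tau) ^ m * f tau)).
{ intros tau H1 H2. apply cps_is_pseries. specialize (H tau H1 H2). cbv zeta in H. now rewrite qpow_ee in H. }
set (t0 := (0, Rmax 0 Y + 1)%R : C). assert (L1 := Rmax_l 0 Y). assert (L2 := Rmax_r 0 Y).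
set (x0 := ee (RtoC (/ IZR (Zpos h)) * t0)). assert (N0 : x0 <> 0) by apply ee_neq_0.
destruct (cps_terms_bounded a x0 _ (H' t0 ltac:(simpl; lra) ltac:(simpl; lra))) as (M & PM & HM).
(* The expansion only speaks of points of the form e(tau / h). Choosing the sum wherever the series
   converges gives a function on a full disc, including 0, without a logarithm. *)
set (F := fun x => epsilon (inhabits (RtoC 0)) (fun l => cps a x l)).
assert (HF : forall x l, cps a x l -> cps a x (F x)).
{ intros x l Hl. unfold F. apply epsilon_spec. now exists l. }
exists F. split.
- exists a. split; trivial. exists (Cmod x0). split. now apply Cmod_gt_0. intros x Hx.
  destruct (cps_converges a x0 x M N0 HM Hx) as [l Hl]. now apply HF with l.
- exists Y. intros tau H1 H2. assert (X := H' tau H1 H2). eapply cps_unique. exact X. eapply HF, X.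
Qed.

Lemma laurent_tends k c f : 0 < c -> laurent k c f -> exists m, tends_at_infinity (fun t => ee (RtoC c * t) ^ m * f t) 0.
Proof.
intros Hc (m & F & (a & Ha) & Y & H). exists (S m).
assert (T := germ_tends _ _ _ Ha).
assert (S1 : forall g l, tends_at_infinity g l -> tends_at_infinity (fun t => g (RtoC c * t)) l).
{ intros g l Hg eps He. destruct (Hg eps He) as [Y1 HY]. exists (Y1 / c)%R. intros t Ht HM. apply HY. now apply im_scal_pos.
  rewrite im_scaled. apply Rmult_lt_compat_l with (r := c) in HM; trivial. replace (c * (Y1 / c))%R with Y1 in HM by (field; lra). exact HM. }
assert (T2 : tends_at_infinity (fun t => ee (RtoC c * t) * F (ee (RtoC c * t))) 0).
{ apply tends_lim with (0 * a 0%nat). ring. apply tends_mult. apply (S1 ee), tends_ee. apply (S1 (fun t => F (ee t)) _ T). }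
intros eps He. destruct (T2 eps He) as [Y2 HY2]. exists (Rmax Y Y2). intros t Ht HM.
rewrite Cpow_S, <- Cmult_assoc, H; trivial. apply HY2; trivial. eapply Rle_lt_trans; [apply Rmax_r|apply HM]. eapply Rle_lt_trans; [apply Rmax_l|apply HM].
Qed.

Lemma laurent_g k : subring k -> laurent k 1 g_lower14.
Proof.
intros Hk. exists 1%nat, serA. split. now apply is_germ_serA. exists 0%R. intros tau Ht _.
rewrite Cmult_1_l, Cpow_1_r. now apply g_serA.
Qed.
Lemma laurent_g_inv k : subring k -> laurent k 1 (fun t => / g_lower14 t).
Proof.
intros Hk. exists 0%nat, (fun x => x * serB x). split. apply is_germ_mult; trivial. now apply is_germ_id. now apply is_germ_serB.
exists 0%R. intros tau Ht _. cbn [Cpow]. cbv beta. rewrite !Cmult_1_l, g_inv_serB by trivial. ring.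
Qed.

Lemma g_minus_16_inv tau : 0 < Im tau -> / (g_lower14 tau - 16) = ee tau * serB (- (1) * ee tau).
Proof.
intros Ht. assert (N := g_minus_16_neq_0 tau Ht).
assert (E := g_inv_serB _ (UHP_half tau Ht)). fold (g_half tau) in E. rewrite (g_half_eq tau Ht), ee_plus, ee_half in E.
replace (ee tau * - (1)) with (- (1) * ee tau) in E by ring.
replace (/ (g_lower14 tau - 16)) with (- / (16 - g_lower14 tau)). rewrite E. ring.
field. split; trivial. intros Z. apply N. replace (g_lower14 tau - 16) with (- (16 - g_lower14 tau)) by ring. rewrite Z. ring.
Qed.

Lemma laurent_g_16_inv k : subring k -> laurent k 1 (fun t => / (g_lower14 t - 16)).
Proof.
intros Hk. exists 0%nat, (fun x => x * serB (- (1) * x)). split.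
- apply is_germ_mult; trivial. now apply is_germ_id. destruct (is_germ_serB k Hk) as [a Ha]. eexists. apply germ_scale; trivial. now apply coeff_m1. exact Ha.
- exists 0%R. intros tau Ht _. cbn [Cpow]. cbv beta. rewrite !Cmult_1_l, g_minus_16_inv by trivial. ring.
Qed.

Definition spread4 (a : nat -> C) (n : nat) : C := if Nat.eqb (n mod 4) 0 then a (n / 4)%nat else 0.

Lemma Csum_spread4 a x n : Csum (fun i => spread4 a i * x ^ i) n = Csum (fun i => a i * (x ^ 4) ^ i) (n / 4).
Proof.
induction n as [|n IH]. simpl. unfold spread4. simpl. ring.
cbn [Csum]. rewrite IH. unfold spread4.
assert (D1 := Nat.div_mod n 4 ltac:(lia)). assert (D2 := Nat.div_mod (S n) 4 ltac:(lia)).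
assert (U1 := Nat.mod_upper_bound n 4 ltac:(lia)). assert (U2 := Nat.mod_upper_bound (S n) 4 ltac:(lia)).
destruct (Nat.eqb (S n mod 4) 0) eqn:E.
- apply Nat.eqb_eq in E. assert (Q : (S n / 4 = S (n / 4))%nat) by (lia). rewrite Q. cbn [Csum].
  rewrite <- Cpow_mult_r. replace (4 * S (n / 4))%nat with (S n). reflexivity. lia.
- apply Nat.eqb_neq in E. assert (Q : (S n / 4 = n / 4)%nat) by (lia). rewrite Q. ring.
Qed.

Lemma is_germ_pow4 k F : subring k -> is_germ k F -> is_germ k (fun x => F (x ^ 4)).
Proof.
intros Hk (a & Ha & r & Hr & H). exists (spread4 a). split.
- intros n. unfold spread4. destruct Nat.eqb; trivial. now apply k_0.
- exists (Rmin 1 r). split. apply Rmin_glb_lt; lra. intros x Hx.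
  assert (x1 : Cmod x < 1) by (eapply Rlt_le_trans; [apply Hx|apply Rmin_l]). assert (xr : Cmod x < r) by (eapply Rlt_le_trans; [apply Hx|apply Rmin_r]).
  assert (X : Cmod (x ^ 4) < r).
  { rewrite Cmod_pow. assert (P := Cmod_ge_0 x). apply Rle_lt_trans with (Cmod x); trivial.
    replace (Cmod x ^ 4)%R with (Cmod x * Cmod x ^ 3)%R by ring. rewrite <- (Rmult_1_r (Cmod x)) at 3. apply Rmult_le_compat_l; trivial.
    rewrite <- (pow1 3). apply pow_incr. lra. }
  intros eps He. destruct (H _ X eps He) as [N HN]. exists (4 * N)%nat. intros n Hn. rewrite Csum_spread4. apply HN.
  apply Nat.div_le_lower_bound; lia.
Qed.

Lemma laurent_1_quarter k f : subring k -> laurent k 1 f -> laurent k (/ 4) f.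
Proof.
intros Hk (m & F & HF & Y & H). exists (4 * m)%nat, (fun x => F (x ^ 4)). split. now apply is_germ_pow4.
exists Y. intros t Ht HM. specialize (H t Ht HM). rewrite Cmult_1_l in H.
assert (E : ee (RtoC (/ 4) * t) ^ 4 = ee t).
{ rewrite ee_pow. apply (f_equal ee). rewrite RtoC_quarter. simpl INR. replace (RtoC (1 + 1 + 1 + 1)) with (RtoC 4) by (apply (f_equal RtoC); ring). field. }
rewrite Cpow_mult_r, E. exact H.
Qed.

Lemma laurent_quarter k f : laurent k 1 f -> laurent k (/ 4) (fun t => f (t / 4)).
Proof.
intros (m & F & HF & Y & H). exists m, F. split; trivial. exists (4 * Y)%R. intros t Ht HM.
replace (RtoC (/ 4) * t) with (RtoC 1 * (t / 4)) by (rewrite RtoC_quarter; field). apply H; rewrite im_quarter; lra.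
Qed.

(** The substitution multiplies q^(1/4) by the constant e(j/4), which need not be rational, hence
    arbitrary coefficients. *)
Lemma laurent_g_quarter f j : laurent coeff_any 1 f -> laurent coeff_any (/ 4) (fun t => f ((t + RtoC j) / 4)).
Proof.
intros (m & F & [a Ha] & Y & H).
set (z := ee (RtoC j / 4)). assert (Nz : z <> 0) by apply ee_neq_0.
exists m, (fun x => / z ^ m * F (z * x)). split.
- apply is_germ_mult. apply subring_any. now apply is_germ_const. eexists. apply germ_scale. apply subring_any. exact I. exact Ha.
- exists (4 * Y)%R. intros t Ht HM.
  assert (E : ee (RtoC 1 * ((t + RtoC j) / 4)) = z * ee (RtoC (/ 4) * t)).
  { unfold z. rewrite <- ee_plus. apply (f_equal ee). rewrite RtoC_quarter. field. }
  rewrite <- E, <- H by (rewrite im_quarter, im_plus_RtoC; lra). rewrite E, Cpow_mult_l. field. now apply Cpow_nz.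
Qed.

Definition gen_fun (i : nat) (x : C) : C :=
  match i with 0%nat => x | 1%nat => / x | _ => / (x - 16) end.

(** The maps x -> 256 / x and [fricke_val] permute 0, 16 and infinity. They therefore send x, 1/x
    and 1/(x - 16) to polynomials in these three functions, and the three expansions can be
    transported together to every coset. *)
Definition laurent_gens k c (x : C -> C) : Prop := forall i, laurent k c (fun t => gen_fun i (x t)).

Lemma laurent_gens_g k : subring k -> laurent_gens k 1 g_lower14.
Proof. intros Hk [|[|i]]; simpl. now apply laurent_g. now apply laurent_g_inv. now apply laurent_g_16_inv. Qed.

Lemma laurent_gens_ext k c (x y : C -> C) : (forall t, 0 < Im t -> x t = y t) -> laurent_gens k c x -> laurent_gens k c y.
Proof. intros E H i. apply laurent_ext with (2 := H i). intros t Ht. now rewrite E. Qed.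

Lemma laurent_gens_inv c (x : C -> C) : (forall t, 0 < Im t -> x t <> 0) -> (forall t, 0 < Im t -> x t - 16 <> 0) ->
  laurent_gens coeff_any c x -> laurent_gens coeff_any c (fun t => 256 * / x t).
Proof.
intros N0 N16 H. assert (Hk := subring_any). assert (K : forall z, coeff_any z) by (intros; exact I).
assert (E16 := C16_neq_0). assert (E256 : RtoC 256 <> 0) by (intros E; apply RtoC_inj in E; lra).
intros [|[|i]]; simpl.
- apply laurent_mult; trivial. now apply laurent_const. exact (H 1%nat).
- apply laurent_ext with (fun t => / 256 * x t). intros t Ht. specialize (N0 t Ht). field; try split; trivial.
  apply laurent_mult; trivial. now apply laurent_const. exact (H 0%nat).
- apply laurent_ext with (fun t => - / 16 * (1 + 16 * / (x t - 16))).
  + intros t Ht. specialize (N0 t Ht). specialize (N16 t Ht). field. repeat split; trivial.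
    intros E. apply (Cmult_neq_0 _ _ E16 N16). replace (16 * (x t - 16)) with (- (256 - 16 * x t)) by ring. rewrite E. ring.
  + apply laurent_mult; trivial. now apply laurent_const. apply laurent_plus; trivial. now apply laurent_const.
    apply laurent_mult; trivial. now apply laurent_const. exact (H 2%nat).
Qed.

Lemma laurent_gens_fricke c (x : C -> C) : (forall t, 0 < Im t -> x t <> 0) -> (forall t, 0 < Im t -> x t - 16 <> 0) ->
  laurent_gens coeff_any c x -> laurent_gens coeff_any c (fun t => fricke_val (x t)).
Proof.
intros N0 N16 H. assert (Hk := subring_any). assert (K : forall z, coeff_any z) by (intros; exact I).
assert (E16 := C16_neq_0). assert (E256 : RtoC 256 <> 0) by (intros E; apply RtoC_inj in E; lra).
intros [|[|i]]; simpl.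
- apply laurent_ext with (fun t => 16 * (1 + 16 * / (x t - 16))).
  + intros t Ht. specialize (N16 t Ht). unfold fricke_val. field. trivial.
  + apply laurent_mult; trivial. now apply laurent_const. apply laurent_plus; trivial. now apply laurent_const.
    apply laurent_mult; trivial. now apply laurent_const. exact (H 2%nat).
- apply laurent_ext with (fun t => / 16 + - (1) * / x t).
  + intros t Ht. specialize (N16 t Ht). specialize (N0 t Ht). unfold fricke_val. field. repeat split; trivial.
  + apply laurent_plus; trivial. now apply laurent_const. apply laurent_mult; trivial. now apply laurent_const. exact (H 1%nat).
- apply laurent_ext with (fun t => / 256 * (x t + - (16))).
  + intros t Ht. specialize (N16 t Ht). rewrite fricke_val_minus_16 by trivial. field. trivial.
  + apply laurent_mult; trivial. now apply laurent_const. apply laurent_plus; trivial. exact (H 0%nat). now apply laurent_const.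
Qed.

Lemma laurent_gens_coset a b : laurent_gens coeff_any (/ 4) (g_coset a b).
Proof.
destruct (mod4_cases a) as [[_ X]|[[_ X]|[_ X]]].
- apply laurent_gens_ext with g_lower14. intros; symmetry; now apply g_coset_0.
  intros i. apply laurent_1_quarter. apply subring_any. now apply laurent_gens_g, subring_any.
- apply laurent_gens_ext with (fun t => 256 * / g_lower14 t). intros; symmetry; now apply g_coset_2.
  apply laurent_gens_inv. exact g_neq_0. exact g_minus_16_neq_0.
  intros i. apply laurent_1_quarter. apply subring_any. now apply laurent_gens_g, subring_any.
- apply laurent_gens_ext with (fun t => fricke_val (g_quarter (a * b) t)). intros; symmetry; now apply g_coset_odd.
  apply laurent_gens_fricke.
  + intros t Ht. apply g_neq_0. now apply im_g_quarter.
  + intros t Ht. apply g_minus_16_neq_0. now apply im_g_quarter.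
  + intros i. apply (laurent_g_quarter (fun t => gen_fun i (g_lower14 t))). now apply laurent_gens_g, subring_any.
Qed.

Lemma g_coset_neq_0 a b t : 0 < Im t -> g_coset a b t <> 0 /\ g_coset a b t - 16 <> 0.
Proof.
assert (E16 := C16_neq_0). assert (E256 : RtoC 256 <> 0) by (intros E; apply RtoC_inj in E; lra).
intros Ht. assert (N0 := g_neq_0 t Ht). assert (N16 := g_minus_16_neq_0 t Ht).
destruct (mod4_cases a) as [[_ X]|[[_ X]|[_ X]]].
- rewrite g_coset_0 by trivial. now split.
- rewrite g_coset_2 by trivial. set (x := g_lower14 t) in *. split.
  + intros E. apply E256. replace (RtoC 256) with (256 * / x * x) by (field; trivial). rewrite E. ring.
  + intros E. apply (Cmult_neq_0 _ _ E16 N16). replace (16 * (x - 16)) with (- ((256 * / x - 16) * x)) by (field; trivial). rewrite E. ring.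
- rewrite g_coset_odd by trivial. assert (M0 := g_neq_0 _ (im_g_quarter (a * b) t Ht)). assert (M16 := g_minus_16_neq_0 _ (im_g_quarter (a * b) t Ht)).
  fold (g_quarter (a * b) t) in M0, M16. set (x := g_quarter (a * b) t) in *. split.
  + unfold fricke_val. intros E. apply (Cmult_neq_0 _ _ E16 M0). replace (16 * x) with (16 * x / (x - 16) * (x - 16)) by (field; trivial). rewrite E. ring.
  + rewrite fricke_val_minus_16 by trivial. intros E. apply E256. replace (RtoC 256) with (256 * / (x - 16) * (x - 16)) by (field; trivial). rewrite E. ring.
Qed.

(** * From growth at the cusps to membership in the ring *)

Definition gens_of (x : C -> C) : list (C -> C) :=
  x :: (fun tau => / x tau) :: (fun tau => / (x tau - 16)) :: nil.

Lemma tends_pow f l n : tends_at_infinity f l -> tends_at_infinity (fun t => f t ^ n) (l ^ n).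
Proof. intros H. induction n as [|n IH]; simpl. apply tends_const. now apply tends_mult. Qed.

Lemma holo_const c : holo (fun _ => c).
Proof. intros t _. eexists. apply cder_const. Qed.
Lemma holo_plus f h : holo f -> holo h -> holo (fun t => f t + h t).
Proof. intros H1 H2 t Ht. destruct (H1 t Ht) as [a Ha]. destruct (H2 t Ht) as [b Hb]. eexists. apply cder_plus; eassumption. Qed.
Lemma holo_mult f h : holo f -> holo h -> holo (fun t => f t * h t).
Proof. intros H1 H2 t Ht. destruct (H1 t Ht) as [a Ha]. destruct (H2 t Ht) as [b Hb]. eexists. apply cder_mult; eassumption. Qed.
Lemma holo_pow f n : holo f -> holo (fun t => f t ^ n).
Proof. intros H. induction n as [|n IH]; simpl. apply holo_const. now apply holo_mult. Qed.
Lemma holo_inv f : holo f -> (forall t, 0 < Im t -> f t <> 0) -> holo (fun t => / f t).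
Proof. intros H N t Ht. destruct (H t Ht) as [a Ha]. eexists. apply (cder_comp (fun w => / w) f). apply cder_inv. now apply N. exact Ha. Qed.

Lemma Q_adjoin_pow gens f n : Q_adjoin gens f -> Q_adjoin gens (fun t => f t ^ n).
Proof.
intros H. induction n as [|n IH]; simpl.
- apply Q_adjoin_eq with (fun _ => RtoC (Q2R 1)). apply Q_adjoin_const. intros. now rewrite RMicromega.Q2R_1.
- now apply Q_adjoin_mul.
Qed.

(* A pole of order [m] at infinity is removed by subtracting a rational multiple of [g^m]. *)
Lemma Q_adjoin_pole_at_infinity m : forall (F : C -> C), holo F ->
  (forall tau, 0 < Im tau -> F (tau + 1) = F tau) ->
  (forall tau, 0 < Im tau -> F (inv_S (tau + 4)) = F (inv_S tau)) ->
  (exists l1, tends_at_infinity (fun t => F (inv_S t)) l1) ->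
  (exists l2, tends_at_infinity (fun t => F (inv_S (inv_S t + 2))) l2) ->
  laurent_order coeff_rat 1 m F -> Q_adjoin (gens_of g_lower14) F.
Proof.
induction m as [|m IH]; intros F HF F1 F4 [l1 L1] [l2 L2] (Fh & [a Ha] & Y & HY).
- destruct (proj1 Ha 0%nat) as [r Hr].
  assert (Z : forall t, 0 < Im t -> F t - RtoC (Q2R r) = 0).
  { apply (liouville_Gamma1_4 (fun t => F t - RtoC (Q2R r)) (l1 - RtoC (Q2R r)) (l2 - RtoC (Q2R r))).
    - apply holo_plus; trivial. apply holo_const.
    - intros t Ht. now rewrite F1.
    - intros t Ht. now rewrite F4.
    - apply tends_lim with (a 0%nat - RtoC (Q2R r)). rewrite Hr. ring. apply tends_minus. 2: apply tends_const.
      assert (T := germ_tends _ _ _ Ha). intros eps He. destruct (T eps He) as [Y' HY']. exists (Rmax Y Y'). intros t Ht HM.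
      specialize (HY t Ht ltac:(eapply Rle_lt_trans; [apply Rmax_l|apply HM])). cbn [Cpow] in HY. rewrite !Cmult_1_l in HY.
      rewrite HY. apply HY'; trivial. eapply Rle_lt_trans; [apply Rmax_r|apply HM].
    - apply tends_minus; trivial. apply tends_const.
    - apply tends_minus; trivial. apply tends_const. }
  apply Q_adjoin_eq with (fun _ => RtoC (Q2R r)). apply Q_adjoin_const. intros t Ht. symmetry. apply Ceq_minus. now apply Z.
- destruct (proj1 Ha 0%nat) as [r Hr].
  destruct (is_germ_pow _ subring_rat serA (S m) (is_germ_serA _ subring_rat)) as [b Hb].
  assert (kr : coeff_rat (- RtoC (Q2R r))) by (exists (- r)%Q; now rewrite Q2R_opp, RtoC_opp).
  (* With r the leading coefficient of F, the germ of q^(m+1) (F - r g^(m+1)) has constant term r -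
     r = 0, since serA(0) = 1. Dividing it by q lowers the pole order to m. *)
  assert (Hd := germ_plus _ subring_rat _ _ _ _ Ha (germ_mult _ subring_rat _ _ _ _ (germ_const _ subring_rat _ kr) Hb)).
  assert (C0 := germ_coef_0 _ _ _ Hd). cbv beta in C0. rewrite serA_0, Cpow_1_l, <- (germ_coef_0 _ _ _ Ha), Hr in C0.
  assert (Hu := germ_unshift _ _ _ Hd ltac:(cbv beta; rewrite Hr, C0; ring)).
  set (F' := fun t => F t + - RtoC (Q2R r) * g_lower14 t ^ S m).
  assert (QF' : Q_adjoin (gens_of g_lower14) F').
  { apply IH.
    - apply holo_plus; trivial. apply holo_mult. apply holo_const. apply holo_pow. apply holo_g.
    - intros t Ht. unfold F'. now rewrite F1, g_plus_1.
    - intros t Ht. unfold F'. now rewrite F4, g_inv_S_plus_4.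
    - eexists. unfold F'. apply tends_plus. exact L1. apply tends_mult. apply tends_const. apply tends_pow.
      apply tends_ext with (fun t => - (16) * (g_lower14 (t / 4) / g_half (t / 4))).
      { intros t Ht. rewrite inv_S_fricke. rewrite g_fricke_quot; trivial. rewrite im_quarter. lra. }
      apply (tends_quarter (fun t => - (16) * (g_lower14 t / g_half t))). apply tends_mult. apply tends_const. apply tends_g_ratio.
    - eexists. unfold F'. apply tends_plus. exact L2. apply tends_mult. apply tends_const. apply tends_pow.
      apply tends_ext with (fun t => 256 * / g_lower14 t).
      { intros t Ht. now rewrite g_cusp_half. }
      apply tends_mult. apply tends_const. apply tends_g_inv.
    - eexists. split. eexists. exact Hu. exists Y. intros t Ht HM. specialize (HY t Ht HM). cbv beta. rewrite !Cmult_1_l in HY |- *.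
      destruct (Ceq_dec (ee t) 0) as [E|N]. now apply ee_neq_0 in E.
      rewrite <- HY. rewrite <- g_serA by trivial. unfold F'. rewrite Cpow_mult_l. simpl Cpow. field. trivial. }
  apply Q_adjoin_eq with (fun t => F' t + RtoC (Q2R r) * g_lower14 t ^ S m).
  + apply Q_adjoin_add; trivial. apply Q_adjoin_mul. apply Q_adjoin_const. apply Q_adjoin_pow. apply Q_adjoin_gen. now left.
  + intros t _. unfold F'. ring.
Qed.

Definition q4 (t : C) : C := ee (RtoC (/ 4) * t).

Lemma tends_q4 : tends_at_infinity q4 0.
Proof.
apply tends_ext with (fun t => ee (t / 4)). intros t _. unfold q4. rewrite RtoC_quarter. apply (f_equal ee). field.
apply (tends_quarter ee). apply tends_ee.
Qed.

Lemma q4_pow4 t : q4 t ^ 4 = ee t.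
Proof.
unfold q4. rewrite ee_pow. apply (f_equal ee). rewrite RtoC_quarter. simpl INR.
replace (RtoC (1 + 1 + 1 + 1)) with (RtoC 4) by (apply (f_equal RtoC); ring). field.
Qed.

Lemma tends_q4_pow_more f m M : (m <= M)%nat -> tends_at_infinity (fun t => q4 t ^ m * f t) 0 -> tends_at_infinity (fun t => q4 t ^ M * f t) 0.
Proof.
intros Hm H. apply tends_ext with (fun t => q4 t ^ (M - m) * (q4 t ^ m * f t)).
- intros t _. replace M with ((M - m) + m)%nat at 2 by lia. rewrite Cpow_add_r. ring.
- apply tends_lim with (0 ^ (M - m) * 0). ring. apply tends_mult; trivial. apply tends_pow. apply tends_q4.
Qed.

(* Multiplication by a power of [g (g - 16)] makes [F] vanish at the two cusps other than infinity. *)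
Theorem Q_adjoin_of_moderate_growth (F : C -> C) : holo F ->
  (forall tau, 0 < Im tau -> F (tau + 1) = F tau) ->
  (forall tau, 0 < Im tau -> F (inv_S (tau + 4)) = F (inv_S tau)) ->
  (exists m, tends_at_infinity (fun t => q4 t ^ m * F (inv_S t)) 0) ->
  (exists m, tends_at_infinity (fun t => q4 t ^ m * F (inv_S (inv_S t + 2))) 0) ->
  laurent coeff_rat 1 F -> Q_adjoin (gens_of g_lower14) F.
Proof.
intros HF F1 F4 [m1 T1] [m2 T2] HL. set (M := Nat.max m1 m2).
apply tends_q4_pow_more with (M := M) in T1; [|lia]. apply tends_q4_pow_more with (M := M) in T2; [|lia].
set (G := fun t => F t * (g_lower14 t ^ M * (g_lower14 t + - (16)) ^ M)).
(* At the cusp 0 the function [g - 16] vanishes to first order in q^(1/4), so its M-th power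
   compensates the growth of F there. *)
assert (HS : forall t, 0 < Im t -> g_lower14 (inv_S t) + - (16) = q4 t * (256 * serB (- (1) * q4 t))).
{ intros t Ht. rewrite g_inv_S by trivial. assert (Hq : 0 < Im (t / 4)) by (rewrite im_quarter; lra).
  change (fricke_val (g_lower14 (t / 4)) - 16 = q4 t * (256 * serB (- (1) * q4 t))).
  rewrite fricke_val_minus_16 by now apply g_minus_16_neq_0. rewrite g_minus_16_inv by trivial.
  replace (q4 t) with (ee (t / 4)). ring. unfold q4. apply (f_equal ee). rewrite RtoC_quarter. field. }
destruct (is_germ_serB _ subring_any) as [b Hb].
assert (TB : tends_at_infinity (fun t => 256 * serB (- (1) * q4 t)) 256).
{ assert (Hs := germ_scale _ _ _ (- (1)) subring_any I Hb). assert (T := germ_tends _ _ _ Hs). cbv beta in T.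
  apply tends_lim with (256 * 1). ring. apply tends_mult. apply tends_const.
  apply tends_lim with (b 0%nat * (- (1)) ^ 0). rewrite (germ_coef_0 _ _ _ Hb), serB_0. simpl. ring.
  apply tends_ext with (fun t => serB (- (1) * ee (t / 4))).
  { intros t _. unfold q4. rewrite RtoC_quarter. replace (/ 4 * t) with (t / 4) by field. reflexivity. }
  apply (tends_quarter (fun t => serB (- (1) * ee t))). exact T. }
assert (TS : tends_at_infinity (fun t => g_lower14 (inv_S t)) 16).
{ apply tends_lim with (0 * 256 + 16). ring. apply tends_ext with (fun t => q4 t * (256 * serB (- (1) * q4 t)) + 16).
  intros t Ht. rewrite <- HS by trivial. ring. apply tends_plus. apply tends_mult. apply tends_q4. exact TB. apply tends_const. }
assert (QG : Q_adjoin (gens_of g_lower14) G).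
{ assert (LG : laurent coeff_rat 1 G).
  { assert (Hk := subring_rat). apply laurent_mult; trivial. apply laurent_mult; trivial.
    - apply laurent_pow; trivial. now apply laurent_g.
    - apply laurent_pow; trivial. apply laurent_plus; trivial. now apply laurent_g. apply laurent_const.
      exact Hk. exists (- (16 # 1))%Q. rewrite Q2R_opp, RtoC_opp. f_equal. f_equal. unfold Q2R. simpl. field. }
  destruct LG as [m Hm]. apply (Q_adjoin_pole_at_infinity m G); trivial.
  - apply holo_mult; trivial. apply holo_mult; apply holo_pow. apply holo_g. apply holo_plus. apply holo_g. apply holo_const.
  - intros t Ht. unfold G. now rewrite F1, g_plus_1.
  - intros t Ht. unfold G. now rewrite F4, g_inv_S_plus_4.
  - exists (0 * (16 ^ M * 256 ^ M)). unfold G.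
    apply tends_ext with (fun t => (q4 t ^ M * F (inv_S t)) * (g_lower14 (inv_S t) ^ M * (256 * serB (- (1) * q4 t)) ^ M)).
    + intros t Ht. rewrite HS by trivial. rewrite (Cpow_mult_l (q4 t)). ring.
    + apply tends_mult; trivial. apply tends_mult; now apply tends_pow.
  (* At the third cusp g becomes 256 / g(t), which vanishes to first order in q = q4^4. Of the
     resulting 4M powers of q4, M are spent on the growth of F. *)
  - exists (0 * (0 ^ (3 * M) * (256 * 1) ^ M * (256 * 0 + - (16)) ^ M)). unfold G.
    apply tends_ext with (fun t => (q4 t ^ M * F (inv_S (inv_S t + 2))) * (q4 t ^ (3 * M) * (256 * serB (ee t)) ^ M * (256 * / g_lower14 t + - (16)) ^ M)).
    + intros t Ht. rewrite (g_cusp_half t Ht). rewrite (g_inv_serB t Ht) at 2.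
      replace (256 * (ee t * serB (ee t))) with (q4 t ^ 4 * (256 * serB (ee t))) by (rewrite q4_pow4; ring).
      rewrite (Cpow_mult_l (q4 t ^ 4)), <- Cpow_mult_r. replace (4 * M)%nat with (M + 3 * M)%nat by lia. rewrite Cpow_add_r. ring.
    + apply tends_mult; trivial. apply tends_mult. apply tends_mult; apply tends_pow. apply tends_q4.
      apply tends_mult. apply tends_const. apply tends_serB.
      apply tends_pow. apply tends_plus. apply tends_mult. apply tends_const. apply tends_g_inv. apply tends_const. }
(* g and g - 16 are units of the ring, so F is recovered from G. *)
apply Q_adjoin_eq with (fun t => G t * ((/ g_lower14 t) ^ M * (/ (g_lower14 t - 16)) ^ M)).
- apply Q_adjoin_mul; trivial. apply Q_adjoin_mul; apply Q_adjoin_pow, Q_adjoin_gen; simpl; tauto.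
- intros t Ht. unfold UHP in Ht. assert (N0 := g_neq_0 t Ht). assert (N16 := g_minus_16_neq_0 t Ht). unfold G.
  rewrite !Cpow_inv by trivial. change (g_lower14 t + - (16)) with (g_lower14 t - 16). field. split; now apply Cpow_nz.
Qed.

(** * The rings of modular functions *)
Lemma holomorphic_holo f : holomorphic f <-> holo f.
Proof.
split.
- intros H t Ht. assert (X := locally_singleton _ _ (H t Ht)). destruct X as [d Hd]. exists d. now apply cder_is_derive.
- intros H t Ht. exists (mkposreal _ Ht). intros w Hw. destruct (H w) as [d Hd].
  + destruct Hw as [_ Hw]. unfold ball in Hw; simpl in Hw. unfold AbsRing_ball, abs, minus, plus, opp in Hw; simpl in Hw.
    apply Rabs_def2 in Hw. unfold UHP, Im in *. lra.
  + now apply cder_ex with d.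
Qed.

Lemma im_moeb a b c d tau : (a * d - b * c = 1)%Z -> 0 < Im tau -> 0 < Im (moeb a b c d tau).
Proof.
intros D H. assert (N : RtoC (IZR c) * tau + RtoC (IZR d) <> 0). { apply UHP_affine; trivial. lia. }
assert (D' : (IZR a * IZR d - IZR b * IZR c = 1)%R) by (rewrite <- !mult_IZR, <- minus_IZR, D; reflexivity).
set (w := RtoC (IZR c) * tau + RtoC (IZR d)) in *. assert (Nw := proj1 (Cmod_gt_0 w) N).
assert (E : moeb a b c d tau = RtoC (/ (Cmod w ^ 2)) * ((RtoC (IZR a) * tau + RtoC (IZR b)) * Cconj w)).
{ assert (N2 : Cconj w <> 0). { apply Cmod_gt_0. now rewrite Cmod_conj. }
  rewrite RtoC_inv by (apply pow_nonzero; lra). rewrite RtoC_pow, <- RtoC_pow, Cmod2_conj. unfold moeb. fold w. field. now split. }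
rewrite E, im_scal_l. apply Rmult_lt_0_compat. apply Rinv_0_lt_compat. now apply pow_lt.
unfold w. destruct tau as [x y]. unfold Im in *. simpl in *.
match goal with |- 0 < ?z => replace z with ((IZR a * IZR d - IZR b * IZR c) * y)%R by ring end. rewrite D'. lra.
Qed.

Lemma mobius_moeb g tau : mobius g tau = moeb (sl_a g) (sl_b g) (sl_c g) (sl_d g) tau.
Proof. reflexivity. Qed.

Lemma im_mobius g tau : 0 < Im tau -> 0 < Im (mobius g tau).
Proof. intros H. apply im_moeb; trivial. apply (sl_det g). Qed.

(** The conditions of the two rings restated with germs instead of coefficient sequences; in this
    form they are visibly closed under sums and products. The number c is the step of the exponents
    of q at infinity. *)
Definition modular_with (G : SL2Z -> Prop) (c : R) (f : C -> C) : Prop :=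
  holo f /\ invariant_under G f /\ (forall g, laurent coeff_any (/ 4) (fun t => f (mobius g t))) /\ laurent coeff_rat c f.

Lemma Q_adjoin_modular G c gens f : (forall h, In h gens -> modular_with G c h) -> Q_adjoin gens f -> modular_with G c f.
Proof.
intros Hg H. assert (Ha := subring_any). assert (Hr := subring_rat).
induction H as [r|f Hf|f1 f2 _ (A1 & A2 & A3 & A4) _ (B1 & B2 & B3 & B4)|f1 f2 _ (A1 & A2 & A3 & A4) _ (B1 & B2 & B3 & B4)|f1 f2 _ (A1 & A2 & A3 & A4) E].
- repeat split. apply holo_const. intros g. apply laurent_const; trivial. exact I. apply laurent_const; trivial. now exists r.
- now apply Hg.
- repeat split. now apply holo_plus. intros g Gg t Ht. now rewrite A2, B2. intros g. now apply (laurent_plus _ Ha _ (fun t => f1 (mobius g t))).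
  now apply laurent_plus.
- repeat split. now apply holo_mult. intros g Gg t Ht. now rewrite A2, B2. intros g. now apply (laurent_mult _ Ha _ (fun t => f1 (mobius g t))).
  now apply laurent_mult.
- repeat split. now apply holo_ext with f1. intros g Gg t Ht. rewrite <- !E; trivial. now apply A2. now apply im_mobius.
  intros g. apply laurent_ext with (2 := A3 g). intros t Ht. apply E. now apply im_mobius.
  now apply laurent_ext with f1.
Qed.

Lemma coeff_rat_choice (a : nat -> C) : (forall n, coeff_rat (a n)) -> exists r : nat -> Q, forall n, a n = RtoC (Q2R (r n)).
Proof.
intros H. exists (fun n => proj1_sig (constructive_indefinite_description _ (H n))). intros n.
exact (proj2_sig (constructive_indefinite_description _ (H n))).
Qed.

Lemma modular_with_O G (h : positive) f : modular_with G (/ IZR (Zpos h)) f ->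
  (meromorphic f /\ invariant_under G f /\ meromorphic_at_cusps 4 f /\ rational_fourier_coefficients h f) /\ holomorphic f.
Proof.
intros (H1 & H2 & H3 & m & H4). apply holomorphic_holo in H1. repeat split; trivial.
- intros t Ht. left. now apply H1.
- intros g. destruct (H3 g) as [n Hn]. destruct (laurent_order_fourier _ 4 _ _ Hn) as (a & _ & Hf). now exists n, a.
- destruct (laurent_order_fourier _ h _ _ H4) as (a & Ha & Y & Hf). destruct (coeff_rat_choice a Ha) as [r Hr].
  exists m, r, Y. intros t Ht HM. cbv zeta. apply cps_is_pseries. apply cps_ext with a. exact Hr. apply cps_is_pseries. now apply Hf.
Qed.

Lemma gens_of_gen_fun x h : In h (gens_of x) -> exists i, h = (fun t => gen_fun i (x t)).
Proof. intros [<-|[<-|[<-|[]]]]. now exists 0%nat. now exists 1%nat. now exists 2%nat. Qed.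

Lemma holo_gen_fun (x : C -> C) i : holo x -> (forall t, 0 < Im t -> x t <> 0) -> (forall t, 0 < Im t -> x t - 16 <> 0) ->
  holo (fun t => gen_fun i (x t)).
Proof.
intros H N0 N16. destruct i as [|[|i]]; simpl; trivial. now apply holo_inv.
apply (holo_inv (fun t => x t - 16)); trivial. apply (holo_plus x); trivial. apply holo_const.
Qed.

Lemma g_modular i : modular_with (Gamma_lower1 4) (/ 1) (fun t => gen_fun i (g_lower14 t)).
Proof.
repeat split.
- apply holo_gen_fun. apply holo_g. apply g_neq_0. apply g_minus_16_neq_0.
- intros g (_ & Hc & _) t Ht. rewrite mobius_moeb, g_moeb; trivial. 2: apply (sl_det g).
  rewrite g_coset_0; trivial. apply Z.mod_divide; trivial. lia.
- intros g. apply laurent_ext with (2 := laurent_gens_coset (sl_c g) (sl_d g) i). intros t Ht.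
  rewrite mobius_moeb, g_moeb; trivial. apply (sl_det g).
- rewrite Rinv_1. now apply laurent_gens_g, subring_rat.
Qed.

Lemma g_upper_eq tau : g_upper14 tau = g_lower14 (tau / 4).
Proof. reflexivity. Qed.

(** Since fricke_val(g(z/4)) = g(S z), applying the involution twice turns the value at gamma tau
    into a value of g at S gamma tau, and S gamma has bottom row (a, b). This avoids conjugating
    gamma by tau -> 4 tau, which does not preserve SL_2(Z). *)
Lemma g_upper_moeb a b c d tau : (a * d - b * c = 1)%Z -> 0 < Im tau -> g_upper14 (moeb a b c d tau) = fricke_val (g_coset a b tau).
Proof.
intros D H. assert (Hm := im_moeb a b c d tau D H). assert (Hq : 0 < Im (moeb a b c d tau / 4)) by (rewrite im_quarter; lra).
rewrite g_upper_eq, <- (fricke_val_involutive (g_lower14 (moeb a b c d tau / 4))) by now apply g_minus_16_neq_0.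
rewrite <- g_inv_S by trivial. f_equal.
replace (inv_S (moeb a b c d tau)) with (moeb (- c) (- d) a b tau). apply g_moeb; trivial. lia.
assert (N1 := UHP_affine a b tau H ltac:(lia)). assert (N2 := UHP_affine c d tau H ltac:(lia)).
unfold inv_S, moeb. rewrite !opp_IZR, !RtoC_opp. field. now split.
Qed.

Lemma g_upper_modular i : modular_with (Gamma_upper1 4) (/ 4) (fun t => gen_fun i (g_upper14 t)).
Proof.
assert (Hq : forall t, 0 < Im t -> 0 < Im (t / 4)) by (intros t Ht; rewrite im_quarter; lra).
repeat split.
- apply (holo_gen_fun (fun t => g_lower14 (t / 4))).
  + apply holo_ext with (fun t => g_lower14 (RtoC (/ 4) * t)).
    intros t _. apply (f_equal g_lower14). rewrite RtoC_quarter. field. apply holo_scale. lra. apply holo_g.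
  + intros t Ht. now apply g_neq_0, Hq.
  + intros t Ht. now apply g_minus_16_neq_0, Hq.
- intros g (Ha & Hb & _) t Ht. rewrite mobius_moeb, g_upper_moeb; trivial. 2: apply (sl_det g). f_equal.
  (* On Gamma^1(4) the bottom row (a, b) has a odd and b divisible by 4, so the coset is that of the
     quarter shift 0, and the two applications of [fricke_val] cancel. *)
  rewrite g_coset_odd.
  + rewrite (g_quarter_mod _ 0); trivial. unfold g_quarter. rewrite Cplus_0_r, fricke_val_involutive; trivial. now apply g_minus_16_neq_0, Hq.
    destruct Hb as [k Hk]. exists (sl_a g * k)%Z. rewrite Hk. ring.
  + destruct Ha as [k Hk]. replace (sl_a g) with (1 + (2 * k) * 2)%Z by lia. now rewrite Z.mod_add.
- intros g. assert (T := laurent_gens_fricke (/ 4) _ (fun t Ht => proj1 (g_coset_neq_0 (sl_a g) (sl_b g) t Ht)) (fun t Ht => proj2 (g_coset_neq_0 (sl_a g) (sl_b g) t Ht)) (laurent_gens_coset _ _)).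
  apply laurent_ext with (2 := T i). intros t Ht. rewrite mobius_moeb, g_upper_moeb; trivial. apply (sl_det g).
- apply (laurent_quarter _ (fun t => gen_fun i (g_lower14 t))). now apply laurent_gens_g, subring_rat.
Qed.

Lemma fourier_laurent_any (h : positive) m f a : fourier_expansion h f m a -> laurent coeff_any (/ IZR (Zpos h)) f.
Proof. intros H. exists m. apply fourier_laurent_order with a; trivial. intros; exact I. Qed.

Lemma rational_laurent (h : positive) f : rational_fourier_coefficients h f -> laurent coeff_rat (/ IZR (Zpos h)) f.
Proof. intros (m & r & H). exists m. eapply fourier_laurent_order. 2: exact H. intros n. now exists (r n). Qed.

Definition mat_T (k : Z) : SL2Z := mkSL2Z 1 k 0 1 ltac:(lia).
Definition mat_L (k : Z) : SL2Z := mkSL2Z 1 0 k 1 ltac:(lia).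
Definition mat_S : SL2Z := mkSL2Z 0 (-1) 1 0 ltac:(lia).
Definition mat_upper_half : SL2Z := mkSL2Z 2 (-1) (-1) 1 ltac:(lia).

Lemma RtoC_m1 : RtoC (-1) = - RtoC 1.
Proof. now rewrite <- RtoC_opp. Qed.
Lemma RtoC_m2 : RtoC (-2) = - RtoC 2.
Proof. now rewrite <- RtoC_opp. Qed.

Lemma mobius_T k tau : mobius (mat_T k) tau = tau + RtoC (IZR k).
Proof. unfold mobius, mat_T. simpl. field. Qed.

Lemma mobius_S tau : 0 < Im tau -> mobius mat_S tau = inv_S tau.
Proof. intros H. assert (N := im_pos_neq_0 _ H). unfold mobius, mat_S, inv_S. simpl. rewrite RtoC_m1. field. trivial. Qed.

Lemma mobius_L_inv_S k tau : 0 < Im tau -> mobius (mat_L k) (inv_S (tau + RtoC (IZR k))) = inv_S tau.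
Proof.
intros H. assert (N := im_pos_neq_0 _ H). assert (N1 := UHP_neq tau (IZR k) H). unfold mobius, mat_L, inv_S. simpl. field.
now split.
Qed.

Lemma neq_0_inv_S_2 tau : 0 < Im tau -> - RtoC 2 * tau + 1 <> 0.
Proof.
intros H E. apply (UHP_affine (-2) 1 tau H). left. lia. rewrite <- E. rewrite <- RtoC_opp. reflexivity.
Qed.

Lemma mobius_L_m2 tau : 0 < Im tau -> mobius (mat_L (-2)) tau = inv_S (inv_S tau + 2).
Proof.
intros H. assert (N := im_pos_neq_0 _ H). assert (N2 := neq_0_inv_S_2 tau H).
unfold mobius, mat_L, inv_S. simpl. rewrite RtoC_m2. field. repeat split; trivial.
all: intros E; apply N2; try (rewrite <- E; ring).
all: replace (- RtoC 2 * tau + 1) with (- (RtoC (-1) + 2 * tau)) by (rewrite RtoC_m1; ring); rewrite <- (Cmult_0_r (- (1))), <- E; rewrite ?RtoC_m1; ring.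
Qed.

Lemma divide_0 n : (n | 0)%Z.
Proof. apply Z.divide_0_r. Qed.

Lemma O_lower_imp f : O_lower1 4 f -> Q_adjoin (gens_of g_lower14) f.
Proof.
intros [(_ & HI & HC & HR) HH]. apply holomorphic_holo in HH.
apply Q_adjoin_of_moderate_growth; trivial.
- intros t Ht. rewrite <- (HI (mat_T 1) ltac:(repeat split; simpl; apply divide_0) t Ht). now rewrite mobius_T.
- intros t Ht. rewrite <- (HI (mat_L 4) ltac:(repeat split; simpl; (apply divide_0 || apply Z.divide_refl)) (inv_S (t + 4))).
  now rewrite (mobius_L_inv_S 4). apply im_inv_S. now rewrite im_plus_RtoC.
- destruct (HC mat_S) as (m & a & Hf). destruct (laurent_tends coeff_any (/ 4) _ ltac:(lra) (fourier_laurent_any _ _ _ _ Hf)) as [n Hn].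
  exists n. apply tends_ext with (2 := Hn). intros t Ht. now rewrite mobius_S.
- destruct (HC (mat_L (-2))) as (m & a & Hf). destruct (laurent_tends coeff_any (/ 4) _ ltac:(lra) (fourier_laurent_any _ _ _ _ Hf)) as [n Hn].
  exists n. apply tends_ext with (2 := Hn). intros t Ht. now rewrite mobius_L_m2.
- apply rational_laurent in HR. now rewrite Rinv_1 in HR.
Qed.

Lemma Q_adjoin_quarter f : Q_adjoin (gens_of g_lower14) f -> Q_adjoin (gens_of g_upper14) (fun t => f (t / 4)).
Proof.
intros H. induction H as [r|f Hf|f1 f2 _ IH1 _ IH2|f1 f2 _ IH1 _ IH2|f1 f2 _ IH E].
- apply Q_adjoin_const.
- apply Q_adjoin_gen. destruct Hf as [<-|[<-|[<-|[]]]]; unfold gens_of. now left. right. now left. right. right. now left.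
- now apply (Q_adjoin_add _ (fun t => f1 (t / 4))).
- now apply (Q_adjoin_mul _ (fun t => f1 (t / 4))).
- apply Q_adjoin_eq with (1 := IH). intros t Ht. apply E. unfold UHP in *. rewrite im_quarter. lra.
Qed.

(** The map tau -> 4 S(S tau + 2) has the integral matrix with rows (4, 0) and (-2, 1). It factors
    as [mat_upper_half] times the matrix with rows (2, 1) and (0, 2), and the latter acts as the
    half shift. *)
Lemma mobius_upper_half tau : 0 < Im tau -> mobius mat_upper_half (tau + / 2) = 4 * inv_S (inv_S tau + 2).
Proof.
intros H. assert (N := im_pos_neq_0 _ H). assert (N2 := neq_0_inv_S_2 tau H).
rewrite <- mobius_L_m2 by trivial.
unfold mobius, mat_upper_half, mat_L. simpl. rewrite RtoC_m1, RtoC_m2. field. repeat split; trivial.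
all: intros E; apply N2; try (rewrite <- E; ring).
all: rewrite <- (Cmult_0_r 2), <- E; field.
Qed.

Lemma O_upper_imp f : O_upper1 4 f -> Q_adjoin (gens_of g_upper14) f.
Proof.
intros [(_ & HI & HC & HR) HH]. apply holomorphic_holo in HH.
assert (Q : Q_adjoin (gens_of g_lower14) (fun t => f (4 * t))).
{ apply Q_adjoin_of_moderate_growth.
  - apply (holo_scale f 4); trivial. lra.
  - intros t Ht. assert (H4 : 0 < Im (4 * t)) by (apply im_scal_pos; lra || trivial).
    rewrite <- (HI (mat_T 4) ltac:(repeat split; simpl; (apply divide_0 || apply Z.divide_refl)) (4 * t) H4).
    rewrite mobius_T. f_equal. ring.
  - intros t Ht. assert (Hq : 0 < Im (t / 4)) by (rewrite im_quarter; lra).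
    assert (E : forall s, 0 < Im s -> 4 * inv_S s = inv_S (s / 4)). { intros s Hs. unfold inv_S. field. now apply im_pos_neq_0. }
    rewrite !E by (trivial; now rewrite im_plus_RtoC). replace ((t + 4) / 4) with (t / 4 + 1) by field.
    rewrite <- (HI (mat_L 1) ltac:(repeat split; simpl; (apply divide_0 || apply Z.divide_refl)) (inv_S (t / 4 + 1))).
    now rewrite (mobius_L_inv_S 1). apply im_inv_S. now rewrite im_plus_RtoC.
  - destruct (HC mat_S) as (m & a & Hf). destruct (laurent_tends coeff_any (/ 4) _ ltac:(lra) (fourier_laurent_any _ _ _ _ Hf)) as [n Hn].
    apply tends_quarter in Hn. exists n.
    (* Here 4 S t = S(t/4), so the expansion proceeds in powers of q4(t/4). Since q4(t) = q4(t/4)^4,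
       the factor q4(t)^n contains the required n-th power with 3n to spare. *)
    apply tends_ext with (fun t => q4 (t / 4) ^ (3 * n) * (q4 (t / 4) ^ n * f (mobius mat_S (t / 4)))).
    + intros t Ht. assert (Hq : 0 < Im (t / 4)) by (rewrite im_quarter; lra). rewrite mobius_S by trivial.
      replace (q4 t ^ n) with (q4 (t / 4) ^ (3 * n) * q4 (t / 4) ^ n).
      2:{ rewrite <- Cpow_add_r. replace (3 * n + n)%nat with (4 * n)%nat by lia. rewrite Cpow_mult_r, q4_pow4. unfold q4.
          apply (f_equal (fun z => ee z ^ n)). rewrite RtoC_quarter. field. }
      replace (4 * inv_S t) with (inv_S (t / 4)). ring. unfold inv_S. field. now apply im_pos_neq_0.
    + apply tends_lim with (0 ^ (3 * n) * 0). ring. apply tends_mult. apply (tends_quarter (fun t => q4 t ^ (3 * n))). apply tends_pow, tends_q4. exact Hn.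
  - destruct (HC mat_upper_half) as (m & a & Hf). destruct (laurent_tends coeff_any (/ 4) _ ltac:(lra) (fourier_laurent_any _ _ _ _ Hf)) as [n Hn].
    apply tends_shift_half in Hn. exists n. set (z := q4 (/ 2)). assert (Nz : z <> 0) by apply ee_neq_0.
    (* The half shift multiplies q4 by the constant z = e(1/8), which is divided out. *)
    apply tends_ext with (fun t => / z ^ n * (q4 (t + / 2) ^ n * f (mobius mat_upper_half (t + / 2)))).
    + intros t Ht. rewrite mobius_upper_half by trivial. replace (q4 (t + / 2)) with (q4 t * z).
      rewrite Cpow_mult_l. field. now apply Cpow_nz. unfold z, q4. rewrite <- ee_plus. apply (f_equal ee). ring.
    + apply tends_lim with (/ z ^ n * 0). ring. apply tends_mult. apply tends_const. exact Hn.
  - apply rational_laurent in HR. destruct HR as (m & F & HF & Y & HY). exists m, F. split; trivial. exists Y. intros t Ht HM.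
    assert (H4 : 0 < Im (4 * t)) by (apply im_scal_pos; lra || trivial).
    replace (RtoC 1 * t) with (RtoC (/ 4) * (4 * t)) by (rewrite RtoC_quarter; field). apply HY; trivial. rewrite im_scal_l. lra. }
apply Q_adjoin_quarter in Q. apply Q_adjoin_eq with (1 := Q). intros t _. f_equal. field.
Qed.

Theorem theorem5p2 :
  (forall f : C -> C,
     O_lower1 4 f <->
     Q_adjoin (g_lower14 ::
               (fun tau => / g_lower14 tau) ::
               (fun tau => / (g_lower14 tau - 16)) :: nil) f)
  /\
  ((forall tau : C, UHP tau ->
      g_upper14 tau =
      / (siegel (1 # 4) 0 tau ^ 8) * siegel (1 # 2) 0 tau ^ 8)
   /\
   (forall f : C -> C,
      O_upper1 4 f <->
      Q_adjoin (g_upper14 ::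
                (fun tau => / g_upper14 tau) ::
                (fun tau => / (g_upper14 tau - 16)) :: nil) f)).
Proof.
split; [|split].
- intros f. split. apply O_lower_imp. intros H.
  apply (modular_with_O (Gamma_lower1 4) 1). apply Q_adjoin_modular with (2 := H).
  intros h Hh. destruct (gens_of_gen_fun g_lower14 h Hh) as [i ->]. apply g_modular.
- intros tau Ht. unfold g_upper14, g_lower14. replace (4 * (tau / 4)) with tau by field.
  assert (N : siegel (1 # 4) 0 tau <> 0).
  { rewrite siegel_theta by trivial. replace (Q2R (1 # 4)) with (/ 4)%R by (unfold Q2R; simpl; field).
    assert (X := theta_real_multiple_neq_0 tau (/ 4) Ht quarter_not_Z).
    apply Cmult_neq_0; trivial. intros E. apply (ee_neq_0 (RtoC (/ 2 * B2 (/ 4)) * tau)).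
    rewrite <- (Cmult_1_l (ee _)). replace (RtoC 1) with (- - RtoC 1) by ring. rewrite <- Copp_0, <- E. ring. }
  unfold Cdiv. rewrite Cpow_mult_l, Cpow_inv by trivial. apply Cmult_comm.
- intros f. split. apply O_upper_imp. intros H.
  apply (modular_with_O (Gamma_upper1 4) 4). apply Q_adjoin_modular with (2 := H).
  intros h Hh. destruct (gens_of_gen_fun g_upper14 h Hh) as [i ->]. apply g_upper_modular.
Qed.
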